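(* Let $\lambda\in(0,\infty)$, let $\alpha$ be a random variable with values in $(0,1)$, and let $(\alpha^{(1)},(X^{(1)}_k)_{k\in\mathbb Z_+})$ be a copy of $\alpha$ together with the associated randomized INAR(1) process with Poisson innovations (defined in the context). Put $\widetilde S^{(1)}_k:=X^{(1)}_k-\mathbb E(X^{(1)}_k\mid\alpha^{(1)})$. Then, in the sense of weak convergence of finite dimensional distributions, $$\biggl(n^{-\frac12}\sum_{k=1}^{\lfloor nt\rfloor}\widetilde S^{(1)}_k\biggr)_{t\in[0,\infty)}=\biggl(n^{-\frac12}\sum_{k=1}^{\lfloor nt\rfloor}\bigl(X^{(1)}_k-\mathbb E(X^{(1)}_k\mid\alpha^{(1)})\bigr)\biggr)_{t\in[0,\infty)}\longrightarrow\frac{\sqrt{\lambda(1+\alpha)}}{1-\alpha}\,B$$ as $n\to\infty$, where $B=(B_t)_{t\in[0,\infty)}$ is a standard Brownian motion, independent of $\alpha$.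
   Context: Randomized INAR(1) process: let $\lambda\in(0,\infty)$ and let $\alpha$ be a random variable with values in $(0,1)$. Let $X_0$, $\xi_{k,j}$, $\varepsilon_k$ ($k,j\in\mathbb N=\{1,2,\dots\}$) be random variables which are conditionally independent given $\alpha$ and such that, conditionally on $\alpha$, each $\xi_{k,j}$ is Bernoulli with $\mathbb P(\xi_{k,j}=1\mid\alpha)=\alpha=1-\mathbb P(\xi_{k,j}=0\mid\alpha)$, each $\varepsilon_k$ is Poisson with parameter $\lambda$, and $X_0$ is Poisson with parameter $\lambda/(1-\alpha)$. Define $X_k=\sum_{j=1}^{X_{k-1}}\xi_{k,j}+\varepsilon_k$, $k\in\mathbb N$ (with $\sum_{j=1}^0:=0$). $(\alpha^{(1)},(X^{(1)}_k)_{k\in\mathbb Z_+})$ is a copy of $(\alpha,(X_k)_{k\in\mathbb Z_+})$, where $\mathbb Z_+=\{0,1,2,\dots\}$. Conditional expectations are in the generalized sense, and $\mathbb E(X^{(1)}_k\mid\alpha^{(1)})=\lambda/(1-\alpha^{(1)})$. *)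

(* Defs.v *)
From HB Require Import structures.
From mathcomp Require Import all_boot all_order all_algebra.
From mathcomp Require Import all_classical all_reals all_analysis.
From mathcomp Require Import measurable_realfun.


Import Order.TTheory GRing.Theory Num.Theory.
Import numFieldNormedType.Exports.

Local Open Scope classical_set_scope.
Local Open Scope ring_scope.

Definition same_law {R : realType} {d1 d2 d} {T1 : measurableType d1}
    {T2 : measurableType d2} {E : measurableType d}
    (P1 : probability T1 R) (X1 : T1 -> E)
    (P2 : probability T2 R) (X2 : T2 -> E) : Prop :=
  forall A : set E, measurable A -> P1 (X1 @^-1` A) = P2 (X2 @^-1` A).

Definition coordinate_sets {d} (E : measurableType d) : set (set (nat -> E)) :=
  [set C | exists k : nat, exists2 B : set E,
     measurable B & C = (fun x : nat -> E => x k) @^-1` B].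

Definition seq_space {d} (E : measurableType d) :=
  g_sigma_algebraType (coordinate_sets E).

(* Generalized conditional expectation: Y is a version of E(X | G) for an
   extended real variable X whose negative part is integrable; X itself need
   not be integrable. *)
Definition is_cond_exp {R : realType} {d} {T : measurableType d}
    (P : probability T R) (G : set (set T)) (X Y : T -> \bar R) : Prop :=
  [/\ (\int[P]_w X^\- w < +oo)%E,
      (\int[P]_w Y^\- w < +oo)%E,
      forall B : set (\bar R), measurable B -> G (Y @^-1` B)
    & forall A, G A -> (\int[P]_(w in A) Y w = \int[P]_(w in A) X w)%E].

Definition is_cond_prob {R : realType} {d} {T : measurableType d}
    (P : probability T R) (G : set (set T)) (A : set T) (q : T -> R) : Prop :=
  is_cond_exp P G (EFin \o \1_A) (EFin \o q).

(* The versions q i are only determined almost surely, and so is the product;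
   hence the quantification over all of them. *)
Definition cond_indep {R : realType} {d d'} {T : measurableType d}
    {E : measurableType d'} (P : probability T R) (G : set (set T))
    {I : eqType} (Z : I -> T -> E) : Prop :=
  forall (J : seq I) (B : I -> set E) (q : I -> T -> R),
    uniq J ->
    (forall i, i \in J -> measurable (B i)) ->
    (forall i, i \in J -> is_cond_prob P G (Z i @^-1` B i) (q i)) ->
    is_cond_prob P G (\bigcap_(i in [set` J]) (Z i @^-1` B i))
      (fun w => \prod_(i <- J) q i w).

Definition inar1_inputs {T : Type} (X0 : T -> nat) (xi : nat -> nat -> T -> nat)
    (eps : nat -> T -> nat)
    (i : option (nat * nat + nat)) : T -> nat :=
  match i with
  | None => X0
  | Some (inl (k, j)) => xi k j
  | Some (inr k) => eps k
  end.

(* Indices are shifted by one: xi k j and eps k are the variables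
   $\xi_{k+1,j+1}$ and $\varepsilon_{k+1}$ of the usual 1-based notation. *)
Fixpoint inar1 {T : Type} (X0 : T -> nat) (xi : nat -> nat -> T -> nat)
    (eps : nat -> T -> nat) (k : nat) (w : T) : nat :=
  if k is k'.+1 then
    (\sum_(j < inar1 X0 xi eps k' w) xi k' j w + eps k' w)%N
  else X0 w.

Record randomized_inar1_inputs {R : realType} {d} {T : measurableType d}
    (P : probability T R) (lambda : R)
    (alpha : {RV P >-> R}) (X0 : {RV P >-> nat})
    (xi : nat -> nat -> {RV P >-> nat}) (eps : nat -> {RV P >-> nat}) : Prop :=
  RandomizedInar1Inputs {
  inputs_cond_indep : cond_indep P (g_sigma_algebra_preimage alpha)
    (inar1_inputs X0 xi eps) ;
  xi_bernoulli1 : forall k j,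
    is_cond_prob P (g_sigma_algebra_preimage alpha)
      (xi k j @^-1` [set 1%N]) alpha ;
  xi_bernoulli0 : forall k j,
    is_cond_prob P (g_sigma_algebra_preimage alpha)
      (xi k j @^-1` [set 0%N]) (fun w => 1 - alpha w) ;
  eps_poisson : forall k m,
    is_cond_prob P (g_sigma_algebra_preimage alpha)
      (eps k @^-1` [set m]) (fun=> poisson_pmf lambda m) ;
  X0_poisson : forall m,
    is_cond_prob P (g_sigma_algebra_preimage alpha)
      (X0 @^-1` [set m]) (fun w => poisson_pmf (lambda / (1 - alpha w)) m)
}.

Definition indep_family {R : realType} {d d'} {T : measurableType d}
    {E : measurableType d'} (P : probability T R)
    {I : eqType} (Z : I -> T -> E) : Prop :=
  forall (J : seq I) (B : I -> set E),
    uniq J -> (forall i, i \in J -> measurable (B i)) ->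
    P (\bigcap_(i in [set` J]) (Z i @^-1` B i)) =
      (\prod_(i <- J) P (Z i @^-1` B i))%E.

(* Processes indexed by [0, +oo[ are functions on R of which only the values
   at nonnegative times matter. *)
Record standard_brownian_motion {R : realType} {d} {T : measurableType d}
    (P : probability T R) (B : R -> {RV P >-> R}) : Prop :=
  StandardBrownianMotion {
  bm_start : {ae P, forall w, B 0 w = 0} ;
  bm_indep_increments : forall t : nat -> R,
    0 <= t 0%N -> {homo t : i j / (i <= j)%N >-> i <= j} ->
    indep_family P (fun (i : nat) w => B (t i.+1) w - B (t i) w) ;
  bm_normal_increments : forall s t : R, 0 <= s -> s < t ->
    forall A : set R, measurable A ->
      P ((fun w => B t w - B s w) @^-1` A) =
        normal_prob 0 (Num.sqrt (t - s)) A ;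
  bm_continuous_paths :
    {ae P, forall w, {within `[0, +oo[, continuous (fun t : R => B t w)}}
}.

Definition process_sigma_algebra {R : realType} {d} {T : measurableType d}
    (B : R -> T -> R) : set (set T) :=
  <<s \bigcup_(t in `[0, +oo[) g_sigma_algebra_preimage (B t) >>.

Definition indep_of_process {R : realType} {d} {T : measurableType d}
    (P : probability T R) (a : T -> R) (B : R -> T -> R) : Prop :=
  forall A C, g_sigma_algebra_preimage a A -> process_sigma_algebra B C ->
    P (A `&` C) = (P A * P C)%E.

(* For t >= 0, Num.truncn (n%:R * t) is the integer part of n t. *)
Definition partial_sum_process {R : realType} {T : Type}
    (S : nat -> T -> R) (n : nat) (t : R) (w : T) : R :=
  (Num.sqrt n%:R)^-1 * \sum_(1 <= k < (Num.truncn (n%:R * t)).+1) S k w.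

Definition fdd_cvg {R : realType} {d d'} {T : measurableType d}
    {T' : measurableType d'}
    (P : probability T R) (Z : nat -> R -> T -> R)
    (P' : probability T' R) (Y : R -> T' -> R) : Prop :=
  forall (m : nat) (t : 'I_m -> R), (forall i, 0 <= t i) ->
  forall f : 'rV[R]_m -> R,
    continuous f -> (exists M : R, forall x, `|f x| <= M) ->
    ('E_P[fun w => f (\row_i Z n (t i) w)]%E) @[n --> \oo] -->
      ('E_P'[fun w => f (\row_i Y (t i) w)]%E).

(* Main.v *)
Require Import Defs.
From HB Require Import structures.
From mathcomp Require Import all_boot all_order all_algebra.
From mathcomp Require Import all_classical all_reals all_analysis.
From mathcomp Require Import measurable_realfun.
From mathcomp Require Import ring lra zify complex.

Set Implicit Arguments.
Unset Strict Implicit.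
Unset Printing Implicit Defensive.

Import Order.TTheory GRing.Theory Num.Theory.
Import numFieldNormedType.Exports.

Local Open Scope classical_set_scope.
Local Open Scope ring_scope.

Local Notation Re := complex.Re.
Local Notation Im := complex.Im.

(** Given the value a of the parameter, the process is a stationary
    autoregression with Poisson innovations, and the law of its first values has
    an explicit generating function. Integrating out the values from the last to
    the first, the argument w attached to the value at time k + 1 contributes a
    Poisson factor exp (lambda (w - 1)) and changes the argument attached to the
    value at time k from z to z (1 + a (w - 1)); the initial Poisson law
    contributes the last factor. The logarithm [log_pgf] of the generating
    function is thus a sum over the steps of a first order recursion. The
    parameter is never fixed in the proof: all identities are between means of
    bounded functions multiplied by an arbitrary bounded function of the
    parameter ([inar1_pgf]), which is what conditional independence provides
    ([inputs_cond_free]).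

    A linear combination of the partial sums at times t_i is a weighted sum of
    the values with weights c_k, which are constant up to boundedly many jumps.
    At the arguments z_k = exp (i tau c_k), tau = n ^ (-1/2), the increments v_k
    of the recursion satisfy v_k = i tau c_k + a v_(k+1) to first order, hence
    are close to i tau c_k / (1 - a) away from the jumps. To second order the
    logarithm is then

      i tau (lambda / (1 - a)) sum c_k
        - (lambda / (1 - a)) (1/2 + a / (1 - a)) tau^2 sum c_k^2,

    where the first term is cancelled by the centring and the second converges
    to half of lambda (1 + a) / (1 - a)^2 times the covariance form
    sum theta_i theta_j min (t_i, t_j) of Brownian motion, with a minus sign
    ([cvg_log_pgf]). No moment of the process is used, which matters since it
    may have none when the parameter is close to 1. By dominated convergence the
    characteristic functions of the marginals converge to the mean of the
    exponential of this limit ([cvg_cmean_cis_partial_sums]), which is the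
    characteristic function of the Brownian motion scaled by an independent
    random factor ([cmean_cis_brownian_mixture]).

    Convergence of characteristic functions implies convergence in law
    ([levy_continuity]). Trigonometric polynomials approximate a bounded
    continuous function uniformly on boxes: fold each axis by a sine and take a
    Bernstein polynomial ([trig_poly_approx]). Tightness follows from
    E exp (- u^2 Z^2 / 2), which is a Gaussian mixture of values of the
    characteristic function of Z.

    Finally the centring is only given as a version of the conditional
    expectation in the generalized sense. It is identified almost surely with
    lambda / (1 - alpha) on each event where the latter is bounded, by
    differentiating the generating function at 1 ([integral_inar1],
    [cond_exp_unique]). *)

(** * Means of bounded real functions *)

Section BoundedMfun.
Context {R : realType} {d} {T : measurableType d}.
Implicit Types (f g : T -> R).

Definition bounded_mfun f : Prop :=
  measurable_fun setT f /\ exists M : R, forall w, `|f w| <= M.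

Lemma bounded_mfun_cst c : bounded_mfun (fun=> c).
Proof. by split; [exact: measurable_cst | exists `|c|]. Qed.

Lemma bounded_mfunD f g :
  bounded_mfun f -> bounded_mfun g -> bounded_mfun (fun w => f w + g w).
Proof.
move=> [mf [M fM]] [mg [N gN]]; split; first exact: measurable_funD.
by exists (M + N) => w; rewrite (le_trans (ler_normD _ _))// lerD.
Qed.

Lemma bounded_mfunN f : bounded_mfun f -> bounded_mfun (fun w => - f w).
Proof.
move=> [mf [M fM]]; split; first exact: measurable_funN.
by exists M => w; rewrite normrN.
Qed.

Lemma bounded_mfunB f g :
  bounded_mfun f -> bounded_mfun g -> bounded_mfun (fun w => f w - g w).
Proof. by move=> bf bg; apply: bounded_mfunD => //; exact: bounded_mfunN. Qed.

Lemma bounded_mfunM f g :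
  bounded_mfun f -> bounded_mfun g -> bounded_mfun (fun w => f w * g w).
Proof.
move=> [mf [M fM]] [mg [N gN]]; split; first exact: measurable_funM.
exists (M * N) => w; rewrite normrM ler_pM//.
Qed.

Lemma bounded_mfun_sum (I : Type) (s : seq I) (F : I -> T -> R) :
  (forall i, bounded_mfun (F i)) -> bounded_mfun (fun w => \sum_(i <- s) F i w).
Proof.
move=> bF; elim: s => [|i s IH].
  by under eq_fun do rewrite big_nil; exact: bounded_mfun_cst.
by under eq_fun do rewrite big_cons; exact: bounded_mfunD.
Qed.

Lemma bounded_mfun_indic (A : set T) :
  measurable A -> bounded_mfun (\1_A : T -> R).
Proof.
move=> mA; split; first exact: measurable_indic.
by exists 1 => w; rewrite indicE; case: (_ \in _); rewrite ?normr1 ?normr0.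
Qed.

(** A function that looks up the index of a measurable function in a
    measurable integer is measurable, because it is measurable on each of the
    countably many level sets of that integer. *)
Lemma measurable_fun_nat_index d' (U : measurableType d') (X : T -> nat)
    (F : nat -> T -> U) :
  measurable_fun setT X -> (forall n, measurable_fun setT (F n)) ->
  measurable_fun setT (fun w => F (X w) w).
Proof.
move=> mX mF _ B mB; rewrite setTI.
rewrite (_ : _ @^-1` B = \bigcup_n (X @^-1` [set n] `&` F n @^-1` B)).
  apply: bigcupT_measurable => n; apply: measurableI.
    by rewrite -[_ @^-1` _]setTI; exact: mX.
  by rewrite -[_ @^-1` _]setTI; exact: mF.
apply/seteqP; split => w /=; first by move=> FB; exists (X w).
by move=> [n _ /= [<-]].
Qed.

End BoundedMfun.

Section Mean.
Context {R : realType} {d} {T : measurableType d} (P : probability T R).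
Implicit Types (f g : T -> R).
Local Notation mean f := (\int[P]_w f w).

Lemma bounded_mfun_integrable f : bounded_mfun f -> P.-integrable setT (EFin \o f).
Proof.
move=> [mf [M fM]]; apply: measurable_bounded_integrable => //.
  exact: (@le_lt_trans _ _ 1%E (P setT) +oo%E (probability_le1 P measurableT) (ltry 1)).
exists M; split; first exact: num_real.
by move=> x Mx w _ /=; rewrite (le_trans (fM w))// ltW.
Qed.

Lemma bounded_mfun_expectation f : bounded_mfun f -> 'E_P[f]%E = (mean f)%:E.
Proof.
move=> bf; rewrite unlock /Rintegral fineK//.
exact: (@integrable_fin_num _ _ _ P setT measurableT _ (bounded_mfun_integrable bf)).
Qed.

Lemma meanD f g : bounded_mfun f -> bounded_mfun g ->
  mean (fun w => f w + g w) = mean f + mean g.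
Proof. by move=> bf bg; rewrite RintegralD//; exact: bounded_mfun_integrable. Qed.

Lemma meanB f g : bounded_mfun f -> bounded_mfun g ->
  mean (fun w => f w - g w) = mean f - mean g.
Proof. by move=> bf bg; rewrite RintegralB//; exact: bounded_mfun_integrable. Qed.

Lemma meanZ c f : bounded_mfun f -> mean (fun w => c * f w) = c * mean f.
Proof. by move=> bf; rewrite RintegralZl//; exact: bounded_mfun_integrable. Qed.

Lemma meanN f : bounded_mfun f -> mean (fun w => - f w) = - mean f.
Proof.
move=> bf; rewrite -mulN1r -meanZ//.
by apply: eq_Rintegral => w _; rewrite mulN1r.
Qed.

Lemma mean_cst c : mean (fun=> c) = c.
Proof.
rewrite Rintegral_cst//.
by rewrite [X in _ * X](congr1 fine (probability_setT P)) mulr1.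
Qed.

Lemma mean_sum (I : Type) (s : seq I) (F : I -> T -> R) :
  (forall i, bounded_mfun (F i)) ->
  mean (fun w => \sum_(i <- s) F i w) = \sum_(i <- s) mean (F i).
Proof.
move=> bF; elim: s => [|i s IH].
  rewrite big_nil -[RHS]mean_cst; apply: eq_Rintegral => w _.
  by rewrite big_nil.
rewrite big_cons -IH -meanD//; last exact: bounded_mfun_sum.
by apply: eq_Rintegral => w _; rewrite big_cons.
Qed.

Lemma le_mean f g : bounded_mfun f -> bounded_mfun g ->
  (forall w, f w <= g w) -> mean f <= mean g.
Proof. by move=> bf bg fg; apply: le_Rintegral => //; exact: bounded_mfun_integrable. Qed.

Lemma le_normr_mean f g : bounded_mfun f -> bounded_mfun g ->
  (forall w, `|f w| <= g w) -> `|mean f| <= mean g.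
Proof.
move=> bf bg fg; rewrite ler_norml; apply/andP; split.
  rewrite -meanN//; apply: le_mean => //; first exact: bounded_mfunN.
  by move=> w; have := fg w; rewrite ler_norml => /andP[].
apply: le_mean => // w; by have := fg w; rewrite ler_norml => /andP[].
Qed.

Lemma mean_indic A : measurable A -> mean (\1_A : T -> R) = fine (P A).
Proof.
move=> mA; rewrite /Rintegral.
by rewrite integral_indic// setIT.
Qed.

(** Dominated convergence, with a constant as the dominating function. *)
Lemma cvg_mean (f_ : nat -> T -> R) f M :
  (forall n, measurable_fun setT (f_ n)) ->
  (forall n w, `|f_ n w| <= M) ->
  (forall w, f_ n w @[n --> \oo] --> f w) ->
  bounded_mfun f /\ mean (f_ n) @[n --> \oo] --> mean f.
Proof.
move=> mf fM fcvg.
have mlim : measurable_fun setT f.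
  by apply: (@measurable_fun_cvg _ _ _ setT f_) => // w _; exact: fcvg.
have bf : bounded_mfun f.
  split=> //; exists M => w.
  have nfcvg : `|f_ n w| @[n --> \oo] --> `|f w| by exact: cvg_norm (fcvg w).
  rewrite -(cvg_lim _ nfcvg)//; apply: limr_le; first by apply/cvg_ex; exists `|f w|.
  by near=> n; exact: fM.
split=> //.
have mfE n : measurable_fun setT (EFin \o f_ n) by exact/measurable_EFinP.
have fE : {ae P, forall w, setT w -> (EFin \o f_ n) w @[n --> \oo] --> (EFin \o f) w}.
  by apply: aeW => w _; apply: cvg_EFin; [exact: nearW | exact: fcvg].
have fME : {ae P, forall w n, setT w -> (`|(EFin \o f_ n) w| <= cst M%:E w)%E}.
  by apply: aeW => w n _; rewrite /= lee_fin.
have [_ _ h] := dominated_convergence measurableT mfE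
  ((measurable_EFinP _ _).2 mlim) fE
  (finite_measure_integrable_cst P M measurableT) fME.
apply: fine_cvg; rewrite [in X in _ --> X]/= fineK//.
exact: (integrable_fin_num measurableT (bounded_mfun_integrable bf)).
Unshelve. all: by end_near. Qed.

End Mean.

(** * From indicators to bounded functions, and complex means *)

Section Extension.
Context {R : realType} {d} {T : measurableType d} (P : probability T R).
Implicit Types (f g : T -> R).
Local Notation mean f := (\int[P]_w f w).

Lemma bounded_mfun_comp (Y : T -> R) (g : R -> R) (M : R) :
  measurable_fun setT Y -> measurable_fun setT g ->
  (forall w, `|g (Y w)| <= M) -> bounded_mfun (fun w => g (Y w)).
Proof. by move=> mY mg gM; split; [exact: measurableT_comp | exists M]. Qed.

(** Counting the multiples of a small step that lie below [x] rounds it with a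
    uniformly small error; applied to a function, it gives a finite combination
    of indicators of preimages. *)
Lemma layer_count_error (K N : nat) (x : R) : 0 <= x <= K%:R ->
  `|N.+1%:R^-1 * (\sum_(j < K * N.+1) (j.+1%:R <= N.+1%:R * x)%R%:R) - x|
    <= N.+1%:R^-1.
Proof.
move=> /andP[x0 xK]; have N0 : 0 < N.+1%:R :> R by rewrite ltr0n.
have y0 : 0 <= N.+1%:R * x by rewrite mulr_ge0// ltW.
pose t := Num.truncn (N.+1%:R * x).
have sumE n : \sum_(j < n) (j.+1%:R <= N.+1%:R * x)%R%:R = (minn n t)%:R :> R.
  elim: n => [|n IH]; first by rewrite big_ord0 min0n.
  rewrite big_ord_recr /= IH -truncn_ge_nat// -/t -natrD; congr (_%:R).
  by case: ltnP => nt; rewrite /minn; do 2 case: ltnP; move=> *; lia.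
rewrite sumE (minn_idPr _); last first.
  rewrite -(ler_nat R) (le_trans (_ : t%:R <= N.+1%:R * x))//.
    by rewrite truncn_le.
  by rewrite natrM mulrC ler_pM2r.
have /andP[t1 t2] := truncn_itv y0; rewrite -/t in t1 t2.
rewrite -(ler_pM2l N0) -[X in X * `| _ |]gtr0_norm// -normrM mulrBr mulVKf ?gt_eqF//.
rewrite divff ?gt_eqF// ler_norml; move: t2; rewrite -natr1 => t2.
by apply/andP; split; lra.
Qed.

(** Bounded functions of [Y] are uniform limits of combinations of indicators of
    events about [Y]. *)
Lemma mean_preimage_ext (Y : T -> R) (f1 f2 : T -> R) (g : R -> R) (M : R) :
  measurable_fun setT Y -> bounded_mfun f1 -> bounded_mfun f2 ->
  (forall A, measurable A -> mean (fun w => \1_(Y @^-1` A) w * f1 w) =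
                             mean (fun w => \1_(Y @^-1` A) w * f2 w)) ->
  measurable_fun setT g -> (forall w, `|g (Y w)| <= M) ->
  mean (fun w => g (Y w) * f1 w) = mean (fun w => g (Y w) * f2 w).
Proof.
move=> mY bf1 bf2 f12 mg gM.
have bgY := bounded_mfun_comp mY mg gM.
have [mf1 [C1 f1C]] := bf1; have [mf2 [C2 f2C]] := bf2.
pose L := (Num.truncn M).+1.
have gL w : 0 <= g (Y w) + L%:R <= (2 * L)%:R.
  have := gM w; have := truncnS_gt M; rewrite -/L ler_norml natrM => ML /andP[].
  by move=> *; apply/andP; split; lra.
(* The shift by [L] makes [g] nonnegative before it is rounded. *)
pose A (N j : nat) := [set y | j.+1%:R <= N.+1%:R * (g y + L%:R)].
have mA N j : measurable (A N j).
  pose h y := N.+1%:R * (g y + L%:R).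
  have mh : measurable_fun setT h.
    by apply: measurable_funM => //; exact: measurable_funD.
  have -> : A N j = h @^-1` `[j.+1%:R, +oo[.
    by apply/seteqP; split => y; rewrite /A /= in_itv/= andbT.
  by rewrite -[_ @^-1` _]setTI; exact: mh.
have mYA N j : measurable (Y @^-1` A N j).
  by rewrite -[_ @^-1` _]setTI; exact: mY.
pose gN N w : R := N.+1%:R^-1 *
  (\sum_(j < 2 * L * N.+1) \1_(Y @^-1` A N j) w) - L%:R.
have bgN N : bounded_mfun (gN N).
  apply: bounded_mfunB; last exact: bounded_mfun_cst.
  apply: bounded_mfunM; first exact: bounded_mfun_cst.
  by apply: bounded_mfun_sum => j; exact: bounded_mfun_indic.
have gNE N w : `|gN N w - g (Y w)| <= N.+1%:R^-1.
  rewrite /gN -addrA -opprD [L%:R + _]addrC.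
  rewrite (eq_bigr (fun j : 'I__ => (j.+1%:R <= N.+1%:R * (g (Y w) + L%:R))%R%:R)).
    exact: layer_count_error.
  by move=> j _; rewrite indicE /A/= mem_setE.
have gNf N f : bounded_mfun f -> mean (fun w => gN N w * f w) = N.+1%:R^-1 *
    (\sum_(j < 2 * L * N.+1) mean (fun w => \1_(Y @^-1` A N j) w * f w)) -
    L%:R * mean f.
  move=> bf; have b1 j : bounded_mfun (fun w => \1_(Y @^-1` A N j) w * f w).
    by apply: bounded_mfunM => //; exact: bounded_mfun_indic.
  rewrite -mean_sum// -!meanZ//; last exact: bounded_mfun_sum.
  rewrite -meanB; last 2 first.
  - apply: bounded_mfunM; first exact: bounded_mfun_cst.
    exact: bounded_mfun_sum.
  - by apply: bounded_mfunM => //; exact: bounded_mfun_cst.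
  apply: eq_Rintegral => w _.
  by rewrite /gN mulrBl -mulrA mulr_suml.
have err N (f : T -> R) (C : R) : bounded_mfun f -> (forall w, `|f w| <= C) ->
    `|mean (fun w => gN N w * f w) - mean (fun w => g (Y w) * f w)|
      <= N.+1%:R^-1 * C.
  move=> bf fC; rewrite -meanB; [|exact: bounded_mfunM..].
  rewrite -[leRHS](mean_cst P); apply: le_normr_mean.
  - by apply: bounded_mfunB; exact: bounded_mfunM.
  - exact: bounded_mfun_cst.
  - by move=> w; rewrite -mulrBl normrM ler_pM.
have mN N : mean (fun w => gN N w * f1 w) = mean (fun w => gN N w * f2 w).
  rewrite !gNf//; congr (_ * _ - _ * _).
    by apply: eq_bigr => j _; exact: f12.
  have := f12 setT measurableT; rewrite preimage_setT.
  have E f : mean (fun w => \1_[set: T] w * f w) = mean f.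
    by apply: eq_Rintegral => w _; rewrite indicT mul1r.
  by rewrite !E.
apply/eqP; rewrite -subr_eq0 -normr_le0.
suff H (e : R) : 0 < e ->
    `|mean (fun w => g (Y w) * f1 w) - mean (fun w => g (Y w) * f2 w)| <= e.
  by apply/ler_addgt0Pl => e e0; rewrite addr0; exact: H.
move=> e0.
have C0 : 0 <= C1 + C2.
  apply: addr_ge0; first exact: le_trans (normr_ge0 _) (f1C point).
  exact: le_trans (normr_ge0 _) (f2C point).
have [N NP] : exists N : nat, (C1 + C2) / e < N.+1%:R.
  by exists (Num.truncn ((C1 + C2) / e)); exact: truncnS_gt.
have := err N f1 C1 bf1 f1C; have := err N f2 C2 bf2 f2C.
rewrite -mN !ler_norml => /andP[a1 a2] /andP[b1 b2].
have : N.+1%:R^-1 * (C1 + C2) <= e.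
  by rewrite mulrC ler_pdivrMr ?ltr0n// mulrC -ler_pdivrMr// ltW.
have aux (a x y p q r : R) : - p <= a - y -> a - y <= p -> - q <= a - x ->
    a - x <= q -> q + p <= r -> - r <= x - y <= r.
  by move=> *; apply/andP; split; lra.
by rewrite mulrDr => h; exact: aux a1 a2 b1 b2 h.
Qed.

End Extension.

Section ComplexBounded.
Context {R : realType} {d} {T : measurableType d}.
Local Notation C := R[i].
Implicit Types (F G : T -> C).

Lemma cReD (x y : C) : Re (x + y) = Re x + Re y.
Proof. by case: x => a b; case: y. Qed.

Lemma cImD (x y : C) : Im (x + y) = Im x + Im y.
Proof. by case: x => a b; case: y. Qed.

Lemma cReM (x y : C) : Re (x * y) = Re x * Re y - Im x * Im y.
Proof. by case: x => a b; case: y. Qed.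

Lemma cImM (x y : C) : Im (x * y) = Re x * Im y + Im x * Re y.
Proof. by case: x => a b; case: y. Qed.

Lemma complex_ext (x y : C) : Re x = Re y -> Im x = Im y -> x = y.
Proof. by case: x => a b; case: y => c e /= -> ->. Qed.

Definition cbounded F : Prop :=
  bounded_mfun (fun w => Re (F w)) /\ bounded_mfun (fun w => Im (F w)).

Lemma cbounded_cst (c : C) : cbounded (fun=> c).
Proof. by split; exact: bounded_mfun_cst. Qed.

Lemma cbounded_real (f : T -> R) : bounded_mfun f -> cbounded (fun w => (f w)%:C%C).
Proof. by move=> bf; split => //=; exact: bounded_mfun_cst. Qed.

Lemma cboundedD F G : cbounded F -> cbounded G -> cbounded (fun w => F w + G w).
Proof.
move=> [F1 F2] [G1 G2]; split.
  by under eq_fun do rewrite cReD; exact: bounded_mfunD.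
by under eq_fun do rewrite cImD; exact: bounded_mfunD.
Qed.

Lemma cboundedM F G : cbounded F -> cbounded G -> cbounded (fun w => F w * G w).
Proof.
move=> [F1 F2] [G1 G2]; split.
  by under eq_fun do rewrite cReM; apply: bounded_mfunB; exact: bounded_mfunM.
by under eq_fun do rewrite cImM; apply: bounded_mfunD; exact: bounded_mfunM.
Qed.

Lemma cbounded_sum (I : Type) (s : seq I) (F : I -> T -> C) :
  (forall i, cbounded (F i)) -> cbounded (fun w => \sum_(i <- s) F i w).
Proof.
move=> bF; elim: s => [|i s IH].
  by under eq_fun do rewrite big_nil; exact: cbounded_cst.
by under eq_fun do rewrite big_cons; exact: cboundedD.
Qed.

Lemma cbounded_prod (I : Type) (s : seq I) (F : I -> T -> C) :
  (forall i, cbounded (F i)) -> cbounded (fun w => \prod_(i <- s) F i w).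
Proof.
move=> bF; elim: s => [|i s IH].
  by under eq_fun do rewrite big_nil; exact: cbounded_cst.
by under eq_fun do rewrite big_cons; exact: cboundedM.
Qed.

Lemma cbounded_indic (A : set T) :
  measurable A -> cbounded (fun w => (\1_A w)%:C%C).
Proof. by move=> mA; apply: cbounded_real; exact: bounded_mfun_indic. Qed.

End ComplexBounded.

Section ComplexMean.
Context {R : realType} {d} {T : measurableType d} (P : probability T R).
Local Notation C := R[i].
Implicit Types (F G : T -> C).

Definition cmean F : C := ((\int[P]_w Re (F w)) +i* (\int[P]_w Im (F w)))%C.

Lemma eq_cmean F G : F =1 G -> cmean F = cmean G.
Proof. by move=> /funext ->. Qed.

Lemma cmeanD F G : cbounded F -> cbounded G ->
  cmean (fun w => F w + G w) = cmean F + cmean G.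
Proof.
move=> [F1 F2] [G1 G2]; apply: complex_ext => /=.
  by rewrite -meanD//; apply: eq_Rintegral => w _; rewrite cReD.
by rewrite -meanD//; apply: eq_Rintegral => w _; rewrite cImD.
Qed.

Lemma cmean_cst (c : C) : cmean (fun=> c) = c.
Proof. by apply: complex_ext; rewrite /= mean_cst. Qed.

Lemma cmean_sum (I : Type) (s : seq I) (F : I -> T -> C) :
  (forall i, cbounded (F i)) ->
  cmean (fun w => \sum_(i <- s) F i w) = \sum_(i <- s) cmean (F i).
Proof.
move=> bF; elim: s => [|i s IH].
  rewrite big_nil -[RHS]cmean_cst; apply: eq_cmean => w.
  by rewrite big_nil.
rewrite big_cons -IH -cmeanD//; last exact: cbounded_sum.
by apply: eq_cmean => w; rewrite big_cons.
Qed.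

Lemma cmeanZ (c : C) F : cbounded F -> cmean (fun w => c * F w) = c * cmean F.
Proof.
move=> [F1 F2]; apply: complex_ext.
  rewrite cReM /= -!meanZ// -meanB.
  - by apply: eq_Rintegral => w _; rewrite cReM.
  - by apply: bounded_mfunM => //; exact: bounded_mfun_cst.
  - by apply: bounded_mfunM => //; exact: bounded_mfun_cst.
rewrite cImM /= -!meanZ// -meanD.
- by apply: eq_Rintegral => w _; rewrite cImM.
- by apply: bounded_mfunM => //; exact: bounded_mfun_cst.
- by apply: bounded_mfunM => //; exact: bounded_mfun_cst.
Qed.

Lemma cmean_preimage_ext (Y : T -> R) (F G : T -> C) (g : R -> C) :
  measurable_fun setT Y -> cbounded F -> cbounded G ->
  (forall A, measurable A -> cmean (fun w => (\1_(Y @^-1` A) w)%:C%C * F w) =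
                             cmean (fun w => (\1_(Y @^-1` A) w)%:C%C * G w)) ->
  measurable_fun setT (fun y => Re (g y)) ->
  measurable_fun setT (fun y => Im (g y)) ->
  cbounded (fun w => g (Y w)) ->
  cmean (fun w => g (Y w) * F w) = cmean (fun w => g (Y w) * G w).
Proof.
move=> mY [bF1 bF2] [bG1 bG2] FG mg1 mg2 [[m1 [M1 M1P]] [m2 [M2 M2P]]].
have FG1 A : measurable A ->
    \int[P]_w (\1_(Y @^-1` A) w * Re (F w)) = \int[P]_w (\1_(Y @^-1` A) w * Re (G w)).
  have E H : \int[P]_w (\1_(Y @^-1` A) w * Re (H w)) =
      \int[P]_w Re ((\1_(Y @^-1` A) w)%:C%C * H w).
    by apply: eq_Rintegral => w _; rewrite cReM /= mul0r subr0.
  by move=> mA; rewrite !E; have [] := FG A mA.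
have FG2 A : measurable A ->
    \int[P]_w (\1_(Y @^-1` A) w * Im (F w)) = \int[P]_w (\1_(Y @^-1` A) w * Im (G w)).
  have E H : \int[P]_w (\1_(Y @^-1` A) w * Im (H w)) =
      \int[P]_w Im ((\1_(Y @^-1` A) w)%:C%C * H w).
    by apply: eq_Rintegral => w _; rewrite cImM /= mul0r addr0.
  by move=> mA; rewrite !E; have [] := FG A mA.
have bg1 : bounded_mfun (fun w => Re (g (Y w))) by split=> //; exists M1.
have bg2 : bounded_mfun (fun w => Im (g (Y w))) by split=> //; exists M2.
apply: complex_ext => /=.
- transitivity (\int[P]_w (Re (g (Y w)) * Re (F w) - Im (g (Y w)) * Im (F w))).
    by apply: eq_Rintegral => w _; rewrite cReM.
  transitivity (\int[P]_w (Re (g (Y w)) * Re (G w) - Im (g (Y w)) * Im (G w))); last first.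
    by apply: eq_Rintegral => w _; rewrite cReM.
  rewrite !meanB; [|exact: bounded_mfunM..].
  congr (_ - _).
    exact: (mean_preimage_ext (g := fun y => Re (g y)) mY bF1 bG1 FG1 mg1 M1P).
  exact: (mean_preimage_ext (g := fun y => Im (g y)) mY bF2 bG2 FG2 mg2 M2P).
- transitivity (\int[P]_w (Re (g (Y w)) * Im (F w) + Im (g (Y w)) * Re (F w))).
    by apply: eq_Rintegral => w _; rewrite cImM.
  transitivity (\int[P]_w (Re (g (Y w)) * Im (G w) + Im (g (Y w)) * Re (G w))); last first.
    by apply: eq_Rintegral => w _; rewrite cImM.
  rewrite !meanD; [|exact: bounded_mfunM..].
  congr (_ + _).
    exact: (mean_preimage_ext (g := fun y => Re (g y)) mY bF2 bG2 FG2 mg1 M1P).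
  exact: (mean_preimage_ext (g := fun y => Im (g y)) mY bF1 bG1 FG1 mg2 M2P).
Qed.

Definition ccvg (u : nat -> C) (l : C) : Prop :=
  (Re (u n) @[n --> \oo] --> Re l) /\ (Im (u n) @[n --> \oo] --> Im l).

Lemma ccvg_unique (u : nat -> C) (l l' : C) : ccvg u l -> ccvg u l' -> l = l'.
Proof.
move=> [a b] [a' b']; apply: complex_ext; first exact: cvg_unique a a'.
exact: cvg_unique b b'.
Qed.

Lemma cvg_cmean (F_ : nat -> T -> C) F (M : R) :
  (forall n, cbounded (F_ n)) ->
  (forall n w, `|Re (F_ n w)| <= M /\ `|Im (F_ n w)| <= M) ->
  (forall w, ccvg (F_ ^~ w) (F w)) ->
  cbounded F /\ ccvg (fun n => cmean (F_ n)) (cmean F).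
Proof.
move=> bF FM FF.
have [b1 c1] := @cvg_mean _ _ _ P (fun n w => Re (F_ n w)) (fun w => Re (F w)) M
  (fun n => (bF n).1.1) (fun n w => (FM n w).1) (fun w => (FF w).1).
have [b2 c2] := @cvg_mean _ _ _ P (fun n w => Im (F_ n w)) (fun w => Im (F w)) M
  (fun n => (bF n).2.1) (fun n w => (FM n w).2) (fun w => (FF w).2).
by [].
Qed.

End ComplexMean.

(** * The complex exponential and the generating function of the Poisson law *)

Section ComplexExponential.
Context {R : realType}.
Local Notation C := R[i].
Implicit Types (x y : R) (z w : C).

Lemma real_complexM x y : (x * y)%:C%C = x%:C%C * y%:C%C :> C.
Proof. exact: rmorphM. Qed.

Lemma real_complexD x y : (x + y)%:C%C = x%:C%C + y%:C%C :> C.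
Proof. exact: rmorphD. Qed.

Lemma real_complexX x n : (x ^+ n)%:C%C = x%:C%C ^+ n :> C.
Proof. exact: rmorphXn. Qed.

(** Squared modulus: it is polynomial, so that no square root intervenes in
    measurability or in the description of the unit disc. *)
Definition sqnorm z : R := Re z ^+ 2 + Im z ^+ 2.

Lemma sqnormM z w : sqnorm (z * w) = sqnorm z * sqnorm w.
Proof. by rewrite /sqnorm cReM cImM; ring. Qed.

Lemma sqnorm1 : sqnorm 1 = 1.
Proof. by rewrite /sqnorm /= expr0n addr0 expr1n. Qed.

Lemma sqnorm_ge0 z : 0 <= sqnorm z.
Proof. by rewrite addr_ge0 ?sqr_ge0. Qed.

Lemma sqnormX z n : sqnorm (z ^+ n) = sqnorm z ^+ n.
Proof. by elim: n => [|n IH]; rewrite ?sqnorm1// !exprS sqnormM IH. Qed.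

Lemma sqnorm_le1M z w : sqnorm z <= 1 -> sqnorm w <= 1 -> sqnorm (z * w) <= 1.
Proof. by move=> z1 w1; rewrite sqnormM mulr_ile1 ?sqnorm_ge0. Qed.

Lemma sqnorm_le1X z n : sqnorm z <= 1 -> sqnorm (z ^+ n) <= 1.
Proof. by move=> z1; rewrite sqnormX exprn_ile1 ?sqnorm_ge0. Qed.

Lemma sqnorm_le1_prod (I : Type) (s : seq I) (F : I -> C) :
  (forall i, sqnorm (F i) <= 1) -> sqnorm (\prod_(i <- s) F i) <= 1.
Proof.
move=> F1; elim: s => [|i s IH]; first by rewrite big_nil sqnorm1.
by rewrite big_cons sqnorm_le1M.
Qed.

Lemma sqnorm_le1_coord z : sqnorm z <= 1 -> `|Re z| <= 1 /\ `|Im z| <= 1.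
Proof.
have s1 x : x ^+ 2 <= 1 -> `|x| <= 1.
  by move=> x1; rewrite -(@ler_pXn2r _ 2) ?nnegrE// expr1n real_normK ?num_real.
rewrite /sqnorm => z1; split; apply: s1; apply: le_trans z1.
  by rewrite lerDl sqr_ge0.
by rewrite lerDr sqr_ge0.
Qed.

(** The unit disc is convex: it contains the segment from 1 to [w]. *)
Lemma sqnorm_le1_conv (a : R) w : 0 <= a <= 1 -> sqnorm w <= 1 ->
  sqnorm (1 + a%:C%C * (w - 1)) <= 1.
Proof.
case: w => p q /andP[a0 a1] h.
have [/= + _] := sqnorm_le1_coord h; rewrite ler_norml => /andP[h3 h4].
have h5 : 0 <= a * (1 - a) * (1 - p) by rewrite !mulr_ge0// subr_ge0.
have h6 : 0 <= a ^+ 2 * (1 - (p ^+ 2 + q ^+ 2)) by rewrite mulr_ge0 ?sqr_ge0// subr_ge0.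
rewrite /sqnorm ?(cReD, cImD, cReM, cImM) /=.
lra.
Qed.


Definition cexp z : C :=
  ((expR (Re z) * cos (Im z)) +i* (expR (Re z) * sin (Im z)))%C.

Lemma cexpD z w : cexp (z + w) = cexp z * cexp w.
Proof.
by apply: complex_ext; rewrite ?cReM ?cImM /= cReD cImD expRD ?cosD ?sinD; ring.
Qed.

Lemma cexp0 : cexp 0 = 1.
Proof. by apply: complex_ext; rewrite /= expR0 ?cos0 ?sin0 ?mul1r ?mulr0. Qed.

Lemma cexp_sum (I : Type) (s : seq I) (F : I -> C) :
  cexp (\sum_(i <- s) F i) = \prod_(i <- s) cexp (F i).
Proof.
elim: s => [|i s IH]; first by rewrite !big_nil cexp0.
by rewrite !big_cons cexpD IH.
Qed.

Lemma cexpX z n : cexp z ^+ n = cexp (n%:R * z).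
Proof.
elim: n => [|n IH]; first by rewrite mul0r cexp0.
by rewrite exprS IH -natr1 mulrDl mul1r addrC cexpD.
Qed.

Lemma cexp_real x : cexp x%:C%C = (expR x)%:C%C.
Proof. by apply: complex_ext; rewrite /= ?cos0 ?sin0 ?mulr1 ?mulr0. Qed.

Lemma sqnorm_cexp z : sqnorm (cexp z) = expR (Re z) ^+ 2.
Proof. by rewrite /sqnorm /= !exprMn -mulrDr cos2Dsin2 mulr1. Qed.

Lemma sqnorm_cexp_le1 z : Re z <= 0 -> sqnorm (cexp z) <= 1.
Proof.
by move=> z0; rewrite sqnorm_cexp exprn_ile1 ?expR_ge0// expR_le1.
Qed.

Definition cexp_coeff z (n : nat) : C := z ^+ n * (n`!%:R^-1)%:C%C.

Lemma cexp_coeffD z w n : cexp_coeff (z + w) n =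
  \sum_(j < n.+1) cexp_coeff z j * cexp_coeff w (n - j)%N.
Proof.
rewrite /cexp_coeff addrC exprDn mulr_suml; apply: eq_bigr => j _.
rewrite [RHS]mulrACA -real_complexM /= [w ^+ _ * _]mulrC -[_ *+ _]mulr_natr -[LHS]mulrA.
congr (_ * _).
have jn : (j <= n)%N by rewrite -ltnS.
have nz k : k`!%:R != 0 :> R by rewrite pnatr_eq0 -lt0n fact_gt0.
have := congr1 (fun k => k%:R : R) (bin_fact jn); rewrite !natrM => bE.
rewrite (_ : 'C(n, j)%:R = ('C(n, j)%:R : R)%:C%C); last by rewrite rmorph_nat.
rewrite -real_complexM /=; congr (_%:C%C).
apply: (mulIf (nz n)); rewrite -mulrA mulVf// mulr1 -bE.
by field; rewrite !nz.
Qed.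

(** Reordering of the terms of a Cauchy product by diagonals. *)
Lemma sum_diagonal (V : nmodType) (F : nat -> nat -> V) N :
  \sum_(n < N) \sum_(j < n.+1) F j (n - j)%N =
  \sum_(j < N) \sum_(0 <= k < N - j) F j k.
Proof.
elim: N => [|N IH]; first by rewrite !big_ord0.
rewrite big_ord_recr /= IH [RHS]big_ord_recr /= subSn// subnn big_nat1.
rewrite big_ord_recr /= subnn addrA; congr (_ + _).
rewrite -big_split /=; apply: eq_bigr => j _.
by rewrite subSn 1?ltnW// big_nat_recr.
Qed.

(** The terms of a product of partial sums that are missing from the partial
    sum of the Cauchy product are those beyond the antidiagonal. *)
Lemma cauchy_product_tail (A : pzSemiRingType) (a b : nat -> A) N :
  (\sum_(j < N) a j) * (\sum_(k < N) b k) =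
  \sum_(n < N) \sum_(j < n.+1) a j * b (n - j)%N +
  \sum_(j < N) \sum_(N - j <= k < N) a j * b k.
Proof.
rewrite (sum_diagonal (fun j k => a j * b k)) -big_split /= mulr_suml.
apply: eq_bigr => j _; rewrite mulr_sumr -big_cat_nat ?leq_subr//=.
by rewrite big_mkord.
Qed.

Lemma cexp_coeff_real x n : cexp_coeff x%:C%C n = (exp_coeff x n)%:C%C.
Proof. by rewrite /cexp_coeff -real_complexX -real_complexM. Qed.

Lemma cexp_coeff_imag x n : cexp_coeff ('i * x%:C)%C n =
  (cos_coeff x n +i* sin_coeff x n)%C.
Proof.
rewrite /cexp_coeff exprMn -real_complexX -mulrA -real_complexM /=.
have -> : 'i%C ^+ n = (((~~ odd n)%:R * (-1) ^+ n./2) +i* ((odd n)%:R * (-1) ^+ n.-1./2))%C :> C.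
  rewrite -[in LHS](odd_double_half n) exprD -mul2n exprM sqr_i.
  rewrite (_ : (-1) ^+ n./2 = ((-1) ^+ n./2)%:C%C :> C); last by rewrite rmorphXn rmorphN1.
  case: (boolP (odd n)) => on /=.
    have -> : n.-1./2 = n./2 by rewrite -[in LHS](odd_double_half n) on /= doubleK.
    by apply: complex_ext; rewrite ?cReM ?cImM /=; ring.
  by apply: complex_ext; rewrite ?cReM ?cImM /=; ring.
rewrite /cos_coeff /sin_coeff /=.
by apply: complex_ext; rewrite ?cReM ?cImM /= -?exprnP; ring.
Qed.

Lemma exp_coeffD x y n : exp_coeff (x + y) n =
  \sum_(j < n.+1) exp_coeff x j * exp_coeff y (n - j)%N.
Proof.
apply: (@complexI R); rewrite -cexp_coeff_real real_complexD cexp_coeffD rmorph_sum.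
by apply: eq_bigr => j _; rewrite !cexp_coeff_real -real_complexM.
Qed.

Lemma cRe_sum (I : Type) (s : seq I) (F : I -> C) :
  Re (\sum_(i <- s) F i) = \sum_(i <- s) Re (F i).
Proof. by elim: s => [|i s IH]; rewrite ?big_nil// !big_cons cReD IH. Qed.

Lemma cIm_sum (I : Type) (s : seq I) (F : I -> C) :
  Im (\sum_(i <- s) F i) = \sum_(i <- s) Im (F i).
Proof. by elim: s => [|i s IH]; rewrite ?big_nil// !big_cons cImD IH. Qed.

Lemma norm_coeff_le (y : R) (k : nat) :
  `|cos_coeff y k| <= exp_coeff `|y| k /\ `|sin_coeff y k| <= exp_coeff `|y| k.
Proof.
have f0 : 0 < k`!%:R :> R by rewrite ltr0n fact_gt0.
have E (b : bool) (m : nat) :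
    `|b%:R * (-1) ^+ m * y ^+ k / k`!%:R| <= exp_coeff `|y| k.
  rewrite normrM normfV (gtr0_norm f0) /exp_coeff /=.
  rewrite ler_pM2r ?invr_gt0// !normrM !normrX normrN1 expr1n mulr1.
  by case: b; rewrite ?normr1 ?mul1r// normr0 mul0r exprn_ge0.
split; last exact: E.
by rewrite /cos_coeff /= -exprnP; exact: E.
Qed.

Lemma cvg_cos_series x : series (cos_coeff x) n @[n --> \oo] --> cos x.
Proof. by rewrite unlock; exact: is_cvg_series_cos_coeff. Qed.

Lemma cvg_sin_series x : series (sin_coeff x) n @[n --> \oo] --> sin x.
Proof. by rewrite unlock; exact: is_cvg_series_sin_coeff. Qed.

Lemma cvg_exp_series x : series (exp_coeff x) n @[n --> \oo] --> expR x.
Proof. exact: is_cvg_series_exp_coeff. Qed.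

(** The power series of the exponential. The Cauchy product of the series of
    exp x and exp iy is the series of their product up to the terms beyond the
    diagonal; these are dominated by the same terms for |x| and |y|, which
    vanish in the limit because exp |x| exp |y| = exp (|x| + |y|). *)
Lemma cvg_cexp_series z : ccvg (fun N => \sum_(n < N) cexp_coeff z n) (cexp z).
Proof.
case: z => x y; set z := (x +i* y)%C.
have zE : z = x%:C%C + ('i * y%:C)%C.
  by rewrite /z; apply: complex_ext; rewrite ?cReD ?cImD /=; ring.
(* The terms beyond the antidiagonal, for the moduli. *)
pose tail N := \sum_(j < N) \sum_(N - j <= k < N)
  exp_coeff `|x| j * exp_coeff `|y| k.
have tail0 : tail N @[N --> \oo] --> 0.
  have -> : tail = (fun N => series (exp_coeff `|x|) N * series (exp_coeff `|y|) N -
      series (exp_coeff (`|x| + `|y|)) N).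
    apply/funext => N; rewrite /series /= !big_mkord.
    rewrite [X in _ = X - _]cauchy_product_tail.
    rewrite [X in _ = _ - X](eq_bigr (fun n : 'I_N =>
       \sum_(j < n.+1) exp_coeff `|x| j * exp_coeff `|y| (n - j)%N)).
      by rewrite addrAC subrr add0r.
    by move=> n _; exact: exp_coeffD.
  rewrite -[X in _ --> X](subrr (expR `|x| * expR `|y|)).
  rewrite -[X in _ --> _ - X]expRD.
  apply: cvgB; last exact: cvg_exp_series.
  by apply: cvgM; exact: cvg_exp_series.
have prodE N : \sum_(n < N) cexp_coeff z n =
    ((series (exp_coeff x) N)%:C * (series (cos_coeff y) N +i* series (sin_coeff y) N))%C -
    \sum_(j < N) \sum_(N - j <= k < N)
      (exp_coeff x j)%:C%C * (cos_coeff y k +i* sin_coeff y k)%C.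
  have -> : (series (cos_coeff y) N +i* series (sin_coeff y) N)%C =
      \sum_(k < N) (cos_coeff y k +i* sin_coeff y k)%C.
    by apply: complex_ext; rewrite ?cRe_sum ?cIm_sum /= /series /= big_mkord.
  have -> : (series (exp_coeff x) N)%:C%C = \sum_(k < N) (exp_coeff x k)%:C%C.
    by rewrite /series /= big_mkord rmorph_sum.
  rewrite (cauchy_product_tail (fun j => (exp_coeff x j)%:C%C)
     (fun k => (cos_coeff y k +i* sin_coeff y k)%C)) addrK.
  apply: eq_bigr => n _; rewrite zE cexp_coeffD; apply: eq_bigr => j _.
  by rewrite cexp_coeff_real cexp_coeff_imag.
have bnd (c : nat -> R) (N : nat) : (forall k, `|c k| <= exp_coeff `|y| k) ->
    `|\sum_(j < N) \sum_(N - j <= k < N) exp_coeff x j * c k| <= tail N.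
  move=> cy; apply: le_trans (ler_norm_sum _ _ _) _; apply: ler_sum => j _.
  apply: le_trans (ler_norm_sum _ _ _) _; apply: ler_sum => k _.
  rewrite normrM ler_pM//.
  by rewrite /exp_coeff /= normrM normfV normrX (@ger0_norm _ (_`!)%:R).
have sq0 (u : nat -> R) : (forall N, `|u N| <= tail N) -> u N @[N --> \oo] --> 0.
  move=> ut; apply/norm_cvg0P; apply: (@squeeze_cvgr _ _ _ _ (fun=> 0) tail) => //.
  - by near=> N; rewrite normr_ge0 ut.
  - exact: cvg_cst.
split.
- have -> : (fun n => Re (\sum_(n0 < n) cexp_coeff z n0)) = (fun N =>
      series (exp_coeff x) N * series (cos_coeff y) N -
      \sum_(j < N) \sum_(N - j <= k < N) exp_coeff x j * cos_coeff y k).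
    apply/funext => N; rewrite prodE cReD cReM /= mul0r subr0; congr (_ + _).
    have ReN (t : C) : Re (- t) = - Re t by case: t.
    rewrite ReN cRe_sum; congr (- _); apply: eq_bigr => j _; rewrite cRe_sum.
    by apply: eq_bigr => k _; rewrite cReM /= mul0r subr0.
  rewrite /= -[X in _ --> X]subr0; apply: cvgB.
    by apply: cvgM; [exact: cvg_exp_series | exact: cvg_cos_series].
  by apply: sq0 => N; apply: bnd => k; have [] := norm_coeff_le y k.
- have -> : (fun n => Im (\sum_(n0 < n) cexp_coeff z n0)) = (fun N =>
      series (exp_coeff x) N * series (sin_coeff y) N -
      \sum_(j < N) \sum_(N - j <= k < N) exp_coeff x j * sin_coeff y k).
    apply/funext => N; rewrite prodE cImD cImM /= mul0r addr0; congr (_ + _).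
    have ImN (t : C) : Im (- t) = - Im t by case: t.
    rewrite ImN cIm_sum; congr (- _); apply: eq_bigr => j _; rewrite cIm_sum.
    by apply: eq_bigr => k _; rewrite cImM /= mul0r addr0.
  rewrite /= -[X in _ --> X]subr0; apply: cvgB.
    by apply: cvgM; [exact: cvg_exp_series | exact: cvg_sin_series].
  by apply: sq0 => N; apply: bnd => k; have [] := norm_coeff_le y k.
Unshelve. all: by end_near. Qed.

Lemma ccvgZ (u : nat -> C) (l c : C) : ccvg u l -> ccvg (fun n => c * u n) (c * l).
Proof.
move=> [ul1 ul2]; split.
  under eq_fun do rewrite cReM; rewrite cReM.
  by apply: cvgB; apply: cvgM => //; exact: cvg_cst.
under eq_fun do rewrite cImM; rewrite cImM.
by apply: cvgD; apply: cvgM => //; exact: cvg_cst.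
Qed.

(** The normalisation of the Poisson weights is the factor that turns the
    exponential series at [rate * w] into an exponential at [rate * (w - 1)]. *)
Lemma cvg_poisson_pgf (rate : R) w : 0 < rate ->
  ccvg (fun N => \sum_(m < N) (poisson_pmf rate m)%:C%C * w ^+ m)
       (cexp (rate%:C%C * (w - 1))).
Proof.
move=> rate0.
have -> : cexp (rate%:C%C * (w - 1)) = (expR (- rate))%:C%C * cexp (rate%:C%C * w).
  rewrite mulrBr mulr1 addrC cexpD; congr (_ * _).
  by rewrite -cexp_real; congr cexp; rewrite rmorphN.
have -> : (fun N => \sum_(m < N) (poisson_pmf rate m)%:C%C * w ^+ m) = (fun N =>
    (expR (- rate))%:C%C * \sum_(m < N) cexp_coeff (rate%:C%C * w) m).
  apply/funext => N; rewrite mulr_sumr; apply: eq_bigr => m _.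
  rewrite /poisson_pmf rate0 /cexp_coeff exprMn -real_complexX !real_complexM.
  by ring.
exact/ccvgZ/cvg_cexp_series.
Qed.

(** The partial sums increase to the generating function at 1, which is 1. *)
Lemma sum_poisson_pmf_le1 (rate : R) N : 0 < rate ->
  \sum_(m < N) poisson_pmf rate m <= 1.
Proof.
move=> rate0; have [+ _] := cvg_poisson_pgf 1 rate0.
rewrite subrr mulr0 cexp0 /=; set u := fun _ => _ => u1.
have uE n : u n = \sum_(m < n) poisson_pmf rate m.
  by rewrite /u cRe_sum; apply: eq_bigr => m _; rewrite expr1n mulr1.
rewrite -uE -(cvg_lim _ u1)//; apply: nondecreasing_cvgn_le; last by apply/cvg_ex; exists 1.
move=> m n mn; rewrite !uE -(subnKC mn) big_split_ord /= lerDl sumr_ge0// => i _.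
exact: poisson_pmf_ge0.
Qed.

End ComplexExponential.

(** * Conditional independence expressed by means *)

Section ComplexMeasurable.
Context {R : realType} {d} {T : measurableType d}.
Local Notation C := R[i].
Implicit Types (F G : T -> C).

Definition cmeasurable F : Prop :=
  measurable_fun setT (fun w => Re (F w)) /\ measurable_fun setT (fun w => Im (F w)).

Lemma cmeasurable_cst (c : C) : cmeasurable (fun=> c).
Proof. by split; exact: measurable_cst. Qed.

Lemma cmeasurable_real (f : T -> R) :
  measurable_fun setT f -> cmeasurable (fun w => (f w)%:C%C).
Proof. by move=> mf; split => //=; exact: measurable_cst. Qed.

Lemma cmeasurableD F G :
  cmeasurable F -> cmeasurable G -> cmeasurable (fun w => F w + G w).
Proof.
move=> [F1 F2] [G1 G2]; split.
  by under eq_fun do rewrite cReD; exact: measurable_funD.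
by under eq_fun do rewrite cImD; exact: measurable_funD.
Qed.

Lemma cmeasurableM F G :
  cmeasurable F -> cmeasurable G -> cmeasurable (fun w => F w * G w).
Proof.
move=> [F1 F2] [G1 G2]; split.
  by under eq_fun do rewrite cReM; apply: measurable_funB; exact: measurable_funM.
by under eq_fun do rewrite cImM; apply: measurable_funD; exact: measurable_funM.
Qed.

Lemma cmeasurableX F n : cmeasurable F -> cmeasurable (fun w => F w ^+ n).
Proof.
move=> mF; elim: n => [|n IH]; first exact: cmeasurable_cst.
by under eq_fun do rewrite exprS; exact: cmeasurableM.
Qed.

Lemma cmeasurable_prod (I : Type) (s : seq I) (F : I -> T -> C) :
  (forall i, cmeasurable (F i)) -> cmeasurable (fun w => \prod_(i <- s) F i w).
Proof.
move=> mF; elim: s => [|i s IH].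
  by under eq_fun do rewrite big_nil; exact: cmeasurable_cst.
by under eq_fun do rewrite big_cons; exact: cmeasurableM.
Qed.

Lemma cmeasurable_cexp F : cmeasurable F -> cmeasurable (fun w => cexp (F w)).
Proof.
move=> [F1 F2]; split => /=; apply: measurable_funM.
- exact: measurableT_comp.
- apply: measurableT_comp => //; apply: continuous_measurable_fun.
  exact: continuous_cos.
- exact: measurableT_comp.
- apply: measurableT_comp => //; apply: continuous_measurable_fun.
  exact: continuous_sin.
Qed.

Lemma cmeasurable_nat_index (X : T -> nat) (F : nat -> T -> C) :
  measurable_fun setT X -> (forall n, cmeasurable (F n)) ->
  cmeasurable (fun w => F (X w) w).
Proof.
move=> mX mF; split.
  exact: (measurable_fun_nat_index (F := fun n w => Re (F n w)) mX (fun n => (mF n).1)).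
exact: (measurable_fun_nat_index (F := fun n w => Im (F n w)) mX (fun n => (mF n).2)).
Qed.

Lemma coord_le_sqnorm (z : C) (K : R) :
  sqnorm z <= K -> `|Re z| <= K + 1 /\ `|Im z| <= K + 1.
Proof.
have h (x : R) : x ^+ 2 <= K -> `|x| <= K + 1.
  move=> xK; have := sqr_ge0 (`|x| - 1); rewrite sqrrB1 real_normK ?num_real//.
  by have := normr_ge0 x; lra.
rewrite /sqnorm => zK; split; apply: h; apply: le_trans zK.
  by rewrite lerDl sqr_ge0.
by rewrite lerDr sqr_ge0.
Qed.

Lemma cboundedP F :
  cbounded F <-> cmeasurable F /\ exists K, forall w, sqnorm (F w) <= K.
Proof.
split=> [[[m1 [M1 b1]] [m2 [M2 b2]]]|[[m1 m2] [K FK]]].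
  split=> //; exists (M1 ^+ 2 + M2 ^+ 2) => w; rewrite /sqnorm lerD//.
    by rewrite -ler_sqrt ?sqr_ge0// !sqrtr_sqr (le_trans (b1 w))// ler_norm.
  by rewrite -ler_sqrt ?sqr_ge0// !sqrtr_sqr (le_trans (b2 w))// ler_norm.
by split; split=> //; exists (K + 1) => w; have [] := coord_le_sqnorm (FK w).
Qed.

Lemma cbounded_disc F :
  cmeasurable F -> (forall w, sqnorm (F w) <= 1) -> cbounded F.
Proof. by move=> mF F1; apply/cboundedP; split=> //; exists 1. Qed.

End ComplexMeasurable.

Section NatLevels.
Context {R : realType} {d} {T : measurableType d} (P : probability T R).
Local Notation C := R[i].

Lemma cmeasurable_level (X : T -> nat) m :
  measurable_fun setT X -> cmeasurable (fun w => (X w == m)%:R : C).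
Proof.
move=> mX; have -> : (fun w => (X w == m)%:R : C) = (fun w => (\1_(X @^-1` [set m]) w)%:C%C).
  apply/funext => w; rewrite indicE (_ : (w \in _) = (X w == m)) ?rmorph_nat//.
  by apply/idP/eqP => [/set_mem//|Xm]; apply/mem_set.
apply: cmeasurable_real; apply: measurable_indic.
by rewrite -[_ @^-1` _]setTI; exact: mX.
Qed.

Lemma sqnorm_bool (b : bool) : sqnorm (b%:R : C) <= 1.
Proof. by case: b; rewrite /sqnorm /= ?expr1n ?expr0n ?addr0. Qed.

Lemma cbounded_level (X : T -> nat) m :
  measurable_fun setT X -> cbounded (fun w => (X w == m)%:R : C).
Proof.
by move=> mX; apply: cbounded_disc => [|w]; [exact: cmeasurable_level|exact: sqnorm_bool].
Qed.

Lemma sum_level (V : nat -> C) (k N : nat) :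
  \sum_(x < N) (k == x)%:R * V x = (k < N)%N%:R * V k.
Proof.
elim: N => [|N IH]; first by rewrite big_ord0 mul0r.
rewrite big_ord_recr /= IH [in RHS]ltnS [in RHS]leq_eqVlt.
by case: (ltngtP k N) => [||->] /=; rewrite ?(mul0r, mul1r, addr0, add0r).
Qed.

(** The level sets of an integer variable exhaust the space, so a mean is the
    sum of its restrictions to them. This replaces random indices and exponents
    by constants. *)
Lemma cvg_cmean_levels (X : T -> nat) (F : nat -> T -> C) (K : R) :
  measurable_fun setT X -> (forall x, cmeasurable (F x)) ->
  (forall x w, sqnorm (F x w) <= K) ->
  ccvg (fun N => \sum_(x < N) cmean P (fun w => (X w == x)%:R * F x w))
       (cmean P (fun w => F (X w) w)).
Proof.
move=> mX mF FK.
have bF x : cbounded (F x) by apply/cboundedP; split=> //; exists K.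
have bXF x : cbounded (fun w => (X w == x)%:R * F x w).
  by apply: cboundedM => //; exact: cbounded_level.
have -> : (fun N => \sum_(x < N) cmean P (fun w => (X w == x)%:R * F x w)) =
    (fun N => cmean P (fun w => (X w < N)%N%:R * F (X w) w)).
  apply/funext => N; rewrite -cmean_sum//.
  by apply: eq_cmean => w; rewrite (sum_level (F ^~ w)).
have K0 : 0 <= K := le_trans (sqnorm_ge0 _) (FK 0%N point).
apply: proj2; apply: (@cvg_cmean _ _ _ P (fun N w => (X w < N)%N%:R * F (X w) w)
  (fun w => F (X w) w) (K + 1)).
- move=> N; rewrite (_ : (fun w => _) = (fun w => \sum_(x < N) (X w == x)%:R * F x w)).
    exact: cbounded_sum.
  by apply/funext => w; rewrite (sum_level (F ^~ w)).
- move=> N w; apply: coord_le_sqnorm; case: (_ < _)%N; rewrite ?mul1r//.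
  by rewrite mul0r /sqnorm /= expr0n addr0.
- move=> w; split; apply: cvg_near_cst; exists (X w).+1 => // N /= XN;
    by rewrite XN mul1r.
Qed.

Lemma eq_cmean_levels (X : T -> nat) (F G : nat -> T -> C) (K : R) :
  measurable_fun setT X ->
  (forall x, cmeasurable (F x)) -> (forall x, cmeasurable (G x)) ->
  (forall x w, sqnorm (F x w) <= K) -> (forall x w, sqnorm (G x w) <= K) ->
  (forall x, cmean P (fun w => (X w == x)%:R * F x w) =
             cmean P (fun w => (X w == x)%:R * G x w)) ->
  cmean P (fun w => F (X w) w) = cmean P (fun w => G (X w) w).
Proof.
move=> mX mF mG FK GK FG; apply: (ccvg_unique (cvg_cmean_levels mX mF FK)).
have := cvg_cmean_levels mX mG GK; congr (ccvg _ _).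
by apply/funext => N; apply: eq_bigr => x _; rewrite FG.
Qed.

End NatLevels.

Section ConditionalIndependence.
Context {R : realType} {d} {T : measurableType d} (P : probability T R).
Local Notation C := R[i].
Context (alpha : T -> R) (malpha : measurable_fun setT alpha).
Context (I : eqType) (Z : I -> T -> nat) (mZ : forall i, measurable_fun setT (Z i)).
Context (q : I -> nat -> R -> R).
Context (mq : forall i m, measurable_fun setT (q i m)).
Context (q01 : forall i m w, 0 <= q i m (alpha w) <= 1).

(** Bounded random variables [F] that carry no information, given [alpha], on
    the inputs outside [D]: any indicators of values of such inputs can be
    replaced by their conditional probabilities. Testing against functions of
    [alpha] instead of conditioning keeps all conditional expectations out of
    the computation of the generating function. *)
Definition cond_free (D : set I) (F : T -> C) : Prop :=
  cbounded F /\
  forall (J : seq I) (m : I -> nat) (g : R -> C),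
    uniq J -> (forall j, j \in J -> ~ D j) ->
    cmeasurable g -> cbounded (g \o alpha) ->
    cmean P (fun w => g (alpha w) * F w * \prod_(j <- J) (Z j w == m j)%:R) =
    cmean P (fun w => g (alpha w) * F w * \prod_(j <- J) (q j (m j) (alpha w))%:C%C).

Lemma cond_free_sub (D D' : set I) F : D `<=` D' -> cond_free D F -> cond_free D' F.
Proof.
move=> DD' [bF FD]; split=> // J m g uJ JD mg bg; apply: FD => // j /JD.
by apply: contra_not; exact: DD'.
Qed.

Lemma cmeasurable_comp_alpha (g : R -> C) : cmeasurable g -> cmeasurable (g \o alpha).
Proof.
by move=> [g1 g2]; split; [exact: measurableT_comp g1 malpha | exact: measurableT_comp g2 malpha].
Qed.

Lemma cond_free_alphaM (D : set I) F (h : R -> C) :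
  cmeasurable h -> cbounded (h \o alpha) ->
  cond_free D F -> cond_free D (fun w => h (alpha w) * F w).
Proof.
move=> mh bh [bF FD]; split; first exact: cboundedM.
move=> J m g uJ JD mg bg.
have := FD J m (fun a => g a * h a) uJ JD (cmeasurableM mg mh) (cboundedM bg bh).
by congr (_ = _); apply: eq_cmean => w; rewrite mulrA.
Qed.

Lemma cond_free_sum (D : set I) N (F : 'I_N -> T -> C) :
  (forall n, cond_free D (F n)) -> cond_free D (fun w => \sum_(n < N) F n w).
Proof.
move=> FD; split; first by apply: cbounded_sum => n; exact: (FD n).1.
move=> J m g uJ JD mg bg.
have bL n : cbounded (fun w => g (alpha w) * F n w * \prod_(j <- J) (Z j w == m j)%:R).
  apply: cboundedM; first by apply: cboundedM => //; exact: (FD n).1.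
  by apply: cbounded_prod => j; exact: cbounded_level.
have bR n : cbounded (fun w => g (alpha w) * F n w *
    \prod_(j <- J) (q j (m j) (alpha w))%:C%C).
  apply: cboundedM; first by apply: cboundedM => //; exact: (FD n).1.
  apply: cbounded_prod => j; apply: cbounded_real; split; first exact: (measurableT_comp (mq _ _) malpha).
  by exists 1 => w; have /andP[q0 q1] := q01 j (m j) w; rewrite ger0_norm.
transitivity (cmean P (fun w => \sum_(n < N) g (alpha w) * F n w *
    \prod_(j <- J) (Z j w == m j)%:R)).
  by apply: eq_cmean => w; rewrite mulr_sumr mulr_suml.
rewrite cmean_sum// (eq_bigr _ (fun n _ => (FD n).2 J m g uJ JD mg bg)) -cmean_sum//.
by apply: eq_cmean => w; rewrite mulr_sumr mulr_suml.
Qed.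

(** The input [i] can be counted among those that are tested by [J]; its
    conditional probability and those of [J] are functions of [alpha], which can
    be moved between the factors. *)
Lemma cond_free_level (D : set I) F i k : cond_free D F -> ~ D i ->
  cond_free (i |` D) (fun w => F w * (Z i w == k)%:R).
Proof.
move=> [bF FD] Di; split; first by apply: cboundedM => //; exact: cbounded_level.
move=> J m g uJ JD mg bg.
have iJ : i \notin J by apply/negP => /JD; apply; left.
have JD' j : j \in J -> ~ D j by move=> /JD; apply: contra_not; right.
(* [i] is added to [J] by a first use of the hypothesis, which replaces all the
   indicators; a second use restores that of [i]. *)
pose m' j := if j == i then k else m j.
have m'J (F' : I -> nat -> C) : \prod_(j <- J) F' j (m' j) = \prod_(j <- J) F' j (m j).
  by apply: eq_big_seq => j jJ; rewrite /m'; case: eqP jJ iJ => // -> ->.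
have mqJ : cmeasurable (fun a => \prod_(j <- J) (q j (m j) a)%:C%C).
  by apply: cmeasurable_prod => j; exact: cmeasurable_real.
have bqJ : cbounded ((fun a => \prod_(j <- J) (q j (m j) a)%:C%C) \o alpha).
  apply: cbounded_prod => j; apply: cbounded_real; split; first exact: (measurableT_comp (mq _ _) malpha).
  by exists 1 => w; have /andP[q0 q1] := q01 j (m j) w; rewrite ger0_norm.
have h1 := FD (i :: J) m' g _ _ mg bg.
have h2 := FD [:: i] m' _ _ _ (cmeasurableM mg mqJ) (cboundedM bg bqJ).
transitivity (cmean P (fun w => g (alpha w) * F w *
    \prod_(j <- i :: J) (Z j w == m' j)%:R)).
  apply: eq_cmean => w; rewrite big_cons (m'J (fun j x => (Z j w == x)%:R)).
  by rewrite /m' eqxx; ring.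
rewrite h1 /= ?iJ//; last first.
  by move=> j; rewrite inE => /orP[/eqP ->//|]; exact: JD'.
transitivity (cmean P (fun w => g (alpha w) * \prod_(j <- J) (q j (m j) (alpha w))%:C%C
     * F w * \prod_(j <- [:: i]) (q j (m' j) (alpha w))%:C%C)).
  apply: eq_cmean => w; rewrite big_cons big_seq1 (m'J (fun j x => (q j x (alpha w))%:C%C)).
  by ring.
rewrite -h2//; last by move=> j; rewrite inE => /eqP ->.
by apply: eq_cmean => w; rewrite big_seq1 /m' eqxx; ring.
Qed.

(** A random index is harmless, because it is constant on its level sets. *)
Lemma cond_free_levels (D : set I) (X : T -> nat) (F : nat -> T -> C) (K : R) :
  measurable_fun setT X -> (forall x, cmeasurable (F x)) ->
  (forall x w, sqnorm (F x w) <= K) ->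
  (forall x, cond_free D (fun w => (X w == x)%:R * F x w)) ->
  cond_free D (fun w => F (X w) w).
Proof.
move=> mX mF FK FD; split.
  apply/cboundedP; split; first exact: cmeasurable_nat_index.
  by exists K.
move=> J m g uJ JD mg bg.
have [_ [Kg gK]] := (cboundedP _).1 bg.
have K0 : 0 <= K := le_trans (sqnorm_ge0 _) (FK 0%N point).
have Kg0 : 0 <= Kg := le_trans (sqnorm_ge0 _) (gK point).
have b1 w : sqnorm (\prod_(j <- J) (Z j w == m j)%:R) <= 1.
  by apply: sqnorm_le1_prod => j; exact: sqnorm_bool.
have b2 w : sqnorm (\prod_(j <- J) (q j (m j) (alpha w))%:C%C) <= 1.
  apply: sqnorm_le1_prod => j; have /andP[q0 q1] := q01 j (m j) w.
  by rewrite /sqnorm /= [0 ^+ 2]expr0n addr0 exprn_ile1.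
have mg' := cmeasurable_comp_alpha mg.
apply: (@eq_cmean_levels _ _ _ P X
  (fun x w => g (alpha w) * F x w * \prod_(j <- J) (Z j w == m j)%:R)
  (fun x w => g (alpha w) * F x w * \prod_(j <- J) (q j (m j) (alpha w))%:C%C)
  (Kg * K * 1)) => //.
- move=> x; apply: cmeasurableM; first exact: cmeasurableM.
  by apply: cmeasurable_prod => j; exact: cmeasurable_level.
- move=> x; apply: cmeasurableM; first exact: cmeasurableM.
  by apply: cmeasurable_prod => j; apply: cmeasurable_real; exact: (measurableT_comp (mq _ _) malpha).
- move=> x w; rewrite !sqnormM; apply: ler_pM; rewrite ?mulr_ge0 ?sqnorm_ge0 ?b1//.
  by apply: ler_pM; rewrite ?sqnorm_ge0 ?gK.
- move=> x w; rewrite !sqnormM; apply: ler_pM; rewrite ?mulr_ge0 ?sqnorm_ge0 ?b2//.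
  by apply: ler_pM; rewrite ?sqnorm_ge0 ?gK.
- move=> x; have := (FD x).2 J m g uJ JD mg bg.
  by congr (_ = _); apply: eq_cmean => w; ring.
Qed.

Lemma cond_free_inputM (D : set I) F i (c : nat -> R -> C) : cond_free D F -> ~ D i ->
  (forall k, cmeasurable (c k)) -> (forall k w, sqnorm (c k (alpha w)) <= 1) ->
  cond_free (i |` D) (fun w => F w * c (Z i w) (alpha w)).
Proof.
move=> FD Di mc c1; have [mF [K FK]] := (cboundedP _).1 FD.1.
have K0 : 0 <= K := le_trans (sqnorm_ge0 _) (FK point).
apply: (@cond_free_levels _ (Z i) (fun k w => F w * c k (alpha w)) (K * 1)) => //.
- by move=> k; apply: cmeasurableM => //; exact: cmeasurable_comp_alpha (mc k).
- by move=> k w; rewrite sqnormM; apply: ler_pM; rewrite ?sqnorm_ge0.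
- move=> k; have bck : cbounded (c k \o alpha).
    by apply: cbounded_disc => [|w]; [exact: cmeasurable_comp_alpha (mc k) | exact: c1].
  have := cond_free_alphaM (mc k) bck (cond_free_level k FD Di).
  by congr (cond_free _ _); apply/funext => w; ring.
Qed.

(** Integrating out one input: on each of its level sets the indicator is
    replaced by the conditional probability, and the sum over the levels is the
    conditional generating function. *)
Lemma cmean_input_pgf (D : set I) F i (g u pgf : R -> C) : cond_free D F -> ~ D i ->
  cmeasurable g -> cbounded (g \o alpha) ->
  cmeasurable u -> (forall w, sqnorm (u (alpha w)) <= 1) ->
  (forall N w, \sum_(m < N) q i m (alpha w) <= 1) ->
  (forall w, ccvg (fun N => \sum_(m < N) (q i m (alpha w))%:C%C * u (alpha w) ^+ m)
                  (pgf (alpha w))) ->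
  cmean P (fun w => g (alpha w) * F w * u (alpha w) ^+ Z i w) =
  cmean P (fun w => g (alpha w) * F w * pgf (alpha w)).
Proof.
move=> FD Di mg bg mu u1 q1 qpgf; have [mF [K FK]] := (cboundedP _).1 FD.1.
have [_ [Kg gK]] := (cboundedP _).1 bg.
have K0 : 0 <= K := le_trans (sqnorm_ge0 _) (FK point).
have Kg0 : 0 <= Kg := le_trans (sqnorm_ge0 _) (gK point).
have mg' := cmeasurable_comp_alpha mg.
have mu' := cmeasurable_comp_alpha mu.
have bu m : cbounded (fun w => u (alpha w) ^+ m).
  apply: cbounded_disc => [|w]; first exact: cmeasurableX.
  exact: sqnorm_le1X.
have bq m : cbounded (fun w => (q i m (alpha w))%:C%C).
  apply: cbounded_real; split; first exact: (measurableT_comp (mq _ _) malpha).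
  by exists 1 => w; have /andP[q0 q1'] := q01 i m w; rewrite ger0_norm.
have L1 : ccvg (fun N => \sum_(m < N) cmean P (fun w => (Z i w == m)%:R *
      (g (alpha w) * F w * u (alpha w) ^+ m)))
    (cmean P (fun w => g (alpha w) * F w * u (alpha w) ^+ Z i w)).
  apply: (@cvg_cmean_levels _ _ _ P (Z i)
    (fun m w => g (alpha w) * F w * u (alpha w) ^+ m) (Kg * K * 1) (mZ i)).
  - move=> m; apply: cmeasurableM; last exact: cmeasurableX.
    exact: cmeasurableM.
  - move=> m w; rewrite !sqnormM; apply: ler_pM; rewrite ?mulr_ge0 ?sqnorm_ge0//.
      by apply: ler_pM; rewrite ?sqnorm_ge0 ?gK.
    exact: sqnorm_le1X.
apply: (ccvg_unique L1) => {L1}.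
rewrite (_ : (fun N => _) = (fun N => cmean P (fun w => \sum_(m < N)
    (g (alpha w) * F w * ((q i m (alpha w))%:C%C * u (alpha w) ^+ m))))).
  apply: proj2; apply: (@cvg_cmean _ _ _ P (fun N w => \sum_(m < N)
    (g (alpha w) * F w * ((q i m (alpha w))%:C%C * u (alpha w) ^+ m)))
    (fun w => g (alpha w) * F w * pgf (alpha w)) (Kg * K * 2 + 1)).
  - move=> N; apply: cbounded_sum => m.
    by apply: cboundedM; apply: cboundedM => //; exact: FD.1.
  - move=> N w; apply: coord_le_sqnorm; rewrite -mulr_sumr !sqnormM.
    apply: ler_pM; rewrite ?mulr_ge0 ?sqnorm_ge0//.
      by apply: ler_pM; rewrite ?sqnorm_ge0 ?gK.
    have co (f : C -> R) : (forall (a : R) z, f (a%:C%C * z) = a * f z) ->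
        (forall (s : seq 'I_N) G, f (\sum_(i <- s) G i) = \sum_(i <- s) f (G i)) ->
        (forall z, sqnorm z <= 1 -> `|f z| <= 1) ->
        f (\sum_(m < N) (q i m (alpha w))%:C%C * u (alpha w) ^+ m) ^+ 2 <= 1.
      move=> fZ fS f1; rewrite fS -real_normK ?num_real// exprn_ile1//.
      apply: le_trans (q1 N w); apply: le_trans (ler_norm_sum _ _ _) _.
      apply: ler_sum => m _; have /andP[q0 q1'] := q01 i m w.
      by rewrite fZ normrM ger0_norm// ler_piMr// f1// sqnorm_le1X.
    rewrite [2]/(1 + 1) /sqnorm lerD//; apply: co.
    - by move=> a z; rewrite cReM /= mul0r subr0.
    - by move=> s G; rewrite cRe_sum.
    - by move=> z /sqnorm_le1_coord[].
    - by move=> a z; rewrite cImM /= mul0r addr0.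
    - by move=> s G; rewrite cIm_sum.
    - by move=> z /sqnorm_le1_coord[].
  - by move=> w; under eq_fun do rewrite -mulr_sumr; exact: ccvgZ.
apply/funext => N; rewrite cmean_sum; last first.
  by move=> m; apply: cboundedM; apply: cboundedM => //; exact: FD.1.
apply: eq_bigr => m _.
have Di' j : j \in [:: i] -> ~ D j by rewrite inE => /eqP ->.
have h := FD.2 [:: i] (fun=> m) (fun a => g a * u a ^+ m) isT Di'
  (cmeasurableM mg (cmeasurableX m mu)) (cboundedM bg (bu m)).
 rewrite (eq_cmean P (G := fun w => g (alpha w) * u (alpha w) ^+ m * F w *
    \prod_(j <- [:: i]) (Z j w == m)%:R)).
  by rewrite h; apply: eq_cmean => w; rewrite big_seq1; ring.
by move=> w; rewrite big_seq1; ring.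
Qed.

End ConditionalIndependence.

(** * The joint generating function of the process *)

Section MeasurableInverse.
Context {R : realType}.

(** The inverse function is the pointwise limit of x / (x^2 + 1/n), also at 0
    with the convention that 0 is its own inverse. *)
Lemma measurable_inv : measurable_fun setT (fun x : R => x^-1).
Proof.
pose h (n : nat) (x : R) := x / (x ^+ 2 + n.+1%:R^-1).
have pos (n : nat) (x : R) : 0 < x ^+ 2 + n.+1%:R^-1.
  by rewrite ltr_wpDl ?sqr_ge0// invr_gt0 ltr0n.
apply: (@measurable_fun_cvg _ _ _ setT h) => //.
  move=> n; apply: continuous_measurable_fun => x.
  apply: cvgM; first exact: cvg_id.
  apply: cvgV; first by rewrite gt_eqF.
  by apply: cvgD; [exact: exprn_continuous | exact: cvg_cst].
move=> x _; rewrite /h; have [->|x0] := eqVneq x 0.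
  by under eq_fun do rewrite mul0r; rewrite invr0; exact: cvg_cst.
have -> : x^-1 = x / (x ^+ 2 + 0).
  by rewrite addr0 expr2 invfM mulrA divff// mul1r.
apply: cvgM; first exact: cvg_cst.
apply: cvgV; first by rewrite addr0 sqrf_eq0.
by apply: cvgD; [exact: cvg_cst | exact: cvg_harmonic].
Qed.

End MeasurableInverse.

Section GeneratingFunction.
Context {R : realType}.
Local Notation C := R[i].

(** The conditional laws that the model prescribes for the inputs, given that
    the thinning parameter is [a]. *)
Definition input_pmf (lam : R) (i : option (nat * nat + nat)) (m : nat) (a : R) : R :=
  match i with
  | None => poisson_pmf (lam / (1 - a)) m
  | Some (inl _) => if m is m'.+1 then (if m' is _.+1 then 0 else a) else 1 - a
  | Some (inr _) => poisson_pmf lam m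
  end.

(** Logarithm of the generating function at [z 0, ..., z (n - 1), w] of the first
    [n + 1] values of the INAR(1) process with parameter [a]: the last value is
    integrated out first, which changes the last argument. *)
Fixpoint log_pgf (lam a : R) (z : nat -> C) (n : nat) (w : C) : C :=
  if n is n'.+1 then
    lam%:C%C * (w - 1) + log_pgf lam a z n' (z n' * (1 + a%:C%C * (w - 1)))
  else (lam / (1 - a))%:C%C * (w - 1).

Lemma measurable_input_pmf lam i m : measurable_fun setT (input_pmf lam i m).
Proof.
have mrate : measurable_fun setT (fun a : R => lam / (1 - a)).
  apply: measurable_funM => //; apply: (measurableT_comp measurable_inv).
  exact: measurable_funB.
case: i => [[kj|k]|] /=.
- case: m => [|[|m]] /=; [|exact: measurable_id|exact: measurable_cst].
  by apply: measurable_funB; [exact: measurable_cst|exact: measurable_id].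
- exact: measurable_cst.
- by apply: (measurableT_comp (f := @poisson_pmf R ^~ m)) => //; exact: measurable_poisson_pmf.
Qed.

Lemma sum_input_pmf_le1 lam i a N : 0 < lam -> 0 < a < 1 ->
  \sum_(m < N) input_pmf lam i m a <= 1.
Proof.
move=> lam0 /andP[a0 a1]; case: i => [[kj|k]|] /=.
- case: N => [|[|N]]; first by rewrite big_ord0.
    by rewrite big_ord_recl big_ord0 /=; lra.
  by rewrite !big_ord_recl /= big1//; lra.
- exact: sum_poisson_pmf_le1.
- by apply: sum_poisson_pmf_le1; rewrite divr_gt0// subr_gt0.
Qed.

Lemma input_pmf01 lam i m a : 0 < lam -> 0 < a < 1 -> 0 <= input_pmf lam i m a <= 1.
Proof.
move=> lam0 a01.
have p0 k : 0 <= input_pmf lam i k a.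
  case: i => [[kj|k']|] /=; rewrite ?poisson_pmf_ge0//.
  by move/andP: a01 => [a0 a1]; case: k => [|[|k]]; lra.
rewrite p0 /=; apply: le_trans (sum_input_pmf_le1 i m.+1 lam0 a01).
by rewrite big_ord_recr /= lerDr sumr_ge0.
Qed.

Lemma cvg_bernoulli_pgf lam kj a (w : C) :
  ccvg (fun N => \sum_(m < N) (input_pmf lam (Some (inl kj)) m a)%:C%C * w ^+ m)
       (1 + a%:C%C * (w - 1)).
Proof.
have E N : (2 <= N)%N -> \sum_(m < N) (input_pmf lam (Some (inl kj)) m a)%:C%C * w ^+ m =
    1 + a%:C%C * (w - 1).
  case: N => [|[|N]]// _; rewrite !big_ord_recl /= big1; last first.
    by move=> i _; rewrite mul0r.
  by rewrite expr0 expr1 rmorphB rmorph1; ring.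
by split; apply: cvg_near_cst; exists 2%N => // N /= N2; rewrite E.
Qed.

Lemma cmeasurable_log_pgf lam z n (u : R -> C) :
  cmeasurable u -> cmeasurable (fun a => log_pgf lam a z n (u a)).
Proof.
have mid : cmeasurable (fun a : R => a%:C%C) by exact: cmeasurable_real.
elim: n u => [|n IH] u mu /=.
  apply: cmeasurableM; last by apply: cmeasurableD => //; exact: cmeasurable_cst.
  apply: cmeasurable_real; apply: measurable_funM => //.
  by apply: (measurableT_comp measurable_inv); exact: measurable_funB.
apply: cmeasurableD.
  apply: cmeasurableM; first exact: cmeasurable_cst.
  by apply: cmeasurableD => //; exact: cmeasurable_cst.
apply: (IH (fun a : R => z n * (1 + a%:C%C * (u a - 1)))).
apply: cmeasurableM; first exact: cmeasurable_cst.
apply: cmeasurableD; first exact: cmeasurable_cst.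
apply: cmeasurableM => //.
by apply: cmeasurableD => //; exact: cmeasurable_cst.
Qed.

Lemma Re_sub1_le0 (lam : R) (w : C) :
  0 <= lam -> sqnorm w <= 1 -> Re (lam%:C%C * (w - 1)) <= 0.
Proof.
move=> lam0 /sqnorm_le1_coord[+ _]; rewrite ler_norml => /andP[_ w1].
rewrite cReM /= mul0r subr0 mulr_ge0_le0//.
by case: w w1 => p s /=; rewrite subr_le0.
Qed.

(** The exponential of [log_pgf] stays in the unit disc, as a generating
    function must; this dominates all the means below. *)
Lemma Re_log_pgf_le0 lam a z n (w : C) : 0 < lam -> 0 < a < 1 ->
  (forall k, sqnorm (z k) <= 1) -> sqnorm w <= 1 -> Re (log_pgf lam a z n w) <= 0.
Proof.
move=> lam0 /andP[a0 a1] z1; elim: n w => [|n IH] w w1 /=.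
  by apply: Re_sub1_le0 => //; rewrite divr_ge0 ?subr_ge0 ?ltW.
rewrite cReD -[leRHS](addr0 0) lerD//; first by apply: Re_sub1_le0 => //; exact: ltW.
by apply: IH; rewrite sqnorm_le1M// sqnorm_le1_conv// !ltW.
Qed.

End GeneratingFunction.

Section Inar1.
Context {R : realType} {d} {T : measurableType d} (P : probability T R).
Local Notation C := R[i].
Context (lam : R) (lam0 : 0 < lam).
Context (alpha : T -> R) (malpha : measurable_fun setT alpha).
Context (alpha01 : forall w, 0 < alpha w < 1).
Context (X0 : T -> nat) (xi : nat -> nat -> T -> nat) (eps : nat -> T -> nat).
Context (mX0 : measurable_fun setT X0) (mxi : forall k j, measurable_fun setT (xi k j)).
Context (meps : forall k, measurable_fun setT (eps k)).

Local Notation Z := (inar1_inputs X0 xi eps).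
Local Notation X := (inar1 X0 xi eps).
Local Notation free := (cond_free P alpha Z (input_pmf lam)).

Let mZ i : measurable_fun setT (Z i).
Proof. by case: i => [[[k j]|k]|] /=. Qed.

Let mq i m : measurable_fun setT (input_pmf lam i m).
Proof. exact: measurable_input_pmf. Qed.

Let q01 i m w : 0 <= input_pmf lam i m (alpha w) <= 1.
Proof. exact: input_pmf01. Qed.

Let malphaC : cmeasurable (fun a : R => a%:C%C).
Proof. exact: cmeasurable_real. Qed.

(** The binomial thinning of the integer [x] in the step from [n] to [n + 1]. *)
Definition thinned (n x : nat) (w : T) : nat := (\sum_(j < x) xi n j w)%N.

Lemma measurable_thinned n x : measurable_fun setT (thinned n x).
Proof.
elim: x => [|x IH].
  by rewrite (_ : thinned n 0 = fun=> 0%N)//; apply/funext => w; rewrite /thinned big_ord0.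
rewrite (_ : thinned n x.+1 = fun w => (thinned n x w + xi n x w)%N).
  exact: measurable_fun_addn.
by apply/funext => w; rewrite /thinned big_ord_recr.
Qed.

Lemma measurable_inar1 n : measurable_fun setT (X n).
Proof.
elim: n => [|n IH] //=.
have := measurable_fun_nat_index (F := fun x w => (thinned n x w + eps n w)%N) IH.
by apply => x; apply: measurable_fun_addn => //; exact: measurable_thinned.
Qed.

(** The inputs that determine the process up to time [n]. *)
Definition past (n : nat) : set (option (nat * nat + nat)) :=
  [set i | match i with
           | None => True
           | Some (inl (k, _)) => (k < n)%N
           | Some (inr k) => (k < n)%N
           end].

Definition thinning (n x : nat) : set (option (nat * nat + nat)) :=
  [set i | exists2 j, (j < x)%N & i = Some (inl (n, j))].

(** The event that a sum takes a given value, as a convolution. *)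
Lemma addn_level (s t v : nat) :
  \sum_(b < s.+1) (v == b)%:R * (t == (s - b)%N)%:R = (t + v == s)%N%:R :> C.
Proof.
rewrite (sum_level (fun b => (t == (s - b)%N)%:R)) ltnS.
case: leqP => vs; first by rewrite mul1r; congr (_%:R); congr nat_of_bool; lia.
by rewrite mul0r (_ : _ == s = false)//; lia.
Qed.

Lemma past_thinning_fresh n x : ~ (past n `|` thinning n x) (Some (inl (n, x))).
Proof. by move=> [/=|[j jx [xj]]]; [rewrite ltnn | rewrite xj ltnn in jx]. Qed.

Lemma past_thinningS n x :
  Some (inl (n, x)) |` (past n `|` thinning n x) `<=` past n `|` thinning n x.+1.
Proof.
move=> i [->|[pi|[j jx ->]]]; last by right; exists j => //; exact: ltnW.
  by right; exists x.
by left.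
Qed.

Lemma past_eps_fresh n x : ~ (past n `|` thinning n x) (Some (inr n)).
Proof. by move=> [/=|[j jx]//]; rewrite ltnn. Qed.

Lemma pastS n x : Some (inr n) |` (past n `|` thinning n x) `<=` past n.+1.
Proof.
move=> i [->|[|[j jx ->]]] //=.
by case: i => [[[k j]|k]|] //= kn; exact: ltnW.
Qed.

(** Induction on the number of Bernoulli inputs: the event is decomposed
    according to the value of the last one, which is fresh. *)
Lemma cond_free_thinned n x s F : free (past n) F ->
  free (past n `|` thinning n x) (fun w => F w * (thinned n x w == s)%:R).
Proof.
move=> Fn; elim: x s => [|x IH] s.
  have bc : cbounded ((fun=> (0%N == s)%:R : C) \o alpha) by exact: cbounded_cst.
  have := cond_free_alphaM (cmeasurable_cst _) bc Fn.
  move=> /(cond_free_sub (@subsetUl _ (past n) (thinning n 0))).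
  by congr cond_free; apply/funext => w; rewrite mulrC /thinned big_ord0.
apply: (cond_free_sub (@past_thinningS n x)).
have -> : (fun w => F w * (thinned n x.+1 w == s)%:R) = (fun w =>
    \sum_(b < s.+1) F w * (thinned n x w == (s - b)%N)%:R * (xi n x w == b)%:R).
  apply/funext => w; rewrite /thinned big_ord_recr /= -addn_level mulr_sumr.
  by apply: eq_bigr => b _; ring.
apply: (cond_free_sum malpha mZ mq q01) => b.
exact: (cond_free_level malpha mZ mq q01 b (IH _) (@past_thinning_fresh n x)).
Qed.

Lemma cond_free_next n x y F : free (past n) F ->
  free (past n.+1) (fun w => F w * (thinned n x w + eps n w == y)%N%:R).
Proof.
move=> Fn; apply: (cond_free_sub (@pastS n x)).
have -> : (fun w => F w * (thinned n x w + eps n w == y)%N%:R) = (fun w =>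
    \sum_(b < y.+1) F w * (thinned n x w == (y - b)%N)%:R * (eps n w == b)%:R).
  apply/funext => w; rewrite -addn_level mulr_sumr.
  by apply: eq_bigr => b _; ring.
apply: (cond_free_sum malpha mZ mq q01) => b.
exact: (cond_free_level malpha mZ mq q01 b (cond_free_thinned _ _ Fn) (@past_eps_fresh n x)).
Qed.

Context (free0 : free set0 (fun=> 1)).
Context (z : nat -> C) (z1 : forall k, sqnorm (z k) <= 1).

Definition history (n : nat) (w : T) : C := \prod_(k < n) z k ^+ X k w.

Lemma cmeasurable_history n : cmeasurable (history n).
Proof.
apply: cmeasurable_prod => k.
apply: (cmeasurable_nat_index (F := fun m _ => z k ^+ m) (measurable_inar1 k)) => m.
exact: cmeasurable_cst.
Qed.

Lemma sqnorm_history n w : sqnorm (history n w) <= 1.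
Proof. by apply: sqnorm_le1_prod => k; exact: sqnorm_le1X. Qed.

(** The history is a function of the past inputs. Although the number of
    Bernoulli inputs used at each step is random, it is constant on the level
    sets of the current value. *)
Lemma cond_free_history n x :
  free (past n) (fun w => history n w * (X n w == x)%:R).
Proof.
elim: n x => [|n IH] x.
  have h := cond_free_level malpha mZ mq q01 x free0 (i := None) id.
  rewrite (_ : (fun w => _) = (fun w => 1 * (Z None w == x)%:R)).
    by apply: cond_free_sub h => i [->|].
  by apply/funext => w; rewrite /history big_ord0.
rewrite (_ : (fun w => _) = (fun w => history n w * z n ^+ X n w *
    (thinned n (X n w) w + eps n w == x)%N%:R)); last first.
  by apply/funext => w; rewrite /history big_ord_recr.
apply: (@cond_free_levels _ _ _ P alpha malpha _ Z mZ (input_pmf lam) mq q01 _ (X n)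
  (fun m w => history n w * z n ^+ m * (thinned n m w + eps n w == x)%N%:R) 1).
- exact: measurable_inar1.
- move=> m; apply: cmeasurableM.
    by apply: cmeasurableM; [exact: cmeasurable_history | exact: cmeasurable_cst].
  apply: cmeasurable_level; apply: measurable_fun_addn => //.
  exact: measurable_thinned.
- move=> m w; rewrite !sqnorm_le1M ?sqnorm_history ?sqnorm_le1X ?sqnorm_bool//.
- move=> m.
  have bc : cbounded ((fun=> z n ^+ m) \o alpha) by exact: cbounded_cst.
  have := cond_free_next m x (cond_free_alphaM (cmeasurable_cst _) bc (IH m)).
  by congr cond_free; apply/funext => w; ring.
Qed.

Lemma cond_free_thinnedX n x (F : T -> C) (u : R -> C) :
  cmeasurable u -> (forall w, sqnorm (u (alpha w)) <= 1) ->
  free (past n) F -> free (past n `|` thinning n x) (fun w => F w * u (alpha w) ^+ thinned n x w).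
Proof.
move=> mu u1 Fn; elim: x => [|x IH].
  apply: (cond_free_sub (@subsetUl _ (past n) (thinning n 0))).
  rewrite (_ : (fun w => _) = F)//; apply/funext => w.
  by rewrite /thinned big_ord0 mulr1.
apply: (cond_free_sub (@past_thinningS n x)).
rewrite (_ : (fun w => _) = (fun w =>
    F w * u (alpha w) ^+ thinned n x w * u (alpha w) ^+ xi n x w)); last first.
  by apply/funext => w; rewrite /thinned big_ord_recr /= exprD mulrA.
apply: (cond_free_inputM malpha mZ mq q01 (c := fun k a => u a ^+ k) IH
  (@past_thinning_fresh n x)) => k; first exact: cmeasurableX.
by move=> w; exact: sqnorm_le1X.
Qed.

Let mconv (u : R -> C) : cmeasurable u -> cmeasurable (fun a : R => 1 + a%:C%C * (u a - 1)).
Proof.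
move=> mu; apply: cmeasurableD; first exact: cmeasurable_cst.
by apply: cmeasurableM => //; apply: cmeasurableD => //; exact: cmeasurable_cst.
Qed.

Let conv1 (u : R -> C) w : sqnorm (u (alpha w)) <= 1 ->
  sqnorm (1 + (alpha w)%:C%C * (u (alpha w) - 1)) <= 1.
Proof.
by move=> u1; have /andP[a0 a1] := alpha01 w; rewrite sqnorm_le1_conv// !ltW.
Qed.

Let cboundedM_disc (g h : R -> C) : cbounded (g \o alpha) -> cmeasurable h ->
  (forall w, sqnorm (h (alpha w)) <= 1) -> cbounded ((fun a => g a * h a) \o alpha).
Proof.
move=> bg mh h1; apply: cboundedM => //.
apply: cbounded_disc => //; exact: (cmeasurable_comp_alpha malpha mh).
Qed.

(** The Bernoulli inputs are integrated out one at a time, the last one first,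
    and each contributes the same factor. *)
Lemma cmean_thinned_pgf n x (F : T -> C) (g u : R -> C) : free (past n) F ->
  cmeasurable g -> cbounded (g \o alpha) ->
  cmeasurable u -> (forall w, sqnorm (u (alpha w)) <= 1) ->
  cmean P (fun w => g (alpha w) * F w * u (alpha w) ^+ thinned n x w) =
  cmean P (fun w => g (alpha w) * F w * (1 + (alpha w)%:C%C * (u (alpha w) - 1)) ^+ x).
Proof.
move=> Fn mg bg mu u1; elim: x g mg bg => [|x IH] g mg bg.
  by apply: eq_cmean => w; rewrite /thinned big_ord0.
have := cmean_input_pgf malpha mZ mq q01 (cond_free_thinnedX x mu u1 Fn)
  (@past_thinning_fresh n x) mg bg mu u1
  (fun N w => sum_input_pmf_le1 _ N lam0 (alpha01 w))
  (fun w => cvg_bernoulli_pgf lam (n, x) (alpha w) (u (alpha w)))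
  (pgf := fun a : R => 1 + a%:C%C * (u a - 1)).
move=> e; transitivity (cmean P (fun w => g (alpha w) * (F w * u (alpha w) ^+ thinned n x w)
    * u (alpha w) ^+ xi n x w)).
  by apply: eq_cmean => w; rewrite /thinned big_ord_recr /= exprD; ring.
rewrite e.
have mg' := cmeasurableM mg (mconv mu).
have bg' := cboundedM_disc bg (mconv mu) (fun w => conv1 (u1 w)).
transitivity (cmean P (fun w => (g (alpha w) * (1 + (alpha w)%:C%C * (u (alpha w) - 1))) *
    F w * u (alpha w) ^+ thinned n x w)).
  by apply: eq_cmean => w; ring.
rewrite (IH _ mg' bg').
by apply: eq_cmean => w; rewrite exprS; ring.
Qed.

Let mexp (u : R -> C) : cmeasurable u -> cmeasurable (fun a : R => cexp (lam%:C%C * (u a - 1))).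
Proof.
move=> mu; apply: cmeasurable_cexp; apply: cmeasurableM; first exact: cmeasurable_cst.
by apply: cmeasurableD => //; exact: cmeasurable_cst.
Qed.

Lemma cmean_next_pgf n x (F : T -> C) (g u : R -> C) : free (past n) F ->
  cmeasurable g -> cbounded (g \o alpha) ->
  cmeasurable u -> (forall w, sqnorm (u (alpha w)) <= 1) ->
  cmean P (fun w => g (alpha w) * F w * u (alpha w) ^+ (thinned n x w + eps n w)) =
  cmean P (fun w => g (alpha w) * cexp (lam%:C%C * (u (alpha w) - 1)) * F w *
    (1 + (alpha w)%:C%C * (u (alpha w) - 1)) ^+ x).
Proof.
move=> Fn mg bg mu u1.
have e1 w : sqnorm (cexp (lam%:C%C * (u (alpha w) - 1))) <= 1.
  by apply: sqnorm_cexp_le1; apply: Re_sub1_le0 => //; exact: ltW.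
have := cmean_input_pgf malpha mZ mq q01 (cond_free_thinnedX x mu u1 Fn)
  (@past_eps_fresh n x) mg bg mu u1
  (fun N w => sum_input_pmf_le1 _ N lam0 (alpha01 w))
  (fun w => cvg_poisson_pgf (u (alpha w)) lam0)
  (pgf := fun a : R => cexp (lam%:C%C * (u a - 1))).
move=> e; transitivity (cmean P (fun w => g (alpha w) * (F w * u (alpha w) ^+ thinned n x w)
    * u (alpha w) ^+ eps n w)).
  by apply: eq_cmean => w; rewrite exprD; ring.
rewrite e -(cmean_thinned_pgf x Fn (cmeasurableM mg (mexp mu))
  (cboundedM_disc bg (mexp mu) e1) mu u1).
by apply: eq_cmean => w; ring.
Qed.

(** Given the earlier values, the last one is a binomial thinning plus a Poisson
    innovation. Integrating it out produces the Poisson factor and changes the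
    argument attached to the preceding value, which is the recursion that
    defines [log_pgf]. *)
Lemma inar1_pgf n (g u : R -> C) :
  cmeasurable g -> cbounded (g \o alpha) ->
  cmeasurable u -> (forall w, sqnorm (u (alpha w)) <= 1) ->
  cmean P (fun w => g (alpha w) * history n w * u (alpha w) ^+ X n w) =
  cmean P (fun w => g (alpha w) * cexp (log_pgf lam (alpha w) z n (u (alpha w)))).
Proof.
elim: n g u => [|n IH] g u mg bg mu u1.
  have mu0 w : 0 < lam / (1 - alpha w).
    by have /andP[a0 a1] := alpha01 w; rewrite divr_gt0// subr_gt0.
  have := cmean_input_pgf malpha mZ mq q01 free0 (i := None) id mg bg mu u1
    (fun N w => sum_input_pmf_le1 _ N lam0 (alpha01 w))
    (fun w => cvg_poisson_pgf (u (alpha w)) (mu0 w))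
    (pgf := fun a : R => cexp ((lam / (1 - a))%:C%C * (u a - 1))).
  move=> e; transitivity (cmean P (fun w => g (alpha w) * 1 * u (alpha w) ^+ X0 w)).
    by apply: eq_cmean => w; rewrite /history big_ord0.
  by rewrite e; apply: eq_cmean => w; rewrite mulr1.
have e1 w : sqnorm (cexp (lam%:C%C * (u (alpha w) - 1))) <= 1.
  by apply: sqnorm_cexp_le1; apply: Re_sub1_le0 => //; exact: ltW.
have [_ [Kg gK]] := (cboundedP _).1 bg.
have mg' := cmeasurable_comp_alpha malpha mg.
have mu' := cmeasurable_comp_alpha malpha mu.
have mh := cmeasurable_history n.
transitivity (cmean P (fun w => g (alpha w) * history n w * z n ^+ X n w *
    u (alpha w) ^+ (thinned n (X n w) w + eps n w))).
  by apply: eq_cmean => w; rewrite /history big_ord_recr /=; ring.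
transitivity (cmean P (fun w => g (alpha w) * cexp (lam%:C%C * (u (alpha w) - 1)) *
    history n w * z n ^+ X n w * (1 + (alpha w)%:C%C * (u (alpha w) - 1)) ^+ X n w)).
  apply: (@eq_cmean_levels _ _ _ P (X n)
    (fun x w => g (alpha w) * history n w * z n ^+ x *
      u (alpha w) ^+ (thinned n x w + eps n w))
    (fun x w => g (alpha w) * cexp (lam%:C%C * (u (alpha w) - 1)) *
      history n w * z n ^+ x * (1 + (alpha w)%:C%C * (u (alpha w) - 1)) ^+ x) Kg).
  - exact: measurable_inar1.
  - move=> x; apply: cmeasurableM.
      by apply: cmeasurableM; [exact: cmeasurableM | exact: cmeasurable_cst].
    apply: (cmeasurable_nat_index (F := fun k w => u (alpha w) ^+ k)).
      by apply: measurable_fun_addn => //; exact: measurable_thinned.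
    by move=> k; exact: cmeasurableX.
  - move=> x; apply: cmeasurableM.
      apply: cmeasurableM; last exact: cmeasurable_cst.
      apply: cmeasurableM => //; apply: cmeasurableM => //.
      exact: (cmeasurable_comp_alpha malpha (mexp mu)).
    apply: cmeasurableX; exact: (cmeasurable_comp_alpha malpha (mconv mu)).
  - move=> x w; rewrite -!mulrA sqnormM -[leRHS]mulr1 ler_pM ?sqnorm_ge0 ?gK//.
    by rewrite !sqnorm_le1M ?sqnorm_history ?sqnorm_le1X.
  - move=> x w; rewrite -!mulrA sqnormM -[leRHS]mulr1 ler_pM ?sqnorm_ge0 ?gK//.
    by rewrite !sqnorm_le1M ?sqnorm_history ?sqnorm_le1X ?conv1.
  - move=> x; have bc : cbounded ((fun=> z n ^+ x) \o alpha) by exact: cbounded_cst.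
    have := cmean_next_pgf x (cond_free_alphaM (cmeasurable_cst _) bc
      (cond_free_history n x)) mg bg mu u1.
    by congr (_ = _); apply: eq_cmean => w; ring.
transitivity (cmean P (fun w => g (alpha w) * cexp (lam%:C%C * (u (alpha w) - 1)) *
    history n w * (z n * (1 + (alpha w)%:C%C * (u (alpha w) - 1))) ^+ X n w)).
  by apply: eq_cmean => w; rewrite exprMn; ring.
rewrite (IH (fun a : R => g a * cexp (lam%:C%C * (u a - 1)))
  (fun a : R => z n * (1 + a%:C%C * (u a - 1)))).
- by apply: eq_cmean => w; rewrite /= cexpD; ring.
- exact: cmeasurableM mg (mexp mu).
- exact: cboundedM_disc bg (mexp mu) e1.
- apply: cmeasurableM; [exact: cmeasurable_cst | exact: mconv].
- by move=> w; rewrite sqnorm_le1M ?conv1.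
Qed.

End Inar1.

(** * The inputs are conditionally independent in the above sense *)

Section ConditionalProbabilities.
Context {R : realType} {d} {T : measurableType d} (P : probability T R).
Local Notation C := R[i].
Local Notation mean f := (\int[P]_w f w).
Context (alpha : T -> R) (malpha : measurable_fun setT alpha).

Lemma mean_indicM (A : set T) (f : T -> R) : measurable A -> bounded_mfun f ->
  (mean (fun w => \1_A w * f w))%:E = (\int[P]_(w in A) (f w)%:E)%E.
Proof.
move=> mA bf; rewrite /Rintegral fineK; last first.
  apply: (integrable_fin_num measurableT); apply: bounded_mfun_integrable.
  by apply: bounded_mfunM => //; exact: bounded_mfun_indic.
rewrite [RHS]integral_mkcond; apply: eq_integral => w _.
rewrite patchE indicE; case: ifPn => _; first by rewrite mul1r.
by rewrite mul0r.
Qed.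

Lemma cond_prob_mean (E : set T) (f : T -> R) : measurable E -> bounded_mfun f ->
  is_cond_prob P (g_sigma_algebra_preimage alpha) E f ->
  forall A, measurable A ->
  mean (fun w => \1_(alpha @^-1` A) w * f w) =
  mean (fun w => \1_(alpha @^-1` A) w * \1_E w).
Proof.
move=> mE bf [_ _ _ h] A mA.
have mA' : measurable (alpha @^-1` A) by rewrite -[_ @^-1` _]setTI; exact: malpha.
have GA : g_sigma_algebra_preimage alpha (alpha @^-1` A) by exists A => //; rewrite setTI.
apply: EFin_inj; rewrite !mean_indicM//; last exact: bounded_mfun_indic.
exact: h.
Qed.

(** The total probability formula. *)
Lemma mean_cond_prob (E : set T) (f : T -> R) : measurable E -> bounded_mfun f ->
  is_cond_prob P (g_sigma_algebra_preimage alpha) E f -> mean f = mean (\1_E : T -> R).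
Proof.
move=> mE bf /(cond_prob_mean mE bf)/(_ _ measurableT); rewrite preimage_setT.
have h g : mean (fun w => \1_[set: T] w * g w) = mean g.
  by apply: eq_Rintegral => w _; rewrite indicT mul1r.
by rewrite !h.
Qed.

Lemma ge0_integral_funeneg (f : T -> \bar R) : (forall w, 0 <= f w)%E ->
  (\int[P]_w f^\- w < +oo)%E.
Proof.
move=> f0; rewrite (eq_integral (cst 0%E)) ?integral0 ?ltry// => w _.
by rewrite (ge0_funenegE (D := setT)) ?inE.
Qed.

Lemma cond_prob_null (E : set T) : measurable E -> P E = 0%E ->
  is_cond_prob P (g_sigma_algebra_preimage alpha) E (fun=> 0).
Proof.
move=> mE E0; split.
- by apply: ge0_integral_funeneg => w; rewrite lee_fin indicE.
- by apply: ge0_integral_funeneg.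
- move=> B mB; exists (if 0%E \in B then setT else set0); first by case: ifP.
  rewrite setTI; apply/seteqP; split => w /=.
    by case: ifPn => // /set_mem.
  by move=> B0; rewrite mem_set.
- move=> A [B mB <-]; rewrite setTI integral0 /=.
  have mA : measurable (alpha @^-1` B) by rewrite -[_ @^-1` _]setTI; exact: malpha.
  rewrite integral_indic//; apply/esym/(subset_measure0 _ _ _ E0) => //.
  exact: measurableI.
Qed.

End ConditionalProbabilities.

Section InputsFree.
Context {R : realType} {d} {T : measurableType d} (P : probability T R).
Local Notation C := R[i].
Local Notation mean f := (\int[P]_w f w).
Context (lam : R) (lam0 : 0 < lam).
Context (alpha : {RV P >-> R}) (alpha01 : forall w, 0 < alpha w < 1).
Context (X0 : {RV P >-> nat}) (xi : nat -> nat -> {RV P >-> nat}).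
Context (eps : nat -> {RV P >-> nat}).
Context (hinputs : randomized_inar1_inputs P lam alpha X0 xi eps).
Local Notation Z := (inar1_inputs X0 xi eps).

Let malpha : measurable_fun setT alpha.
Proof. exact: measurable_funPT. Qed.

Let mZ i : measurable_fun setT (Z i).
Proof. by case: i => [[[k j]|k]|] /=; exact: measurable_funPT. Qed.

Let mZm i m : measurable (Z i @^-1` [set m]).
Proof. by rewrite -[_ @^-1` _]setTI; exact: mZ. Qed.

Let bq i m : bounded_mfun (fun w => input_pmf lam i m (alpha w)).
Proof.
split; first exact: (measurableT_comp (measurable_input_pmf lam i m) malpha).
exists 1 => w; have /andP[q0 q1] := input_pmf01 i m lam0 (alpha01 w).
by rewrite ger0_norm.
Qed.

(** A Bernoulli input has no mass outside {0, 1}, because the two conditional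
    probabilities that are prescribed add up to 1. *)
Lemma bernoulli_input_null k j m : P (xi k j @^-1` [set m.+2]) = 0%E.
Proof.
pose i : option (nat * nat + nat) := Some (inl (k, j)).
have [_ xi1 xi0 _ _] := hinputs.
have h1 := mean_cond_prob malpha (mZm i 1) (bq i 1) (xi1 k j).
have h0 := mean_cond_prob malpha (mZm i 0) (bq i 0) (xi0 k j).
have b n : bounded_mfun (\1_(Z i @^-1` [set n]) : T -> R) by exact: bounded_mfun_indic.
have sum1 : mean (\1_(Z i @^-1` [set 1%N]) : T -> R) +
    mean (\1_(Z i @^-1` [set 0%N]) : T -> R) = 1.
  rewrite -h1 -h0 -meanD; [|exact: (bq i 1)|exact: (bq i 0)].
  by rewrite -[RHS](mean_cst P); apply: eq_Rintegral => w _ /=; ring.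
have le1 : mean (\1_(Z i @^-1` [set m.+2]) : T -> R) +
    (mean (\1_(Z i @^-1` [set 1%N]) : T -> R) +
     mean (\1_(Z i @^-1` [set 0%N]) : T -> R)) <= 1.
  rewrite -!meanD//; last exact: bounded_mfunD.
  rewrite -[leRHS](mean_cst P); apply: le_mean.
  - by apply: bounded_mfunD => //; exact: bounded_mfunD.
  - exact: bounded_mfun_cst.
  - move=> w; have mem n : (w \in Z i @^-1` [set n]) = (Z i w == n).
      by apply/idP/eqP => [/set_mem//|Xm]; apply/mem_set.
    by rewrite !indicE !mem; case: (Z i w) => [|[|n]] /=;
    rewrite ?add0r ?addr0// lern1 leq_b1.
move: le1; rewrite sum1 -[X in _ <= X]add0r lerD2r mean_indic//.
move=> le0; apply/eqP; rewrite -measure_le0.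
rewrite -[X in (X <= _)%E](@fineK _ (P (xi k j @^-1` [set m.+2]))).
  by rewrite lee_fin.
exact: (fin_num_measure P _ (mZm i m.+2)).
Qed.

Lemma cond_prob_input i m : is_cond_prob P (g_sigma_algebra_preimage alpha)
  (Z i @^-1` [set m]) (fun w => input_pmf lam i m (alpha w)).
Proof.
have [_ xi1 xi0 epsP X0P] := hinputs; case: i => [[[k j]|k]|] /=.
- case: m => [|[|m]]; [exact: xi0|exact: xi1|].
  apply: cond_prob_null => //; last exact: bernoulli_input_null.
  exact: (mZm (Some (inl (k, j))) m.+2).
- exact: epsP.
- exact: X0P.
Qed.

(** The conditional independence of the level sets of the inputs is tested
    against events about [alpha], hence against bounded functions of it. *)
Lemma inputs_cond_free :
  cond_free P alpha Z (input_pmf lam) set0 (fun=> 1).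
Proof.
split; first exact: cbounded_cst.
move=> J m g uJ _ mg bg.
pose E : set T := \bigcap_(i in [set` J]) (Z i @^-1` [set m i]).
pose f w := \prod_(i <- J) input_pmf lam i (m i) (alpha w).
have mE : measurable E.
  by apply: fin_bigcap_measurable => // i _; exact: mZm.
have bf : bounded_mfun f.
  split.
    rewrite /f; elim: (J) => [|i s IH].
      by under eq_fun do rewrite big_nil; exact: measurable_cst.
    under eq_fun do rewrite big_cons; apply: measurable_funM => //.
    exact: (bq i (m i)).1.
  exists 1 => w; rewrite normr_prod; elim: (J) => [|i s IH]; first by rewrite big_nil.
  rewrite big_cons; apply: mulr_ile1 => //; first by apply: prodr_ge0.
  by have /andP[q0 q1] := input_pmf01 i (m i) lam0 (alpha01 w); rewrite ger0_norm.
have hE : is_cond_prob P (g_sigma_algebra_preimage alpha) E f.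
  have [ci _ _ _ _] := hinputs.
  by apply: ci => // i _; exact: cond_prob_input.
have indE w : \1_E w = \prod_(j <- J) (Z j w == m j)%:R :> R.
  rewrite indicE; have -> : (w \in E) = all (fun j => Z j w == m j) J.
    apply/idP/allP => [/set_mem wE j jJ|h]; first by apply/eqP; exact: wE.
    by apply/mem_set => j /= jJ; apply/eqP; exact: h.
  elim: (J) => [|j s IH]; first by rewrite big_nil.
  by rewrite big_cons -IH /= -natrM mulnb.
have -> : cmean P (fun w => g (alpha w) * 1 * \prod_(j <- J) (Z j w == m j)%:R) =
    cmean P (fun w => g (alpha w) * (\1_E w)%:C%C).
  by apply: eq_cmean => w; rewrite mulr1 indE rmorph_prod; congr (_ * _);
     apply: eq_bigr => j _; rewrite rmorph_nat.
have -> : cmean P (fun w => g (alpha w) * 1 *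
     \prod_(j <- J) (input_pmf lam j (m j) (alpha w))%:C%C) =
    cmean P (fun w => g (alpha w) * (f w)%:C%C).
  by apply: eq_cmean => w; rewrite mulr1 rmorph_prod.
apply: cmean_preimage_ext => //.
- exact: cbounded_indic.
- exact: cbounded_real.
- move=> A mA; have := cond_prob_mean malpha mE bf hE mA => h.
  apply: complex_ext => /=.
    transitivity (mean (fun w => \1_(alpha @^-1` A) w * \1_E w)).
      by apply: eq_Rintegral => w _ /=; rewrite mul0r subr0.
    by rewrite -h; apply: eq_Rintegral => w _ /=; rewrite mul0r subr0.
  by apply: eq_Rintegral => w _ /=; rewrite !mulr0 !mul0r.
- exact: mg.1.
- exact: mg.2.
Qed.

End InputsFree.

(** * Expansion of the logarithm of the generating function *)

Section TaylorTrig.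
Context {R : realType}.
Implicit Types (x y : R).

(** By the mean value theorem an order of smallness is gained from the
    derivative to the function; all the Taylor bounds below follow. *)
Lemma norm_le_of_derive (f df : R -> R) (K : R) (n : nat) :
  (forall x, is_derive x 1 f (df x)) -> f 0 = 0 ->
  (forall y, `|df y| <= K * `|y| ^+ n) -> forall x, `|f x| <= K * `|x| ^+ n.+1.
Proof.
move=> fdf f0 dfK x.
have cf : continuous f.
  by move=> y; apply/differentiable_continuous/derivable1_diffP; have [] := fdf y.
have K0 : 0 <= K.
  by have := le_trans (normr_ge0 _) (dfK 1); rewrite normr1 expr1n mulr1.
have bnd y : `|y| <= `|x| -> `|df y * x| <= K * `|x| ^+ n.+1.
  move=> yx; rewrite normrM exprSr mulrA ler_wpM2r//.
  by apply: le_trans (dfK y) _; rewrite ler_wpM2l// lerXn2r// nnegrE.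
have [x0|x0|->] := ltgtP x 0.
- have [y yx] := MVT x0 (fun z _ => fdf z) (continuous_subspaceT cf).
  move: yx; rewrite in_itv /= f0 sub0r => /andP[xy y0] e.
  rewrite -[f x]opprK e sub0r mulrN opprK; apply: bnd.
  by rewrite (ltr0_norm x0) (ltr0_norm y0) lerN2 ltW.
- have [y yx] := MVT x0 (fun z _ => fdf z) (continuous_subspaceT cf).
  move: yx; rewrite in_itv /= f0 !subr0 => /andP[xy y0] ->.
  by apply: bnd; rewrite (gtr0_norm x0) (gtr0_norm xy) ltW.
- by rewrite f0 normr0 mulr_ge0// exprn_ge0.
Qed.

Lemma norm_sin_le x : `|sin x| <= `|x|.
Proof.
have := norm_le_of_derive (fun z => is_derive_sin z) (sin0 R) (K := 1) (n := 0).
by rewrite -[`|x|]expr1 -[X in _ <= X]mul1r; apply => y; rewrite expr0 mulr1 cos_max.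
Qed.

Let dcos1 (z : R) : is_derive z (1 : R) (fun x : R => 1 - cos x) (sin z).
Proof. by apply: is_derive_eq; ring. Qed.

Let dxsin (z : R) : is_derive z (1 : R) (fun x : R => x - sin x) (1 - cos z).
Proof. by apply: is_derive_eq; ring. Qed.

Lemma one_sub_cos_le x : `|1 - cos x| <= `|x| /\ `|1 - cos x| <= `|x| ^+ 2.
Proof.
have f0 : 1 - cos 0 = 0 :> R by rewrite cos0 subrr.
split; rewrite -[X in _ <= X]mul1r.
  rewrite -[`|x|]expr1; apply: (norm_le_of_derive dcos1 f0 (K := 1)) => y.
  by rewrite expr0 mulr1 sin_max.
apply: (norm_le_of_derive dcos1 f0 (K := 1)) => y.
by rewrite expr1 mul1r norm_sin_le.
Qed.

Lemma x_sub_sin_le x : `|x - sin x| <= `|x| ^+ 2 /\ `|x - sin x| <= `|x| ^+ 3.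
Proof.
have f0 : 0 - sin 0 = 0 :> R by rewrite sin0 subrr.
split; rewrite -[X in _ <= X]mul1r;
    apply: (norm_le_of_derive dxsin f0 (K := 1)) => y; rewrite mul1r ?expr1;
  by have [] := one_sub_cos_le y.
Qed.

Lemma cos_taylor2_le x : `|cos x - 1 + x ^+ 2 / 2| <= `|x| ^+ 3.
Proof.
rewrite -[X in _ <= X]mul1r.
apply: (@norm_le_of_derive (fun x => cos x - 1 + x ^+ 2 / 2) (fun x => x - sin x)).
- move=> z; apply: is_derive_eq; rewrite /GRing.scale /=. by field.
- by rewrite /= cos0 expr0n mul0r subrr addr0.
- by move=> y; rewrite mul1r; have [] := x_sub_sin_le y.
Qed.

End TaylorTrig.

Section OneNorm.
Context {R : realType}.
Local Notation C := R[i].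
Implicit Types (z w : C) (x : R).

(** Subadditive and submultiplicative like the modulus, but without square
    roots. *)
Definition onenorm z : R := `|Re z| + `|Im z|.

Lemma onenorm_ge0 z : 0 <= onenorm z.
Proof. by rewrite addr_ge0. Qed.

Lemma onenorm0 : onenorm 0 = 0.
Proof. by rewrite /onenorm /= normr0 addr0. Qed.

Lemma onenormD z w : onenorm (z + w) <= onenorm z + onenorm w.
Proof. by rewrite /onenorm cReD cImD addrACA lerD// ler_normD. Qed.

Lemma onenormM z w : onenorm (z * w) <= onenorm z * onenorm w.
Proof.
rewrite /onenorm cReM cImM mulrDl !mulrDr -!normrM.
have := ler_normB (Re z * Re w) (Im z * Im w).
have := ler_normD (Re z * Im w) (Im z * Re w).
by move=> h1 h2; apply: le_trans (lerD h2 h1) _; rewrite addrACA [in X in _ + X]addrC addrACA [in X in _ + X]addrC lexx.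
Qed.

Lemma onenorm_real x : onenorm x%:C%C = `|x|.
Proof. by rewrite /onenorm /= normr0 addr0. Qed.

Lemma onenorm_imag x : onenorm ('i * x%:C)%C = `|x|.
Proof. by rewrite /onenorm /= !mul0r !mul1r subr0 normr0 !add0r. Qed.

Lemma onenorm_sum (I : Type) (s : seq I) (F : I -> C) :
  onenorm (\sum_(i <- s) F i) <= \sum_(i <- s) onenorm (F i).
Proof.
elim: s => [|i s IH]; first by rewrite !big_nil onenorm0.
by rewrite !big_cons (le_trans (onenormD _ _))// lerD2l.
Qed.

Definition cis x : C := cexp ('i * x%:C)%C.

Lemma cisE x : cis x = (cos x +i* sin x)%C.
Proof.
by rewrite /cis /cexp /= !mul0r !mul1r subr0 add0r expR0 !mul1r.
Qed.

Lemma sqnorm_cis x : sqnorm (cis x) = 1.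
Proof. by rewrite cisE /sqnorm /= cos2Dsin2. Qed.

Lemma cis_sub1 x : onenorm (cis x - 1) <= 2 * `|x|.
Proof.
rewrite cisE /onenorm /= subr0 mulrDl mul1r lerD ?norm_sin_le//.
by rewrite distrC; have [] := one_sub_cos_le x.
Qed.

Lemma cis_taylor1 x : onenorm (cis x - 1 - ('i * x%:C)%C) <= 2 * `|x| ^+ 2.
Proof.
rewrite cisE /onenorm /= (_ : cos x - 1 - (0 * x - 1 * 0) = - (1 - cos x)); last by ring.
rewrite (_ : sin x - 0 - (0 * 0 + 1 * x) = - (x - sin x)); last by ring.
rewrite !normrN mulrDl mul1r lerD//.
  by have [] := one_sub_cos_le x.
by have [] := x_sub_sin_le x.
Qed.

Lemma cis_taylor2 x :
  onenorm (cis x - 1 - ('i * x%:C)%C + (x ^+ 2 / 2)%:C%C) <= 2 * `|x| ^+ 3.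
Proof.
rewrite cisE /onenorm /=.
rewrite (_ : _ + (x ^+ 2 / 2) = cos x - 1 + x ^+ 2 / 2); last by ring.
rewrite (_ : sin x - 0 - _ + 0 = - (x - sin x)); last by ring.
rewrite normrN mulrDl mul1r lerD//; first exact: cos_taylor2_le.
by have [] := x_sub_sin_le x.
Qed.

End OneNorm.

Section LogPgfAsymptotics.
Context {R : realType}.
Local Notation C := R[i].

(** The increments [v k = w k - 1] of the successive arguments of the
    generating function. *)
Definition pgf_increments (a : R) (z : nat -> C) (n : nat) (v : nat -> C) : Prop :=
  forall k, (k < n)%N -> v k = z k * (1 + a%:C%C * v k.+1) - 1.

Lemma pgf_increments_exist (a : R) (z : nat -> C) (n : nat) (w : C) :
  exists2 v, v n = w - 1 & pgf_increments a z n v.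
Proof.
elim: n w => [|n IH] w; first by exists (fun=> w - 1).
have [v vn vP] := IH (z n * (1 + a%:C%C * (w - 1))).
exists (fun k => if (k <= n)%N then v k else w - 1); first by rewrite ltnn.
move=> k; rewrite ltnS => kn1.
have /predU1P[->|kn] /= : (k == n) || (k < n)%N by rewrite -leq_eqVlt.
  by rewrite leqnn ltnn vn.
by rewrite (ltnW kn) kn vP.
Qed.

(** Summing the recursion for [v] eliminates the accumulated [v k]: this is
    where the stationary initial law enters. *)
Lemma log_pgf_sum (lam a : R) (z : nat -> C) (n : nat) (w : C) (v : nat -> C) :
  a < 1 -> v n = w - 1 -> pgf_increments a z n v ->
  log_pgf lam a z n w = (lam / (1 - a))%:C%C *
    (v n + \sum_(k < n) (z k - 1) * (1 + a%:C%C * v k.+1)).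
Proof.
move=> a1; elim: n w => [|n IH] w vn vP /=.
  by rewrite big_ord0 addr0 vn.
have vP' : pgf_increments a z n v by move=> k kn; apply: vP; exact: ltnW.
have vnE : v n = z n * (1 + a%:C%C * (w - 1)) - 1 by rewrite vP// vn.
rewrite (IH _ vnE vP') big_ord_recr /= vn vnE.
have -> : lam%:C%C * (w - 1) = (lam / (1 - a))%:C%C * ((1 - a%:C%C) * (w - 1)) :> C.
  rewrite mulrA (_ : 1 - a%:C%C = (1 - a)%:C%C); last by rewrite rmorphB.
  by rewrite -real_complexM divfK// subr_eq0 eq_sym lt_eqF.
by rewrite -!mulrDr; congr (_ * _); ring.
Qed.

(** The successive arguments of the generating function stay in the unit disc,
    by convexity. *)
Lemma sqnorm_increments (a : R) (z : nat -> C) (n : nat) (v : nat -> C) :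
  0 <= a <= 1 -> (forall k, sqnorm (z k) <= 1) -> v n = 0 ->
  pgf_increments a z n v -> forall k, (k <= n)%N -> sqnorm (1 + v k) <= 1.
Proof.
move=> a01 z1 vn vP k kn; rewrite -(subKn kn); elim: (n - k)%N => [|j IH].
  by rewrite subn0 vn addr0 sqnorm1.
have [jn|nj] := ltnP j n; last first.
  by move: IH; rewrite (_ : (n - j.+1 = n - j)%N)//; lia.
rewrite vP; last by lia.
rewrite addrCA subrr addr0 sqnorm_le1M//.
have := sqnorm_le1_conv a01 IH; rewrite addrAC subrr add0r.
by rewrite (_ : (n - j.+1).+1 = (n - j)%N)//; lia.
Qed.

Section Estimates.
Context (a : R) (a0 : 0 < a) (a1 : a < 1).
Context (K tau : R) (K0 : 0 <= K) (tau0 : 0 <= tau).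
Context (c : nat -> R) (n : nat) (v : nat -> C).
Context (cK : forall k, `|c k| <= K) (cn : c n = 0) (vn : v n = 0).
Local Notation z := (fun k => cis (tau * c k)).
Context (vP : pgf_increments a z n v).

(* The solution of [v = i tau c + a v], the linearised recursion for locally
   constant weights. *)
Let b k : C := ('i * (tau * c k / (1 - a))%:C)%C.
(* The fixed point of [x |-> 4 tau K + a x], which bounds the increments. *)
Let V : R := 4 * tau * K / (1 - a).
Let TV : R := \sum_(k < n) `|c k.+1 - c k|.

Let oma : 0 < 1 - a.
Proof. by rewrite subr_gt0. Qed.

Let V0 : 0 <= V.
Proof. by rewrite !mulr_ge0 ?invr_ge0// ltW. Qed.

Let tc k : `|tau * c k| <= tau * K.
Proof. by rewrite normrM ger0_norm// ler_wpM2l. Qed.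

Let vrec k : (k < n)%N -> v k = (z k - 1) * (1 + a%:C%C * v k.+1) + a%:C%C * v k.+1.
Proof. by move=> kn; rewrite vP//; ring. Qed.

Let onenorm_aM x : onenorm (a%:C%C * x) <= a * onenorm x.
Proof. by rewrite (le_trans (onenormM _ _))// onenorm_real gtr0_norm. Qed.

Let onenorm_v k : (k <= n)%N -> onenorm (v k) <= V.
Proof.
move=> kn; rewrite -(subKn kn); elim: (n - k)%N => [|j IH].
  by rewrite subn0 vn onenorm0.
have [jn|nj] := ltnP j n; last first.
  by move: IH; rewrite (_ : (n - j.+1 = n - j)%N)//; lia.
rewrite vrec; last by lia.
rewrite (_ : (n - j.+1).+1 = (n - j)%N); last by lia.
apply: le_trans (onenormD _ _) _.
have h1 : onenorm (1 + a%:C%C * v (n - j)%N) <= 2.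
  have h0 : sqnorm (1 + v (n - j)%N) <= 1.
    apply: (sqnorm_increments _ _ vn vP); rewrite ?leq_subr ?ltW//.
    by move=> m; rewrite sqnorm_cis.
  have a01 : 0 <= a <= 1 by rewrite !ltW.
  have := sqnorm_le1_conv a01 h0; rewrite addrAC subrr add0r.
  by move=> /sqnorm_le1_coord[r1 r2]; rewrite [2]/(1 + 1) lerD.
have h2 := cis_sub1 (tau * c (n - j.+1)%N).
have h3 : onenorm ((z (n - j.+1)%N - 1) * (1 + a%:C%C * v (n - j)%N)) <= 4 * (tau * K).
  apply: le_trans (onenormM _ _) _.
  apply: le_trans (ler_pM (onenorm_ge0 _) (onenorm_ge0 _) h2 h1) _.
  by have := tc (n - j.+1)%N; lra.
apply: le_trans (lerD h3 (onenorm_aM _)) _.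
apply: le_trans (lerD (lexx _) (ler_wpM2l (ltW a0) IH)) _.
have -> : 4 * (tau * K) = (1 - a) * V by rewrite /V; field; rewrite gt_eqF.
by rewrite -mulrDl subrK mul1r.
Qed.

Let bD k : onenorm (b k.+1 - b k) <= tau * `|c k.+1 - c k| / (1 - a).
Proof.
have -> : b k.+1 - b k = ('i * (tau * (c k.+1 - c k) / (1 - a))%:C)%C.
  rewrite /b -mulrBr; congr (_ * _); rewrite -rmorphB; congr (_%:C%C); ring.
by rewrite onenorm_imag !normrM (ger0_norm tau0) normfV (gtr0_norm oma).
Qed.

Let shift : \sum_(k < n) onenorm (v k.+1 - b k.+1) <= \sum_(k < n) onenorm (v k - b k).
Proof.
have : \sum_(k < n.+1) onenorm (v k - b k) =
    onenorm (v 0%N - b 0%N) + \sum_(k < n) onenorm (v k.+1 - b k.+1).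
  by rewrite big_ord_recl.
rewrite big_ord_recr /= vn /b cn mulr0 mul0r mulr0 subr0 onenorm0 addr0.
by move=> ->; rewrite lerDr onenorm_ge0.
Qed.

(** The distance from [v] to [b] is contracted by the factor [a] at each step
    and fed by the second order terms and by the jumps of the weights. *)
Let sum_increment_error :
  (1 - a) * \sum_(k < n) onenorm (v k - b k) <=
  n%:R * (2 * (tau * K) ^+ 2 + 2 * (tau * K) * V) + tau * TV / (1 - a).
Proof.
pose r k := 2 * (tau * K) ^+ 2 + 2 * (tau * K) * V + tau * `|c k.+1 - c k| / (1 - a).
have step (k : 'I_n) : onenorm (v k - b k) <= a * onenorm (v k.+1 - b k.+1) + r k.
  have -> : v k - b k = a%:C%C * (v k.+1 - b k.+1) +
     ((z k - 1 - ('i * (tau * c k)%:C)%C) + (a%:C%C * ((z k - 1) * v k.+1)) +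
      a%:C%C * (b k.+1 - b k)).
    have -> : ('i * (tau * c k)%:C)%C = b k - a%:C%C * b k.
      rewrite /b mulrCA -mulrBr -real_complexM -rmorphB; congr (_ * _%:C%C).
      by field; rewrite gt_eqF.
    by rewrite vrec//; ring.
  apply: le_trans (onenormD _ _) _; rewrite lerD//.
  apply: le_trans (onenormD _ _) _; apply: lerD; last first.
    apply: le_trans (onenorm_aM _) _.
    by apply: le_trans (ler_piMl (onenorm_ge0 _) (ltW a1)) _.
  apply: le_trans (onenormD _ _) _; apply: lerD.
    apply: le_trans (cis_taylor1 _) _; rewrite ler_pM2l//.
    by rewrite lerXn2r ?nnegrE ?mulr_ge0.
  apply: le_trans (onenorm_aM _) _.
  apply: le_trans (ler_piMl (onenorm_ge0 _) (ltW a1)) _.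
  apply: le_trans (onenormM _ _) _; apply: ler_pM; rewrite ?onenorm_ge0 ?onenorm_v//.
  by apply: le_trans (cis_sub1 _) _; rewrite ler_pM2l.
have : \sum_(k < n) onenorm (v k - b k) <=
    \sum_(k < n) (a * onenorm (v k.+1 - b k.+1) + r k).
  by apply: ler_sum => k _; exact: step.
have -> : \sum_(k < n) (a * onenorm (v k.+1 - b k.+1) + r k) =
    a * (\sum_(k < n) onenorm (v k.+1 - b k.+1)) +
    (n%:R * (2 * (tau * K) ^+ 2 + 2 * (tau * K) * V) + tau * TV / (1 - a)).
  rewrite big_split /=; congr (_ + _); first by rewrite mulr_sumr.
  rewrite /r big_split /= sumr_const card_ord; congr (_ + _); first exact: esym (mulr_natl _ _).
  by rewrite /TV mulr_sumr mulr_suml.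
have := ler_wpM2l (ltW a0) shift.
by move=> *; lra.
Qed.

(** To second order [v k.+1] can be replaced by [b k], so that its product with
    [i tau c k] adds [a / (1 - a)] to the coefficient 1/2 of the Taylor
    expansion. The error collects cubic remainders and the distance from [v] to
    [b]. *)
Lemma log_pgf_error :
  onenorm (\sum_(k < n) ((z k - 1) * (1 + a%:C%C * v k.+1) - ('i * (tau * c k)%:C)%C) +
    (tau ^+ 2 * (2^-1 + a / (1 - a)) * \sum_(k < n) c k ^+ 2)%:C%C) <=
  n%:R * (2 * (tau * K) ^+ 3 + 2 * (tau * K) ^+ 2 * V) +
  tau * K * ((n%:R * (2 * (tau * K) ^+ 2 + 2 * (tau * K) * V) + tau * TV / (1 - a)) / (1 - a)
    + tau * TV / (1 - a)).
Proof.
have -> : \sum_(k < n) ((z k - 1) * (1 + a%:C%C * v k.+1) - ('i * (tau * c k)%:C)%C) +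
    (tau ^+ 2 * (2^-1 + a / (1 - a)) * \sum_(k < n) c k ^+ 2)%:C%C =
  \sum_(k < n) ((z k - 1 - ('i * (tau * c k)%:C)%C + ((tau * c k) ^+ 2 / 2)%:C%C) +
    a%:C%C * ((z k - 1 - ('i * (tau * c k)%:C)%C) * v k.+1) +
    ('i * (tau * c k)%:C)%C * (a%:C%C * ((v k.+1 - b k.+1) + (b k.+1 - b k)))).
  rewrite mulr_sumr rmorph_sum -big_split /=; apply: eq_bigr => k _.
  (* Since [b k] is imaginary, its product with [i tau c k] is real and negative. *)
  have -> : (tau ^+ 2 * (2^-1 + a / (1 - a)) * c k ^+ 2)%:C%C =
      ((tau * c k) ^+ 2 / 2)%:C%C - ('i * (tau * c k)%:C)%C * (a%:C%C * b k).
    rewrite /b; apply: complex_ext => /=; last by ring.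
    by field; rewrite gt_eqF.
  by ring.
apply: le_trans (onenorm_sum _ _) _.
have term (k : 'I_n) : onenorm ((z k - 1 - ('i * (tau * c k)%:C)%C + ((tau * c k) ^+ 2 / 2)%:C%C) +
    a%:C%C * ((z k - 1 - ('i * (tau * c k)%:C)%C) * v k.+1) +
    ('i * (tau * c k)%:C)%C * (a%:C%C * ((v k.+1 - b k.+1) + (b k.+1 - b k)))) <=
   (2 * (tau * K) ^+ 3 + 2 * (tau * K) ^+ 2 * V) +
   tau * K * (onenorm (v k.+1 - b k.+1) + tau * `|c k.+1 - c k| / (1 - a)).
  apply: le_trans (onenormD _ _) _; apply: lerD.
    apply: le_trans (onenormD _ _) _; apply: lerD.
      apply: le_trans (cis_taylor2 _) _; rewrite ler_pM2l//.
      by rewrite lerXn2r ?nnegrE ?mulr_ge0.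
    apply: le_trans (onenorm_aM _) _.
    apply: le_trans (ler_piMl (onenorm_ge0 _) (ltW a1)) _.
    apply: le_trans (onenormM _ _) _; apply: ler_pM; rewrite ?onenorm_ge0 ?onenorm_v//.
    apply: le_trans (cis_taylor1 _) _; rewrite ler_pM2l//.
    by rewrite lerXn2r ?nnegrE ?mulr_ge0.
  apply: le_trans (onenormM _ _) _; rewrite onenorm_imag; apply: ler_pM => //.
    exact: onenorm_ge0.
  apply: le_trans (onenorm_aM _) _.
  apply: le_trans (ler_piMl (onenorm_ge0 _) (ltW a1)) _.
  by apply: le_trans (onenormD _ _) _; rewrite lerD.
apply: le_trans (ler_sum _ (fun k _ => term k)) _.
rewrite big_split /= sumr_const card_ord -[X in X + _]mulr_natl lerD2l.
have -> : \sum_(k < n) tau * K *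
     (onenorm (v k.+1 - b k.+1) + tau * `|c k.+1 - c k| / (1 - a)) =
    tau * K * (\sum_(k < n) onenorm (v k.+1 - b k.+1) + tau * TV / (1 - a)).
  by rewrite /TV mulr_sumr mulr_suml -big_split /= mulr_sumr.
rewrite ler_wpM2l ?mulr_ge0// lerD2r.
apply: (le_trans shift).
by rewrite ler_pdivlMr// mulrC sum_increment_error.
Qed.

End Estimates.
End LogPgfAsymptotics.

(** * Its limit under the central limit scaling *)

Section LogPgfLimit.
Context {R : realType}.
Local Notation C := R[i].

Lemma ccvgD (u v : nat -> C) (l m : C) :
  ccvg u l -> ccvg v m -> ccvg (fun n => u n + v n) (l + m).
Proof.
move=> [u1 u2] [v1 v2]; split.
  by under eq_fun do rewrite cReD; rewrite cReD; exact: cvgD.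
by under eq_fun do rewrite cImD; rewrite cImD; exact: cvgD.
Qed.

Lemma ccvg_real (u : nat -> R) (l : R) :
  u n @[n --> \oo] --> l -> ccvg (fun n => (u n)%:C%C) l%:C%C.
Proof. by move=> ul; split => //=; exact: cvg_cst. Qed.

Lemma ccvg0_onenorm (u : nat -> C) (e : nat -> R) :
  (forall n, onenorm (u n) <= e n) -> e n @[n --> \oo] --> 0 -> ccvg u 0.
Proof.
have sq0 (x : nat -> R) : (forall n, `|x n| <= e n) -> e n @[n --> \oo] --> 0 ->
    x n @[n --> \oo] --> 0.
  move=> xe e0; apply/norm_cvg0P; apply: (@squeeze_cvgr _ _ _ _ (fun=> 0) e) => //.
    by near=> n; rewrite normr_ge0 xe.
  exact: cvg_cst.
move=> ue e0; split; apply: sq0 => // n; apply: le_trans (ue n).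
  by rewrite /onenorm lerDl.
by rewrite /onenorm lerDr.
Unshelve. all: by end_near. Qed.

Lemma ccvg_cexp (u : nat -> C) (l : C) :
  ccvg u l -> ccvg (fun n => cexp (u n)) (cexp l).
Proof.
have cE := @continuous_expR R; have cC := @continuous_cos R.
have cS := @continuous_sin R.
move=> [u1 u2]; split => /=; apply: cvgM.
- exact: cvg_comp u1 (cE (Re l)).
- exact: cvg_comp u2 (cC (Im l)).
- exact: cvg_comp u1 (cE (Re l)).
- exact: cvg_comp u2 (cS (Im l)).
Qed.

(** The central limit theorem at the level of cumulants: when the number of
    steps is of order [tau ^- 2] and the weights have bounded variation, the
    error of the second order expansion is of order [tau]. *)
Lemma cvg_log_pgf (lam a K s2 : R) (c : nat -> nat -> R) (n : nat -> nat)
    (tau : nat -> R) :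
  0 < a < 1 -> 0 <= K -> (forall N, 0 <= tau N) -> tau N @[N --> \oo] --> 0 ->
  (forall N k, `|c N k| <= K) -> (forall N, c N (n N) = 0) ->
  (forall N, (n N)%:R * tau N ^+ 2 <= K) ->
  (forall N, \sum_(k < n N) `|c N k.+1 - c N k| <= K) ->
  tau N ^+ 2 * \sum_(k < n N) c N k ^+ 2 @[N --> \oo] --> s2 ->
  ccvg (fun N => log_pgf lam a (fun k => cis (tau N * c N k)) (n N) 1 -
          ('i * (tau N * (lam / (1 - a)) * \sum_(k < n N) c N k)%:C)%C)
       (- (lam * (1 + a) / (1 - a) ^+ 2 / 2 * s2))%:C%C.
Proof.
move=> /andP[a0 a1] K0 tau0 tau_cvg cK cn ntau TVK sq.
have oma : 0 < 1 - a by rewrite subr_gt0.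
pose S N := log_pgf lam a (fun k => cis (tau N * c N k)) (n N) 1 -
  ('i * (tau N * (lam / (1 - a)) * \sum_(k < n N) c N k)%:C)%C.
pose Q N := tau N ^+ 2 * (2^-1 + a / (1 - a)) * \sum_(k < n N) c N k ^+ 2.
(* The bound of [log_pgf_error], where [K] bounds the rescaled number of steps
   and the variation. *)
pose e N := tau N * (K * (2 * K ^+ 3 + 8 * K ^+ 3 / (1 - a)) + K *
  ((K * (2 * K ^+ 2 + 8 * K ^+ 2 / (1 - a)) + tau N * K / (1 - a)) / (1 - a) +
   tau N * K / (1 - a))).
have e0 : e N @[N --> \oo] --> 0.
  rewrite /e -[X in _ --> X](mul0r (K * (2 * K ^+ 3 + 8 * K ^+ 3 / (1 - a)) + K *
    ((K * (2 * K ^+ 2 + 8 * K ^+ 2 / (1 - a)) + 0 * K / (1 - a)) / (1 - a) +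
     0 * K / (1 - a)))).
  have tK : tau N * K / (1 - a) @[N --> \oo] --> 0 * K / (1 - a).
    by apply: cvgMr_tmp; exact: cvgMr_tmp.
  apply: cvgM => //; apply: cvgD; first exact: cvg_cst.
  apply: cvgMl_tmp; apply: cvgD => //; apply: cvgMr_tmp; apply: cvgD => //.
  exact: cvg_cst.
pose err N := S N + (lam / (1 - a) * Q N)%:C%C.
have errE N : onenorm (err N) <= `|lam / (1 - a)| * e N.
  have [v vn vP] := @pgf_increments_exist R a (fun k => cis (tau N * c N k)) (n N) 1.
  have Sum := @log_pgf_sum R lam a (fun k => cis (tau N * c N k)) (n N) 1 v a1 vn vP.
  rewrite subrr in vn; rewrite vn add0r in Sum.
  have -> : err N = (lam / (1 - a))%:C%C *
     (\sum_(k < n N) ((cis (tau N * c N k) - 1) * (1 + a%:C%C * v k.+1) -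
        ('i * (tau N * c N k)%:C)%C) + (Q N)%:C%C).
    rewrite /err /S.
    have -> : ('i * (tau N * (lam / (1 - a)) * \sum_(k < n N) c N k)%:C)%C =
        (lam / (1 - a))%:C%C * \sum_(k < n N) ('i * (tau N * c N k)%:C)%C.
      have -> : \sum_(k < n N) ('i * (tau N * c N k)%:C)%C =
          ('i * (tau N * \sum_(k < n N) c N k)%:C)%C.
        by rewrite mulr_sumr rmorph_sum mulr_sumr.
      by apply: complex_ext => /=; ring.
    by rewrite Sum real_complexM sumrB; ring.
  apply: le_trans (onenormM _ _) _; rewrite onenorm_real ler_wpM2l//.
  apply: le_trans (log_pgf_error a0 a1 K0 (tau0 N) (cK N) (cn N) vn vP) _.
  set TV := \sum_(k < n N) _; set x := (n N)%:R.
  have i0 : 0 <= (1 - a)^-1 by rewrite invr_ge0 ltW.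
  have x0 : 0 <= x * tau N ^+ 2 by rewrite mulr_ge0 ?sqr_ge0.
  have TV0 : 0 <= TV by rewrite sumr_ge0.
  have -> : x * (2 * (tau N * K) ^+ 3 + 2 * (tau N * K) ^+ 2 * (4 * tau N * K / (1 - a))) +
    tau N * K * ((x * (2 * (tau N * K) ^+ 2 + 2 * (tau N * K) * (4 * tau N * K / (1 - a))) +
      tau N * TV / (1 - a)) / (1 - a) + tau N * TV / (1 - a)) =
    tau N * ((x * tau N ^+ 2) * (2 * K ^+ 3 + 8 * K ^+ 3 / (1 - a)) + K *
    (((x * tau N ^+ 2) * (2 * K ^+ 2 + 8 * K ^+ 2 / (1 - a)) + tau N * TV / (1 - a)) / (1 - a)
     + tau N * TV / (1 - a))).
    by field; rewrite gt_eqF.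
  have p m : 0 <= 2 * K ^+ m + 8 * K ^+ m / (1 - a).
    by rewrite addr_ge0 ?mulr_ge0 ?exprn_ge0.
  have q1 : tau N * TV / (1 - a) <= tau N * K / (1 - a).
    by rewrite ler_wpM2r// ler_wpM2l// TVK.
  rewrite /e ler_wpM2l// lerD ?ler_wpM2r ?ntau// ler_wpM2l// lerD// ler_wpM2r// lerD//.
  by rewrite ler_wpM2r ?ntau.
have err0 : ccvg err 0.
  apply: (ccvg0_onenorm errE); rewrite -[X in _ --> X](mulr0 `|lam / (1 - a)|).
  exact: cvgMl_tmp.
rewrite -[X in ccvg X _]/S.
have -> : S = (fun N => err N + (- (lam / (1 - a) * Q N))%:C%C).
  by apply/funext => N; rewrite /err rmorphN addrK.
rewrite -[X in ccvg _ X]add0r; apply: ccvgD => //; apply: ccvg_real.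
apply: cvgN; rewrite (_ : _ / 2 * s2 = lam / (1 - a) * ((2^-1 + a / (1 - a)) * s2)); last first.
  by field; rewrite gt_eqF.
apply: cvgMl_tmp; rewrite (_ : Q = (fun N => (2^-1 + a / (1 - a)) *
  (tau N ^+ 2 * \sum_(k < n N) c N k ^+ 2))); first exact: cvgMl_tmp.
by apply/funext => N; rewrite /Q; ring.
Qed.

End LogPgfLimit.

(** * Transport of the law to a copy *)

Section SameLaw.
Context {R : realType} {d1 d2 d : measure_display} {T1 : measurableType d1} {T2 : measurableType d2}.
Context {U : measurableType d} (P1 : probability T1 R) (P2 : probability T2 R).
Context (X1 : T1 -> U) (X2 : T2 -> U).
Context (mX1 : measurable_fun setT X1) (mX2 : measurable_fun setT X2).
Context (X12 : same_law P1 X1 P2 X2).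

Lemma same_law_mean (F : U -> R) : measurable_fun setT F ->
  bounded_mfun (F \o X1) -> bounded_mfun (F \o X2) ->
  \int[P1]_w F (X1 w) = \int[P2]_w F (X2 w).
Proof.
move=> mF b1 b2; congr fine.
have mFE : measurable_fun setT (EFin \o F) by exact/measurable_EFinP.
have := integral_pushforward mX1 mFE (bounded_mfun_integrable P1 b1) measurableT.
have := integral_pushforward mX2 mFE (bounded_mfun_integrable P2 b2) measurableT.
rewrite !preimage_setT => <- <-.
by apply: eq_measure_integral => A mA _; exact: X12.
Qed.

Lemma same_law_cmean (F : U -> R[i]) : cmeasurable F ->
  cbounded (F \o X1) -> cbounded (F \o X2) ->
  cmean P1 (fun w => F (X1 w)) = cmean P2 (fun w => F (X2 w)).
Proof.
move=> [m1 m2] [a1 a2] [b1 b2]; apply: complex_ext => /=.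
  exact: (same_law_mean (F := fun u => Re (F u)) m1 a1 b1).
exact: (same_law_mean (F := fun u => Im (F u)) m2 a2 b2).
Qed.

End SameLaw.

Section Inar1Law.
Context {R : realType}.
Local Notation C := R[i].

(** The joint law of the parameter and of the process, as far as it is needed,
    is expressed by generating functions. This form passes to a copy, for which
    the inputs of the recursion are not available. *)
Record inar1_law (lam : R) {d} {T : measurableType d} (P : probability T R)
    (alpha : T -> R) (X : nat -> T -> nat) : Prop := Inar1Law {
  law_malpha : measurable_fun setT alpha ;
  law_alpha01 : forall w, 0 < alpha w < 1 ;
  law_mX : forall k, measurable_fun setT (X k) ;
  law_pgf : forall (n : nat) (z : nat -> C) (g : R -> C) (K : R),
    (forall k, sqnorm (z k) <= 1) -> cmeasurable g ->
    (forall a : R, 0 < a < 1 -> sqnorm (g a) <= K) ->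
    cmean P (fun w => g (alpha w) * \prod_(k < n) z k ^+ X k w) =
    cmean P (fun w => g (alpha w) * cexp (log_pgf lam (alpha w) z n 1))
}.

Lemma cbounded_on01 d (T : measurableType d) (alpha : T -> R) (g : R -> C) (K : R) :
  measurable_fun setT alpha -> (forall w, 0 < alpha w < 1) -> cmeasurable g ->
  (forall a : R, 0 < a < 1 -> sqnorm (g a) <= K) -> cbounded (g \o alpha).
Proof.
move=> ma a01 mg gK; apply/cboundedP; split; first exact (cmeasurable_comp_alpha ma mg).
by exists K => w; exact: gK.
Qed.

(** The value outside ]0, 1[ is arbitrary. *)
Definition clamp01 (a : R) : R := if 0 < a < 1 then a else 2^-1.

Lemma clamp01_itv a : 0 < clamp01 a < 1.
Proof. by rewrite /clamp01; case: ifPn => // _; lra. Qed.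

Lemma clamp01_id a : 0 < a < 1 -> clamp01 a = a.
Proof. by rewrite /clamp01 => ->. Qed.

Lemma measurable_clamp01 : measurable_fun setT clamp01.
Proof.
apply: measurable_fun_if => //.
by apply: measurable_and; exact: measurable_fun_ltr.
Qed.

Lemma inar1_law_inputs (lam : R) d (T : measurableType d) (P : probability T R)
  (alpha : {RV P >-> R}) (X0 : {RV P >-> nat}) (xi : nat -> nat -> {RV P >-> nat})
  (eps : nat -> {RV P >-> nat}) :
  0 < lam -> (forall w, 0 < alpha w < 1) ->
  randomized_inar1_inputs P lam alpha X0 xi eps ->
  inar1_law lam P alpha (inar1 X0 xi eps).
Proof.
move=> lam0 a01 hinputs.
have malpha : measurable_fun setT alpha by exact: measurable_funPT.
have mX0 : measurable_fun setT X0 by exact: measurable_funPT.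
have mxi k j : measurable_fun setT (xi k j) by exact: measurable_funPT.
have meps k : measurable_fun setT (eps k) by exact: measurable_funPT.
split=> //.
  by move=> k; exact: measurable_inar1.
move=> n z g K z1 mg gK.
have := @inar1_pgf _ _ _ P lam lam0 alpha malpha a01 X0 xi eps mX0 mxi meps
  (inputs_cond_free lam0 a01 hinputs) z z1 n g (fun=> 1) mg
  (cbounded_on01 malpha a01 mg gK) (cmeasurable_cst _).
move=> <-; last by move=> w; rewrite sqnorm1.
by apply: eq_cmean => w; rewrite /history expr1n mulr1.
Qed.

Lemma cmeasurable_seq_prod d (T : measurableType d) (X : T -> nat -> nat)
    (z : nat -> C) (n : nat) : (forall k, measurable_fun setT (X ^~ k)) ->
  cmeasurable (fun w => \prod_(k < n) z k ^+ X w k).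
Proof.
move=> mX; apply: cmeasurable_prod => k.
apply: (cmeasurable_nat_index (F := fun m _ => z k ^+ m) (mX k)) => m.
exact: cmeasurable_cst.
Qed.

Lemma measurable_seq_coordinate (k : nat) :
  measurable_fun setT (fun x : seq_space nat => (x : nat -> nat) k).
Proof.
move=> _ B mB; rewrite setTI; apply: sub_sigma_algebra.
by exists k, B.
Qed.

Lemma measurable_to_seq_space d (T : measurableType d) (X : nat -> T -> nat) :
  (forall k, measurable_fun setT (X k)) ->
  measurable_fun setT (fun w => (fun k => X k w) : seq_space nat).
Proof.
move=> mX; apply: (@measurability _ _ T (seq_space nat) setT _ (coordinate_sets nat)) => //.
move=> _ [_ [k [B mB ->]] <-]; rewrite setTI.
by rewrite -[X in measurable X]setTI; exact: mX.
Qed.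

(** The law is transported to a copy. The parameter of the copy need only lie
    in ]0, 1[ almost surely, which is repaired by truncation. *)
Lemma inar1_law_copy (lam : R) d (T : measurableType d) (P : probability T R)
    (alpha : T -> R) (X : nat -> T -> nat)
    d1 (T1 : measurableType d1) (P1 : probability T1 R)
    (alpha1 : T1 -> R) (X1 : nat -> T1 -> nat) :
  0 < lam -> inar1_law lam P alpha X ->
  measurable_fun setT alpha1 -> (forall k, measurable_fun setT (X1 k)) ->
  same_law P1 (fun w => (alpha1 w, (fun k => X1 k w) : seq_space nat))
           P (fun w => (alpha w, (fun k => X k w) : seq_space nat)) ->
  inar1_law lam P1 (clamp01 \o alpha1) X1.
Proof.
move=> lam0 [malpha a01 mX pgf] malpha1 mX1 hcopy.
have mc1 : measurable_fun setT (clamp01 \o alpha1).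
  exact: measurableT_comp measurable_clamp01 malpha1.
have c01 w : 0 < (clamp01 \o alpha1) w < 1 by exact: clamp01_itv.
split=> // n z g K z1 mg gK.
have mphi := measurable_fun_pair malpha (measurable_to_seq_space mX).
have mphi1 := measurable_fun_pair malpha1 (measurable_to_seq_space mX1).
have mgc : cmeasurable (g \o clamp01) by exact (cmeasurable_comp_alpha measurable_clamp01 mg).
have mL : cmeasurable (fun a : R => cexp (log_pgf lam (clamp01 a) z n 1)).
  apply: (@cmeasurable_comp_alpha _ _ _ clamp01 measurable_clamp01
    (fun a : R => cexp (log_pgf lam a z n 1))).
  by apply: cmeasurable_cexp; apply: cmeasurable_log_pgf; exact: cmeasurable_cst.
have K0 : 0 <= K.
  by apply: le_trans (sqnorm_ge0 _) (gK 2^-1 _); lra.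
pose F (u : R * seq_space nat) : C :=
  g (clamp01 u.1) * \prod_(k < n) z k ^+ (u.2 : nat -> nat) k.
pose G (u : R * seq_space nat) : C :=
  g (clamp01 u.1) * cexp (log_pgf lam (clamp01 u.1) z n 1).
have mfst (h : R -> C) : cmeasurable h -> cmeasurable (fun u : R * seq_space nat => h u.1).
  by move=> [h1 h2]; split; [exact: measurableT_comp h1 measurable_fst |
    exact: measurableT_comp h2 measurable_fst].
have mF : cmeasurable F.
  apply: cmeasurableM; first exact: (mfst _ mgc).
  apply: (cmeasurable_seq_prod (X := fun u : R * seq_space nat => (u.2 : nat -> nat))) => k.
  exact: measurableT_comp (measurable_seq_coordinate k) measurable_snd.
have mG : cmeasurable G by apply: cmeasurableM; [exact: (mfst _ mgc) | exact: (mfst _ mL)].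
have FK u : sqnorm (F u) <= K.
  rewrite /F sqnormM -[leRHS]mulr1 ler_pM ?sqnorm_ge0//; first exact/gK/clamp01_itv.
  by apply: sqnorm_le1_prod => k; exact: sqnorm_le1X.
have GK u : sqnorm (G u) <= K.
  rewrite /G sqnormM -[leRHS]mulr1 ler_pM ?sqnorm_ge0//; first exact/gK/clamp01_itv.
  apply: sqnorm_cexp_le1; apply: Re_log_pgf_le0 => //; first exact: clamp01_itv.
  by rewrite sqnorm1.
have bnd (H : R * seq_space nat -> C) d' (T' : measurableType d') (phi : T' -> R * seq_space nat) :
    cmeasurable H -> (forall u, sqnorm (H u) <= K) -> measurable_fun setT phi ->
    cbounded (H \o phi).
  move=> [m1 m2] HK mp; apply/cboundedP; split; last by exists K => w; exact: HK.
  by split; [exact: measurableT_comp m1 mp | exact: measurableT_comp m2 mp].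
have := same_law_cmean mphi1 mphi hcopy mF (bnd _ _ _ _ mF FK mphi1) (bnd _ _ _ _ mF FK mphi).
have := same_law_cmean mphi1 mphi hcopy mG (bnd _ _ _ _ mG GK mphi1) (bnd _ _ _ _ mG GK mphi).
rewrite /F /G /= => -> ->.
under [X in cmean _ X = _]funext do rewrite clamp01_id//.
have := pgf n z g K z1 mg gK.
by congr (_ = _); apply: eq_cmean => w; rewrite clamp01_id.
Qed.

End Inar1Law.

(** * The conditional expectation of the process given the parameter *)

Lemma cvg_sum_seq (R : realType) (I : Type) (s : seq I) (F : nat -> I -> R) (l : I -> R) :
  (forall i, F n i @[n --> \oo] --> l i) ->
  \sum_(i <- s) F n i @[n --> \oo] --> \sum_(i <- s) l i.
Proof.
move=> Fl; elim: s => [|i s IH].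
  by under eq_fun do rewrite big_nil; rewrite big_nil; exact: cvg_cst.
by under eq_fun do rewrite big_cons; rewrite big_cons; exact: cvgD.
Qed.

Section ConditionalMean.
Context {R : realType}.
Local Notation C := R[i].

Lemma log_pgf_ones (lam a : R) (z : nat -> C) (n : nat) (w : C) : a < 1 ->
  (forall k, (k < n)%N -> z k = 1) ->
  log_pgf lam a z n w = (lam / (1 - a))%:C%C * (w - 1).
Proof.
move=> a1; elim: n w => [//|n IH] w z1 /=.
rewrite IH; last by move=> k kn; apply: z1; exact: ltnW.
rewrite z1// mul1r (_ : lam%:C%C = (lam / (1 - a))%:C%C * (1 - a%:C%C)).
  by ring.
rewrite (_ : 1 - a%:C%C = (1 - a)%:C%C); last by rewrite rmorphB.
by rewrite -real_complexM divfK// subr_eq0 eq_sym lt_eqF.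
Qed.

Context (lam : R) (lam0 : 0 < lam) {d} {T : measurableType d} (P : probability T R).
Context (alpha : T -> R) (X : nat -> T -> nat) (law : inar1_law lam P alpha X).
Local Notation mean f := (\int[P]_w f w).
Local Notation mu w := (lam / (1 - alpha w)).

Let malpha : measurable_fun setT alpha. Proof. by case: law. Qed.
Let a01 w : 0 < alpha w < 1. Proof. by case: law. Qed.
Let mX k : measurable_fun setT (X k). Proof. by case: law. Qed.

Let mpre (A : set R) : measurable A -> measurable (alpha @^-1` A).
Proof. by move=> mA; rewrite -[_ @^-1` _]setTI; exact: malpha. Qed.

Let mmu : measurable_fun setT (fun w => mu w).
Proof.
apply: measurable_funM => //; apply: (measurableT_comp measurable_inv).
exact: measurable_funB.
Qed.

Let mu_gt0 w : 0 < mu w.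
Proof. by have /andP[a0 a1] := a01 w; rewrite divr_gt0// subr_gt0. Qed.

(** The joint generating function with a single argument different from 1: by
    stationarity it is that of the Poisson law with parameter [mu]. *)
Lemma mean_inar1_geometric (k : nat) (A : set R) (r : R) : measurable A -> 0 <= r <= 1 ->
  mean (fun w => \1_(alpha @^-1` A) w * r ^+ X k w) =
  mean (fun w => \1_(alpha @^-1` A) w * expR (mu w * (r - 1))).
Proof.
move=> mA /andP[r0 r1].
pose z (j : nat) : C := if j == k then r%:C%C else 1.
have z1 j : sqnorm (z j) <= 1.
  rewrite /z; case: ifP => _; last by rewrite sqnorm1.
  by rewrite /sqnorm /= [0 ^+ 2]expr0n addr0 exprn_ile1.
have mg : cmeasurable (fun a : R => (\1_A a)%:C%C : C).
  by apply: cmeasurable_real; exact: measurable_indic.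
have [_ _ _ pgf] := law.
have := pgf k.+1 z (fun a => (\1_A a)%:C%C) 1 z1 mg.
have bg a : 0 < a < 1 -> sqnorm ((\1_A a)%:C%C : C) <= 1.
  by move=> _; rewrite /sqnorm /= indicE; case: (_ \in _); rewrite ?expr1n ?expr0n ?addr0.
move=> /(_ bg) e.
have {}e : \int[P]_w Re ((\1_A (alpha w))%:C%C * \prod_(j < k.+1) z j ^+ X j w) =
    \int[P]_w Re ((\1_A (alpha w))%:C%C * cexp (log_pgf lam (alpha w) z k.+1 1)).
  exact (congr1 (fun c : C => Re c) e).
transitivity (\int[P]_w Re ((\1_A (alpha w))%:C%C * \prod_(j < k.+1) z j ^+ X j w)).
  apply: eq_Rintegral => w _; rewrite big_ord_recr /= big1 ?mul1r; last first.
    by move=> j _; rewrite /z ltn_eqF// expr1n.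
  by rewrite /z eqxx -real_complexX -real_complexM.
rewrite e; apply: eq_Rintegral => w _.
have /andP[_ a1] := a01 w.
have -> : log_pgf lam (alpha w) z k.+1 1 = (mu w * (r - 1))%:C%C.
  rewrite /= subrr !mulr0 add0r addr0 mulr1 log_pgf_ones//; last first.
    by move=> j jk; rewrite /z ltn_eqF.
  rewrite /z eqxx (_ : r%:C%C - 1 = (r - 1)%:C%C); last by rewrite rmorphB.
  by rewrite -real_complexM.
by rewrite cexp_real -real_complexM.
Qed.

(** The mean of the process given the parameter: the difference quotients
    (1 - r^X)/(1 - r) of the generating function at r = 1 increase to X as r
    increases to 1. *)
Lemma integral_inar1 (k : nat) (A : set R) (e : R) : measurable A -> 0 < e ->
  A `<=` [set a | a <= 1 - e] ->
  (\int[P]_(w in alpha @^-1` A) (X k w)%:R%:E = (mean (fun w => \1_(alpha @^-1` A) w * mu w))%:E)%E.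
Proof.
move=> mA e0 Ae.
pose r (N : nat) : R := 1 - N.+1%:R^-1.
have r01 N : 0 <= r N <= 1.
  by rewrite /r subr_ge0 invf_le1 ?ltr0n// ler1n/= gerBl invr_ge0.
have rcvg : r N @[N --> \oo] --> (1 : R).
  rewrite -[X in _ --> X]subr0; apply: cvgB; first exact: cvg_cst.
  exact: cvg_harmonic.
have rmono m n : (m <= n)%N -> r m <= r n.
  by move=> mn; rewrite lerD2l lerN2 lef_pV2 ?posrE ?ltr0n// ler_nat ltnS.
pose f (N : nat) w : R := N.+1%:R * (1 - r N ^+ X k w).
(* As geometric sums the difference quotients are seen to increase with [N]. *)
have fE N w : f N w = \sum_(j < X k w) r N ^+ j.
  rewrite /f -[1 - _]opprB subrX1 -mulNr opprB mulrA.
  by rewrite {1}/r opprD opprK addrA subrr add0r divff ?mul1r// pnatr_eq0.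
have bf N : bounded_mfun (fun w => r N ^+ X k w).
  split.
    by apply: (measurable_fun_nat_index (F := fun m _ => r N ^+ m) (mX k)) => m; exact: measurable_cst.
  by exists 1 => w; have /andP[r0 r1] := r01 N; rewrite ger0_norm ?exprn_ge0// exprn_ile1.
have bfN N : bounded_mfun (f N).
  by apply: bounded_mfunM; [exact: bounded_mfun_cst | apply: bounded_mfunB => //; exact: bounded_mfun_cst].
have b1A : bounded_mfun (\1_(alpha @^-1` A) : T -> R).
  by apply: bounded_mfun_indic; exact: mpre.
pose g (N : nat) w : R := \1_(alpha @^-1` A) w * (N.+1%:R * (1 - expR (mu w * (r N - 1)))).
have bexp N : bounded_mfun (fun w => expR (mu w * (r N - 1))).
  split.
    by apply: measurableT_comp => //; exact: measurable_funM.
  exists 1 => w; rewrite ger0_norm ?expR_ge0// expR_le1.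
  have /andP[_ r1] := r01 N; apply: mulr_ge0_le0; first by rewrite ltW// mu_gt0.
  by rewrite subr_le0.
have fg N : (\int[P]_(w in alpha @^-1` A) (f N w)%:E = (mean (g N))%:E)%E.
  rewrite -mean_indicM//; last exact: mpre.
  congr (_%:E); rewrite /f /g.
  transitivity (N.+1%:R * (mean (\1_(alpha @^-1` A) : T -> R) -
      mean (fun w => \1_(alpha @^-1` A) w * r N ^+ X k w))).
    rewrite -meanB//; last exact: bounded_mfunM.
    rewrite -meanZ; last by apply: bounded_mfunB => //; exact: bounded_mfunM.
    by apply: eq_Rintegral => w _; ring.
  rewrite mean_inar1_geometric// -meanB//; last exact: bounded_mfunM.
  rewrite -meanZ; last by apply: bounded_mfunB => //; exact: bounded_mfunM.
  by apply: eq_Rintegral => w _; ring.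
have rE N : r N - 1 = - N.+1%:R^-1 by rewrite /r addrAC subrr add0r.
(* From exp(-h) <= 1/(1 + h) and 1 - h <= exp(-h), with h = x/(N + 1). *)
have qle (x : R) N : 0 <= x -> x / (1 + x / N.+1%:R) <= N.+1%:R * (1 - expR (x * (r N - 1))) <= x.
  move=> x0; have N0 : 0 < N.+1%:R :> R by rewrite ltr0n.
  have h0 : 0 <= x / N.+1%:R by rewrite divr_ge0// ltW.
  have i0 : 0 < 1 + x / N.+1%:R by rewrite ltr_wpDr.
  rewrite rE mulrN; apply/andP; split.
    rewrite -ler_pdivrMl//.
    have : expR (- (x / N.+1%:R)) <= (1 + x / N.+1%:R)^-1.
      by rewrite expRN lef_pV2 ?posrE ?expR_gt0// expR_ge1Dx.
    suff -> : N.+1%:R^-1 * (x / (1 + x / N.+1%:R)) = 1 - (1 + x / N.+1%:R)^-1 by lra.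
    set h := x / N.+1%:R; rewrite mulrCA mulrA -/h -{1}[h](addKr 1) mulrDl divff ?gt_eqF//.
    by rewrite mulN1r addrC.
  rewrite -ler_pdivlMl//.
  rewrite [_^-1 * x]mulrC lerBlDr addrC -lerBlDr.
  exact: expR_ge1Dx.
have Ncvg (x : R) : 0 <= x -> N.+1%:R * (1 - expR (x * (r N - 1))) @[N --> \oo] --> x.
  move=> x0; apply: (@squeeze_cvgr _ _ _ _ (fun N => x / (1 + x / N.+1%:R)) (fun=> x)).
  - by near=> N; exact: qle.
  - rewrite -[X in _ --> X]divr1; apply: cvgM; first exact: cvg_cst.
    apply: cvgV; first exact: oner_neq0.
    rewrite -[X in _ --> X]addr0; apply: cvgD; first exact: cvg_cst.
    by rewrite -[X in _ --> X](mulr0 x); apply: cvgMl_tmp; exact: cvg_harmonic.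
  - exact: cvg_cst.
have gle N w : `|g N w| <= lam / e.
  have /andP[q1 q2] := qle (mu w) N (ltW (mu_gt0 w)).
  have q0 : 0 <= mu w / (1 + mu w / N.+1%:R).
    have m0 := ltW (mu_gt0 w).
    by apply: divr_ge0 => //; apply: addr_ge0 => //; apply: divr_ge0.
  rewrite /g normrM (ger0_norm (le_trans q0 q1)) indicE.
  case: (boolP (w \in _)) => [/set_mem/Ae /= we|_]; last first.
    by rewrite normr0 mul0r; apply: divr_ge0; exact: ltW.
  rewrite normr1 mul1r (le_trans q2)// ler_pM2l// lef_pV2 ?posrE//; first by lra.
  by have /andP[_] := a01 w; rewrite subr_gt0.
have gcvg : mean (g N) @[N --> \oo] --> mean (fun w => \1_(alpha @^-1` A) w * mu w).
  apply: proj2; apply: (@cvg_mean _ _ _ P g (fun w => \1_(alpha @^-1` A) w * mu w) (lam / e)).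
  - move=> N; apply: (proj1 (_ : bounded_mfun (g N))).
    apply: bounded_mfunM => //; apply: bounded_mfunM; first exact: bounded_mfun_cst.
    by apply: bounded_mfunB => //; exact: bounded_mfun_cst.
  - exact: gle.
  - by move=> w; apply: cvgMl_tmp; apply: Ncvg; rewrite ltW// mu_gt0.
have fcvg : (\int[P]_(w in alpha @^-1` A) (f N w)%:E @[N --> \oo] -->
    \int[P]_(w in alpha @^-1` A) (X k w)%:R%:E)%E.
  have fX w : (f N w)%:E @[N --> \oo] --> (X k w)%:R%:E.
    apply: cvg_EFin; first exact: nearW.
    under eq_fun do rewrite /= fE.
    have -> : (X k w)%:R = \sum_(j < X k w) 1 ^+ j :> R.
      by rewrite (eq_bigr (fun=> 1)) => [|j _]; rewrite ?sumr_const ?card_ord// expr1n.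
    apply: (@cvg_sum_seq _ _ _ (fun N (j : 'I__) => r N ^+ j)) => j.
    exact: cvg_comp rcvg (@exprn_continuous R j 1).
  rewrite (eq_integral (fun w => limn (fun N => (f N w)%:E))); last first.
    by move=> w _; rewrite (cvg_lim _ (fX w)).
  apply: cvg_monotone_convergence.
  - exact: mpre.
  - by move=> N; apply/measurable_EFinP; apply: measurable_funTS; exact: (bfN N).1.
  - move=> N w _; rewrite lee_fin fE sumr_ge0// => j _.
    by have /andP[r0 _] := r01 N; rewrite exprn_ge0.
  - move=> w _ m n mn; rewrite lee_fin !fE ler_sum// => j _.
    have /andP[r0 _] := r01 m; have /andP[r0' _] := r01 n.
    by rewrite lerXn2r ?nnegrE// rmono.
have fcvg' : (\int[P]_(w in alpha @^-1` A) (f N w)%:E @[N --> \oo] -->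
    (mean (fun w => \1_(alpha @^-1` A) w * mu w))%:E)%E.
  rewrite (_ : (fun N => _) = (fun N => (mean (g N))%:E)); last exact/funext.
  by apply: cvg_EFin; [exact: nearW | exact: gcvg].
exact: (cvg_unique _ fcvg fcvg').
Unshelve. all: by end_near. Qed.

End ConditionalMean.

(** Two versions of a generalized conditional expectation of a nonnegative
    variable agree almost surely where one of them is bounded. If they differed
    on a set of positive probability, then they would be separated by two
    rationals on an event of the conditioning sigma-algebra. *)
Section CondExpUnique.
Context {R : realType} {d} {T : measurableType d} (P : probability T R).
Context (alpha : T -> R) (malpha : measurable_fun setT alpha).
Context (h : R -> R) (mh : measurable_fun setT h) (h0 : forall a, 0 < a < 1 -> 0 < h a).
Context (X Y : T -> \bar R).
Context (XY : is_cond_exp P (g_sigma_algebra_preimage alpha) X Y).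
Context (Xh : forall (A : set R) (e : R), measurable A -> 0 < e ->
  A `<=` [set a | 0 < a <= 1 - e] ->
  (\int[P]_(w in alpha @^-1` A) X w = \int[P]_(w in alpha @^-1` A) (h (alpha w))%:E)%E).
Context (alpha01 : {ae P, forall w, 0 < alpha w < 1}).

Let mpre (A : set R) : measurable A -> measurable (alpha @^-1` A).
Proof. by move=> mA; rewrite -[_ @^-1` _]setTI; exact: malpha. Qed.

Let mhpre (A : set R) : measurable A -> measurable (h @^-1` A).
Proof. by move=> mA; rewrite -[_ @^-1` _]setTI; exact: mh. Qed.

Let YG (B : set (\bar R)) : measurable B ->
  exists2 A : set R, measurable A & Y @^-1` B = alpha @^-1` A.
Proof.
move=> mB; have [_ _ YG _] := XY.
by have [A mA] := YG B mB; rewrite setTI => <-; exists A.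
Qed.

Lemma cond_exp_measurable : measurable_fun setT Y.
Proof. by move=> _ B mB; rewrite setTI; have [A mA ->] := YG mB; exact: mpre. Qed.

Let away (m : nat) : set R := [set a | 0 < a <= 1 - m.+1%:R^-1].

Let maway m : measurable (away m).
Proof.
have -> : away m = `]0, 1 - m.+1%:R^-1]%classic.
  by apply/seteqP; split => a; rewrite /= in_itv.
exact: measurable_itv.
Qed.

Let int_away (A : set R) m : measurable A -> A `<=` away m ->
  (\int[P]_(w in alpha @^-1` A) Y w = \int[P]_(w in alpha @^-1` A) (h (alpha w))%:E)%E.
Proof.
move=> mA Am; have [_ _ _ YX] := XY.
rewrite YX; last by exists A => //; rewrite setTI.
by apply: (@Xh _ m.+1%:R^-1) => //; rewrite invr_gt0 ltr0n.
Qed.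

Let gap_null (A : set R) (p q : R) : measurable A -> 0 <= p -> p < q ->
  (q%:E * P (alpha @^-1` A) <= p%:E * P (alpha @^-1` A))%E -> P (alpha @^-1` A) = 0%E.
Proof.
move=> mA p0 pq; have fP := fin_num_measure P _ (mpre mA).
rewrite -(fineK fP) -!EFinM lee_fin => qp; congr (_%:E).
apply/eqP; rewrite eq_le fine_ge0// andbT.
have : (q - p) * fine (P (alpha @^-1` A)) <= 0 by rewrite mulrBl subr_le0.
by rewrite pmulr_rle0// subr_gt0.
Qed.

Let above (m : nat) (p q : R) : set T :=
  alpha @^-1` (away m `&` h @^-1` [set x | x <= p]) `&` Y @^-1` [set y | (q%:E <= y)%E].

Let below (m : nat) (p q : R) : set T :=
  alpha @^-1` (away m `&` h @^-1` [set x | q <= x]) `&` Y @^-1` [set y | (y <= p%:E)%E].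

Let above_null m p q : 0 <= p -> p < q -> P (above m p q) = 0%E.
Proof.
move=> p0 pq.
have mq : measurable [set y : \bar R | (q%:E <= y)%E].
  have -> : [set y : \bar R | (q%:E <= y)%E] = `[q%:E, +oo[%classic.
    by apply/seteqP; split => y; rewrite /= in_itv /= andbT.
  exact: emeasurable_itv.
have mp : measurable [set x : R | x <= p].
  have -> : [set x : R | x <= p] = `]-oo, p]%classic.
    by apply/seteqP; split => y; rewrite /= in_itv.
  exact: measurable_itv.
have [A mA YA] := YG mq.
pose E := away m `&` h @^-1` [set x | x <= p] `&` A.
have mE : measurable E by apply: measurableI => //; apply: measurableI => //; exact: mhpre.
have aE : above m p q = alpha @^-1` E by rewrite /above YA preimage_setI.
rewrite aE; apply: (gap_null mE p0 pq).
have mE' := mpre mE.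
have Yq w : (alpha @^-1` E) w -> (q%:E <= Y w)%E.
  by rewrite -aE => -[].
have hp w : (alpha @^-1` E) w -> 0 <= h (alpha w) <= p.
  move=> [[/= /andP[w0 w1] hw] _]; rewrite hw andbT ltW// h0// w0 /=.
  by rewrite (le_lt_trans w1)// gtrBl invr_gt0.
rewrite -!integral_cst// -[X in (_ <= X)%E]/(\int[P]_(w in alpha @^-1` E) (cst p%:E) w)%E.
apply: (@le_trans _ _ (\int[P]_(w in alpha @^-1` E) Y w)%E).
  apply: ge0_le_integral => //.
  - by move=> w _; rewrite lee_fin (le_trans p0)// ltW.
  - by apply: measurable_funTS; exact: cond_exp_measurable.
rewrite (@int_away _ m)//; last by move=> a [[]].
apply: ge0_le_integral => //.
- by move=> w /hp/andP[]; rewrite lee_fin.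
- by apply/measurable_EFinP; apply: measurable_funTS; exact: measurableT_comp.
- by move=> w /hp/andP[_]; rewrite lee_fin.
Qed.

Let below_null m p q : 0 <= p -> p < q -> P (below m p q) = 0%E.
Proof.
move=> p0 pq.
have mp : measurable [set y : \bar R | (y <= p%:E)%E].
  have -> : [set y : \bar R | (y <= p%:E)%E] = `]-oo, p%:E]%classic.
    by apply/seteqP; split => y; rewrite /= in_itv.
  exact: emeasurable_itv.
have mq : measurable [set x : R | q <= x].
  have -> : [set x : R | q <= x] = `[q, +oo[%classic.
    by apply/seteqP; split => y; rewrite /= in_itv /= andbT.
  exact: measurable_itv.
have [A mA YA] := YG mp.
pose E := away m `&` h @^-1` [set x | q <= x] `&` A.
have mE : measurable E by apply: measurableI => //; apply: measurableI => //; exact: mhpre.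
have aE : below m p q = alpha @^-1` E by rewrite /below YA preimage_setI.
rewrite aE; apply: (gap_null mE p0 pq).
have mE' := mpre mE.
have Yp w : (alpha @^-1` E) w -> (Y w <= p%:E)%E.
  by rewrite -aE => -[].
have hq w : (alpha @^-1` E) w -> q <= h (alpha w) by move=> [[]].
rewrite -!integral_cst//.
apply: (@le_trans _ _ (\int[P]_(w in alpha @^-1` E) (h (alpha w))%:E)%E).
  apply: ge0_le_integral => //.
  - by move=> w _; rewrite lee_fin (le_trans p0)// ltW.
  - by apply/measurable_EFinP; apply: measurable_funTS; exact: measurableT_comp.
rewrite -(@int_away _ m)//; last by move=> a [[]].
apply: (@le_trans _ _ (\int[P]_(w in alpha @^-1` E) Y^\+ w)%E).
  by rewrite [leLHS]integralE geeDl ?oppe_le0 ?integral_ge0.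
apply: ge0_le_integral => //.
- by apply: measurable_funTS; apply: measurable_funepos; exact: cond_exp_measurable.
- by move=> w /Yp Ypw; rewrite funeposE ge_max Ypw lee_fin.
Qed.

Lemma cond_exp_unique : {ae P, forall w, Y w = (h (alpha w))%:E}.
Proof.
(* Countably many null events, one for each pair of rationals that may separate
   the two versions. *)
pose bad (t : nat * rat * rat) : set T :=
  if (0 <= ratr t.1.2 :> R) && (ratr t.1.2 < ratr t.2 :> R) then
  above t.1.1 (ratr t.1.2) (ratr t.2) `|` below t.1.1 (ratr t.1.2) (ratr t.2) else set0.
have mY := cond_exp_measurable.
have ma m p q : measurable (above m p q).
  apply: measurableI.
    apply: mpre; apply: measurableI => //; apply: mhpre.
    have -> : [set x : R | x <= p] = `]-oo, p]%classic.
      by apply/seteqP; split => y; rewrite /= in_itv.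
    exact: measurable_itv.
  rewrite -[X in measurable X]setTI; apply: mY => //.
  have -> : [set y : \bar R | (q%:E <= y)%E] = `[q%:E, +oo[%classic.
    by apply/seteqP; split => y; rewrite /= in_itv /= andbT.
  exact: emeasurable_itv.
have mb m p q : measurable (below m p q).
  apply: measurableI.
    apply: mpre; apply: measurableI => //; apply: mhpre.
    have -> : [set x : R | q <= x] = `[q, +oo[%classic.
      by apply/seteqP; split => y; rewrite /= in_itv /= andbT.
    exact: measurable_itv.
  rewrite -[X in measurable X]setTI; apply: mY => //.
  have -> : [set y : \bar R | (y <= p%:E)%E] = `]-oo, p%:E]%classic.
    by apply/seteqP; split => y; rewrite /= in_itv.
  exact: emeasurable_itv.
have bad_null t : P.-negligible (bad t).
  rewrite /bad; case: ifPn => [/andP[p0 pq]|_]; last exact: negligible_set0.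
  apply: negligibleU.
    by apply: (negligibleP _ (ma _ _ _)).2; exact: above_null.
  by apply: (negligibleP _ (mb _ _ _)).2; exact: below_null.
have good : {ae P, forall w, forall k : nat,
    if (unpickle k : option (nat * rat * rat)) is Some t then ~ bad t w else True}.
  apply: ae_foralln => k; case: (unpickle k) => [t|]; last by apply: aeW.
  apply: negligibleS (bad_null t) => w /=; exact: contrapT.
apply: filterS2 good alpha01 => w good /andP[w0 w1].
have {}good m p q : 0 <= ratr p :> R -> ratr p < ratr q :> R ->
    ~ above m (ratr p) (ratr q) w /\ ~ below m (ratr p) (ratr q) w.
  move=> p0 pq; have := good (pickle (m, p, q)); rewrite pickleK /bad /= p0 pq /=.
  by move=> ab; split=> ?; apply: ab; [left | right].
have hw0 : 0 < h (alpha w) by apply: h0; rewrite w0.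
have [m wm] : exists m : nat, alpha w <= 1 - m.+1%:R^-1.
  exists (Num.truncn (1 - alpha w)^-1); rewrite lerBrDr -lerBrDl.
  rewrite -[leRHS]invrK lef_pV2 ?posrE ?invr_gt0 ?subr_gt0//.
  by rewrite ltW// truncnS_gt.
have aw : away m (alpha w) by rewrite /away /= w0.
apply/eqP; rewrite eq_le; apply/andP; split; rewrite leNgt; apply/negP => hY.
- have [y hy yY] : exists2 y : R, h (alpha w) < y & (y%:E <= Y w)%E.
    move: hY; case: (Y w) => [r||//]; first by rewrite lte_fin => hr; exists r.
    by move=> _; exists (h (alpha w) + 1); rewrite ?ltrDl ?leey.
  have [p] := rat_in_itvoo hy; rewrite in_itv /= => /andP[hp py].
  have [q] := rat_in_itvoo py; rewrite in_itv /= => /andP[pq qy].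
  have [+ _] := good m p q (ltW (lt_trans hw0 hp)) pq; apply.
  split; first by split => //=; exact: ltW.
  by apply: le_trans yY; rewrite lee_fin ltW.
- have [y] : exists2 y : R, 0 <= y < h (alpha w) & (Y w <= y%:E)%E.
    move: hY; case: (Y w) => [r|//|]; last by exists 0; rewrite ?lexx ?leNye.
    rewrite lte_fin => rh; exists (Num.max r 0).
      by rewrite le_max lexx orbT gt_max rh hw0.
    by rewrite lee_fin le_max lexx.
  move=> /andP[y0 yh] Yy; have [p] := rat_in_itvoo yh; rewrite in_itv /= => /andP[yp ph].
  have [q] := rat_in_itvoo ph; rewrite in_itv /= => /andP[pq qh].
  have [_ +] := good m p q (le_trans y0 (ltW yp)) pq; apply.
  split; first by split => //=; exact: ltW.
  by apply: le_trans Yy _; rewrite lee_fin ltW.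
Qed.

End CondExpUnique.

(** * The characteristic function of a Gaussian law *)

Section GaussianCharacteristic.
Context {R : realType} (s : R) (s0 : 0 < s).
Local Notation mu := (@lebesgue_measure R).
Local Notation p := (normal_pdf 0 s).

Let snz : s != 0. Proof. exact: lt0r_neq0. Qed.

Let pE x : p x = normal_peak s * expR (- x ^+ 2 / (s ^+ 2 *+ 2)).
Proof. by rewrite normal_pdfE// /normal_fun subr0. Qed.

Let p0 x : 0 <= p x. Proof. exact: normal_pdf_ge0. Qed.

Let mp : measurable_fun setT p. Proof. exact: measurable_normal_pdf. Qed.

Let derive_gaussian (k c x : R) : is_derive x (1 : R) (fun y : R => k * expR (- y ^+ 2 * c))
  (- (2 * x * c) * (k * expR (- x ^+ 2 * c))).
Proof.
have h : is_derive x (1 : R) (fun y : R => - y ^+ 2 * c) (- (2 * x * c)).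
  by apply: is_derive_eq; rewrite /GRing.scale /=; ring.
have h2 : is_derive x (1 : R) (fun y : R => expR (- y ^+ 2 * c))
    (expR (- x ^+ 2 * c) * (- (2 * x * c))).
  exact: (@is_derive1_comp R expR (fun y : R => - y ^+ 2 * c) x _ _ (is_derive_expR _) h).
by apply: is_derive_eq; rewrite /GRing.scale /=; ring.
Qed.

Let derive_p (x : R) : is_derive x (1 : R) p (- (x / s ^+ 2) * p x).
Proof.
have := derive_gaussian (normal_peak s) (s ^+ 2 *+ 2)^-1 x.
rewrite -(pE x) (_ : (fun y => _) = p); last by apply/funext => y; rewrite pE.
by congr is_derive; congr (_ * _); rewrite -mulr_natl; field.
Qed.

Let square_lt_exp (x : R) : `|x| * expR (- x ^+ 2 / (4 * s ^+ 2)) <= 1 + 4 * s ^+ 2.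
Proof.
have s2 : 0 < 4 * s ^+ 2 by rewrite mulr_gt0 ?exprn_gt0.
set y := x ^+ 2 / (4 * s ^+ 2).
have y0 : 0 <= y by rewrite divr_ge0 ?sqr_ge0// ltW.
rewrite mulNr -/y expRN ler_pdivrMr ?expR_gt0//.
have xE : x ^+ 2 = y * (4 * s ^+ 2) by rewrite /y divfK// gt_eqF.
have h1 : `|x| <= 1 + x ^+ 2.
  have := sqr_ge0 (`|x| - 1); rewrite sqrrB1 real_normK ?num_real//.
  by have := normr_ge0 x; lra.
have h2 : 1 + y <= expR y := expR_ge1Dx y.
have h3 : y * (4 * s ^+ 2) <= expR y * (4 * s ^+ 2) by rewrite ler_pM2r//; lra.
apply: le_trans h1 _; rewrite xE.
by move: h2 h3 y0; set E := expR y; set c := 4 * s ^+ 2; lra.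
Qed.

(** Half of the Gaussian exponent absorbs the linear factor, and the other half
    is the exponent of the law of deviation [s * sqrt 2]. *)
Lemma integrable_xnormal : mu.-integrable setT (EFin \o (fun x => `|x| * p x)).
Proof.
pose s' := s * Num.sqrt 2.
have s'0 : s' != 0 by rewrite mulf_neq0// gt_eqF// sqrtr_gt0.
pose K := normal_peak s * (1 + 4 * s ^+ 2) / normal_peak s'.
have pk' : 0 < normal_peak s' by exact: normal_peak_gt0.
have K0 : 0 <= K.
  apply: mulr_ge0; last by rewrite invr_ge0 ltW.
  apply: mulr_ge0; first exact: normal_peak_ge0.
  by rewrite addr_ge0// mulr_ge0// sqr_ge0.
have mf : measurable_fun setT (fun x : R => `|x| * p x).
  by apply: measurable_funM => //; exact: measurableT_comp.
apply: (@le_integrable _ _ _ mu setT measurableT (EFin \o (fun x => `|x| * p x))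
  (fun x => (K%:E * (normal_pdf 0 s' x)%:E)%E)).
- exact/measurable_EFinP.
- move=> x _; rewrite /= lee_fin normrM normr_id (ger0_norm (p0 x)).
  rewrite normrM (ger0_norm K0) (ger0_norm (normal_pdf_ge0 _ _ _)).
  rewrite pE normal_pdfE// /normal_fun subr0 /K.
  rewrite (_ : normal_peak s * _ / _ * _ = normal_peak s * ((1 + 4 * s ^+ 2) *
     expR (- x ^+ 2 / (s' ^+ 2 *+ 2)))); last first.
    by rewrite [LHS]mulrA divfK ?gt_eqF// -mulrA.
  rewrite mulrCA ler_wpM2l ?normal_peak_ge0//.
  have -> : s' ^+ 2 *+ 2 = 4 * s ^+ 2.
    by rewrite /s' exprMn sqr_sqrtr// -mulr_natl; ring.
  have -> : - x ^+ 2 / (s ^+ 2 *+ 2) =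
      - x ^+ 2 / (4 * s ^+ 2) + - x ^+ 2 / (4 * s ^+ 2).
    by rewrite -mulr_natl; field.
  by rewrite expRD mulrA ler_wpM2r ?expR_ge0// square_lt_exp.
- by apply: integrableZl => //; exact: integrable_normal_pdf.
Qed.


Let integrable_p : mu.-integrable setT (EFin \o p).
Proof. exact: integrable_normal_pdf. Qed.

Let integrable_dom (f : R -> R) (a b : R) : measurable_fun setT f ->
  (forall x, `|f x| <= a * p x + b * (`|x| * p x)) -> mu.-integrable setT (EFin \o f).
Proof.
move=> mf fab.
apply: (@le_integrable _ _ _ mu setT measurableT (EFin \o f)
  (fun x => a%:E * (p x)%:E + b%:E * (`|x| * p x)%:E)%E).
- exact/measurable_EFinP.
- by move=> x _; rewrite /= lee_fin (le_trans (fab x))// ler_norm.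
- by apply: integrableD => //; apply: integrableZl => //; exact: integrable_xnormal.
Qed.

(* The phase treats cosines and sines at once. *)
Context (phi : R).
Let trig (f : R -> R) (u x : R) := f (u * x + phi).

Let continuous_trig f u : continuous f -> continuous (trig f u).
Proof.
move=> cf x; apply: (@continuous_comp _ _ _ (fun x => u * x + phi) f).
  by apply: cvgD; [apply: cvgMl_tmp; exact: cvg_id | exact: cvg_cst].
exact: cf.
Qed.

Let mtrig f u : continuous f -> measurable_fun setT (trig f u).
Proof. by move=> cf; apply: continuous_measurable_fun; exact: continuous_trig. Qed.

Let G u x := trig sin u x * p x.
Let dG u x := u * trig cos u x * p x - trig sin u x * (x / s ^+ 2) * p x.

Let derive_G (u x : R) : is_derive x (1 : R) (G u) (dG u x).
Proof.
have h1 : is_derive x (1 : R) (fun x : R => u * x + phi) u.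
  by apply: is_derive_eq; rewrite /GRing.scale /=; ring.
have h2 : is_derive x (1 : R) (trig sin u) (cos (u * x + phi) * u).
  exact: (@is_derive1_comp R sin (fun x : R => u * x + phi) x _ _ (is_derive_sin _) h1).
have h3 := derive_p x.
have := @is_deriveM R R^o (trig sin u) p x 1 _ _ h2 h3.
by congr is_derive; rewrite /dG /trig /GRing.scale /=; ring.
Qed.

Let continuous_p : continuous p.
Proof. exact: continuous_normal_pdf. Qed.

Let continuous_dG u : continuous (dG u).
Proof.
move=> x; apply: cvgB; apply: cvgM; try exact: continuous_p.
  by apply: cvgMl_tmp; exact: (continuous_trig (@continuous_cos R)).
apply: cvgM; first exact: (continuous_trig (@continuous_sin R)).
by apply: cvgMr_tmp; exact: cvg_id.
Qed.

Let dG_bound u x : `|dG u x| <= `|u| * p x + (s ^+ 2)^-1 * (`|x| * p x).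
Proof.
have s2 : 0 <= (s ^+ 2)^-1 by rewrite invr_ge0 sqr_ge0.
rewrite /dG (le_trans (ler_normB _ _))// lerD//.
  rewrite !normrM (ger0_norm (p0 x)) ler_wpM2r// ler_piMr// /trig cos_max//.
rewrite !normrM (ger0_norm (p0 x)) (ger0_norm s2).
rewrite (_ : _^-1 * _ = `|x| * (s ^+ 2)^-1 * p x); last by rewrite mulrA [_^-1 * _]mulrC.
by rewrite ler_wpM2r// ler_piMl ?mulr_ge0// /trig sin_max.
Qed.

Let p_cvg0 : p n.+1%:R @[n --> \oo] --> 0.
Proof.
apply: (@squeeze_cvgr _ _ _ _ (fun=> 0)
   (fun n => normal_peak s * (1 + 4 * s ^+ 2) * n.+1%:R^-1)).
- near=> n; rewrite p0 /= pE -mulrA ler_wpM2l ?normal_peak_ge0//.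
  rewrite ler_pdivlMr ?ltr0n// mulrC.
  apply: le_trans (square_lt_exp n.+1%:R); rewrite ger0_norm// ler_wpM2l//.
  have s2 : 0 < s ^+ 2 by rewrite exprn_gt0.
  rewrite ler_expR !mulNr lerN2 ler_wpM2l ?sqr_ge0// lef_pV2 ?posrE ?mulr_gt0//.
    by rewrite -mulr_natl ler_wpM2r// ?ltW//; lra.
  by rewrite -mulr_natl mulr_gt0.
- exact: cvg_cst.
- rewrite -[X in _ --> X](mulr0 (normal_peak s * (1 + 4 * s ^+ 2))).
  by apply: cvgMl_tmp; exact: cvg_harmonic.
Unshelve. all: by end_near. Qed.

(** Integration by parts against the Gaussian density: the integral over a
    symmetric interval is the difference of the boundary values of [G], which
    vanishes in the limit. *)
Lemma stein_trig u : \int[mu]_x dG u x = 0.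
Proof.
pose I (n : nat) : set R := `[- n.+1%:R, n.+1%:R]%classic.
have mI n : measurable (I n) by exact: measurable_itv.
have mdG : measurable_fun setT (dG u) by apply: continuous_measurable_fun; exact: continuous_dG.
have mdGI n : measurable_fun setT (dG u \_ (I n)).
  by apply/(measurable_restrictT _ _).1 => //; exact: measurable_funTS.
have ldom : (\int[mu]_x ((dG u \_ (I n)) x)%:E @[n --> \oo] --> \int[mu]_x (dG u x)%:E)%E.
  pose H (x : R) := `|u| * p x + (s ^+ 2)^-1 * (`|x| * p x).
  have m1 n : measurable_fun setT (EFin \o (dG u \_ (I n))) by exact/measurable_EFinP.
  have c1 : {ae mu, forall x, setT x ->
      (EFin \o (dG u \_ (I n))) x @[n --> \oo] --> (EFin \o dG u) x}.
    apply: aeW => x _; apply: cvg_EFin; first exact: nearW.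
    apply: cvg_near_cst; exists (Num.truncn `|x|) => // n /= xn.
    rewrite patchE ifT//; apply/mem_set; rewrite /I /= in_itv /= -ler_norml.
    by apply: le_trans (ltW (truncnS_gt _)) _; rewrite ler_nat ltnS.
  have i1 : mu.-integrable setT
      (EFin \o H).
    apply: (@integrable_dom _ `|u| (s ^+ 2)^-1).
      apply: measurable_funD; apply: measurable_funM => //.
      by apply: measurable_funM => //; exact: measurableT_comp.
    by move=> x; rewrite ger0_norm// /H addr_ge0 ?mulr_ge0 ?invr_ge0 ?sqr_ge0.
  have b1 : {ae mu, forall x n, setT x -> (`|(EFin \o (dG u \_ (I n))) x| <=
      (EFin \o H) x)%E}.
    apply: aeW => x n _; rewrite /= lee_fin patchE; case: ifP => _; first exact: dG_bound.
    by rewrite normr0 addr_ge0 ?mulr_ge0 ?invr_ge0 ?sqr_ge0.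
  have [_ _ h] := @dominated_convergence _ _ _ mu setT measurableT
    (fun n => EFin \o (dG u \_ (I n))) (EFin \o dG u) (EFin \o H) m1
    ((measurable_EFinP _ _).2 mdG) c1 i1 b1.
  exact: h.
have IE n : (\int[mu]_x ((dG u \_ (I n)) x)%:E)%E = (G u n.+1%:R - G u (- n.+1%:R))%:E.
  transitivity (\int[mu]_(x in I n) (dG u x)%:E)%E.
    rewrite [RHS]integral_mkcond; apply: eq_integral => x _.
    by rewrite restrict_EFin.
  rewrite EFinB; apply: continuous_FTC2.
  - by rewrite (@lt_trans _ _ 0)// oppr_lt0 ltr0n.
  - by apply: continuous_subspaceT; exact: continuous_dG.
  - have cG : continuous (G u).
      by move=> x; apply: cvgM; [exact: (continuous_trig (@continuous_sin R)) | exact: continuous_p].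
    split.
    + by move=> x _; have [] := derive_G u x.
    + by apply: cvg_at_right_filter; exact: cG.
    + by apply: cvg_at_left_filter; exact: cG.
  - by move=> x _; rewrite derive1E; have [_ ->] := derive_G u x.
have l0 : (\int[mu]_x ((dG u \_ (I n)) x)%:E @[n --> \oo] --> 0%:E)%E.
  rewrite (_ : (fun n => _) = (fun n => (G u n.+1%:R - G u (- n.+1%:R))%:E)); last exact/funext.
  apply: cvg_EFin; first exact: nearW.
  apply/norm_cvg0P; apply: (@squeeze_cvgr _ _ _ _ (fun=> 0) (fun n => p n.+1%:R + p n.+1%:R)).
  - near=> n; rewrite normr_ge0 /= (le_trans (ler_normB _ _))// lerD//.
      by rewrite /G normrM (ger0_norm (p0 _)) ler_piMl// /trig sin_max.
    rewrite /G normrM (ger0_norm (p0 _)) [leRHS](_ : _ = p (- n.+1%:R)).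
      by rewrite ler_piMl// /trig sin_max.
    by rewrite !pE sqrrN.
  - exact: cvg_cst.
  - by rewrite -[X in _ --> X]addr0; apply: cvgD; exact: p_cvg0.
by rewrite /Rintegral (cvg_unique _ ldom l0).
Unshelve. all: by end_near. Qed.


Let F u := \int[mu]_x (trig cos u x * p x).
Let f (u x : R) : R := trig cos u x * p x.

Let mf u : measurable_fun setT (f u).
Proof. by apply: measurable_funM => //; exact: (mtrig u (@continuous_cos R)). Qed.

Let f_int u : mu.-integrable setT (EFin \o f u).
Proof.
apply: (@integrable_dom _ 1 0); first exact: mf.
move=> x; rewrite mul1r mul0r addr0 /f normrM (ger0_norm (p0 x)).
by rewrite ler_piMl// /trig cos_max.
Qed.

Let partial_f u x : partial1of2 f u x = - (trig sin u x * x * p x).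
Proof.
rewrite partial1of2E.
have h1 : is_derive u (1 : R) (fun u : R => u * x + phi) x.
  by apply: is_derive_eq; rewrite /GRing.scale /=; ring.
have h2 : is_derive u (1 : R) (fun u : R => trig cos u x) (- sin (u * x + phi) * x).
  exact: (@is_derive1_comp R cos (fun u : R => u * x + phi) u _ _ (is_derive_cos _) h1).
have h3 : is_derive u (1 : R) (fun u : R => trig cos u x * p x)
    (- sin (u * x + phi) * x * p x).
  by apply: is_derive_eq; rewrite /GRing.scale /=; ring.
by have [_ ->] := h3; rewrite /trig !mulNr.
Qed.

Let derivable_f u x : derivable (f ^~ x) u 1.
Proof.
have h1 : is_derive u (1 : R) (fun u : R => u * x + phi) x.
  by apply: is_derive_eq; rewrite /GRing.scale /=; ring.
have h2 : is_derive u (1 : R) (fun u : R => trig cos u x) (- sin (u * x + phi) * x).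
  exact: (@is_derive1_comp R cos (fun u : R => u * x + phi) u _ _ (is_derive_cos _) h1).
have h3 : is_derive u (1 : R) (fun u : R => trig cos u x * p x)
    (- sin (u * x + phi) * x * p x).
  by apply: is_derive_eq; rewrite /GRing.scale /=; ring.
by have [] := h3.
Qed.

Let steinF u : \int[mu]_x (- (trig sin u x * x * p x)) = - (s ^+ 2 * u * F u).
Proof.
have s2 : s ^+ 2 != 0 by rewrite expf_neq0.
rewrite (_ : - (s ^+ 2 * u * F u) = s ^+ 2 * (\int[mu]_x dG u x) - s ^+ 2 * u * F u); last first.
  by rewrite stein_trig mulr0 sub0r.
have i1 : mu.-integrable setT (EFin \o dG u).
  apply: (@integrable_dom _ `|u| (s ^+ 2)^-1); last exact: dG_bound.
  by apply: continuous_measurable_fun; exact: continuous_dG.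
have E1 : s ^+ 2 * (\int[mu]_x dG u x) = \int[mu]_x (s ^+ 2 * dG u x).
  by rewrite RintegralZl.
have E2 : s ^+ 2 * u * F u = \int[mu]_x (s ^+ 2 * u * (trig cos u x * p x)).
  by rewrite RintegralZl//; exact: f_int.
rewrite E1 E2 -RintegralB//.
- apply: eq_Rintegral => x _; rewrite /dG.
  rewrite mulrBr [s ^+ 2 * (_ * _ * _)](_ : _ = s ^+ 2 * u * (trig cos u x * p x)); last first.
    by rewrite !mulrA.
  rewrite addrAC subrr add0r; congr (- _).
  by move: (trig sin u x) (p x) => a b; field.
- by rewrite (_ : EFin \o _ = (fun x => (s ^+ 2)%:E * (dG u x)%:E)%E)//; exact: integrableZl.
- rewrite (_ : EFin \o _ = (fun x => (s ^+ 2 * u)%:E * (f u x)%:E)%E)//.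
  by apply: integrableZl => //; exact: f_int.
Qed.

Let derive_F u : is_derive u (1 : R) F (- (s ^+ 2 * u * F u)).
Proof.
have Iu : (`]u - 1, u + 1[%classic : set R) u.
  by rewrite /= in_itv /= ltrDl ltr01 andbT gtrBl.
have G0 (x : R) : 0 <= `|x| * p x by rewrite mulr_ge0.
have Gub x y : (`]u - 1, u + 1[%classic : set R) x -> (setT : set R) y ->
    `|partial1of2 f x y| <= `|y| * p y.
  move=> _ _; rewrite partial_f normrN !normrM (ger0_norm (p0 y)) -mulrA ler_piMl//.
  by rewrite /trig sin_max.
have h1 := @derivable_under_integral R _ _ mu f setT measurableT u (u - 1) (u + 1)
  Iu (fun x _ => f_int x) (fun x y _ _ => @derivable_f x y) _ G0 integrable_xnormal Gub.
have h2 := @differentiation_under_integral R _ _ mu f setT measurableT u (u - 1) (u + 1)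
  Iu (fun x _ => f_int x) (fun x y _ _ => @derivable_f x y) _ G0 integrable_xnormal Gub.
apply: DeriveDef; first exact: h1.
rewrite -derive1E h2 -steinF; apply: eq_Rintegral => x _.
exact: partial_f.
Qed.

(** As a function of [u] the integral has derivative [- s ^+ 2 * u] times itself:
    differentiation brings down a factor [x], which integration by parts
    removes. *)
Lemma normal_trig u :
  \int[mu]_x (cos (u * x + phi) * p x) = cos phi * expR (- (s ^+ 2 * u ^+ 2) / 2).
Proof.
pose E (u : R) : R := expR (s ^+ 2 * u ^+ 2 / 2).
have derE (v : R) : is_derive v (1 : R) E (E v * (s ^+ 2 * v)).
  have h : is_derive v (1 : R) (fun v : R => s ^+ 2 * v ^+ 2 / 2) (s ^+ 2 * v).
    by apply: is_derive_eq; rewrite /GRing.scale /=; field.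
  exact: (@is_derive1_comp R expR (fun v : R => s ^+ 2 * v ^+ 2 / 2) v _ _ (is_derive_expR _) h).
have der0 (v : R) : is_derive v (1 : R) (fun v => F v * E v) 0.
  have h1 := derive_F v; have h2 := derE v.
  have := @is_deriveM R R^o F E v 1 _ _ h1 h2.
  by congr is_derive; rewrite /GRing.scale /=; ring.
have FE : F u * E u = F 0 * E 0 := @is_derive_0_is_cst R (fun v : R => F v * E v) u 0 der0.
have E0 : E 0 = 1 by rewrite /E expr0n mulr0 mul0r expR0.
have F0 : F 0 = cos phi.
  rewrite /F; transitivity (\int[mu]_x (cos phi * p x)).
    by apply: eq_Rintegral => x _; rewrite /trig mul0r add0r.
  rewrite RintegralZl//.
  by rewrite /Rintegral integral_normal_pdf /= mulr1.
have Eu : E u != 0 by rewrite gt_eqF// expR_gt0.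
rewrite mulNr expRN -[expR _]/(E u) -[LHS]/(F u).
by apply: (mulIf Eu); rewrite divfK// FE E0 mulr1.
Qed.

End GaussianCharacteristic.

Section GaussianVariable.
Context {R : realType}.
Local Notation mu := (@lebesgue_measure R).

Lemma mean_normal_prob (s : R) (F : R -> R) : bounded_mfun F ->
  \int[normal_prob 0 s]_x F x = \int[mu]_x (F x * normal_pdf 0 s x).
Proof.
move=> bF; have dom := normal_prob_dominates 0 s.
congr fine.
have iF := bounded_mfun_integrable (normal_prob 0 s) bF.
rewrite -(Radon_Nikodym_change_of_variables dom measurableT iF).
apply: ae_eq_integral => //.
- apply: emeasurable_funM; first by apply/measurable_EFinP; exact: bF.1.
  by apply: (measurable_int mu); exact: Radon_Nikodym_integrable.
- by apply/measurable_EFinP; apply: measurable_funM; [exact: bF.1 | exact: measurable_normal_pdf].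
- under [X in ae_eq _ _ _ X]eq_fun do rewrite EFinM.
  apply: ae_eqe_mul2l => /=.
  rewrite Radon_NikodymE//=; case: cid => /= h [h1 h2 h3].
  apply: integral_ae_eq => //=.
  + by apply/measurable_EFinP; exact: measurable_normal_pdf.
  + by move=> E E01 mE; rewrite -h3.
Qed.

(** The real and imaginary parts are the integrals of [normal_trig] with phases
    0 and [- pi / 2]. *)
Lemma cmean_cis_normal d (T : measurableType d) (P : probability T R) (D : T -> R) (s u : R) :
  0 < s -> measurable_fun setT D ->
  (forall A, measurable A -> P (D @^-1` A) = normal_prob 0 s A) ->
  cmean P (fun w => cis (u * D w)) = (expR (- (s ^+ 2 * u ^+ 2) / 2))%:C%C.
Proof.
move=> s0 mD Dlaw.
have key phi : \int[P]_w cos (u * D w + phi) = cos phi * expR (- (s ^+ 2 * u ^+ 2) / 2).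
  pose F (x : R) := cos (u * x + phi).
  have mF : measurable_fun setT F.
    apply: continuous_measurable_fun => x.
    apply: (@continuous_comp _ _ _ (fun x => u * x + phi) cos); last exact: continuous_cos.
    by apply: cvgD; [apply: cvgMl_tmp; exact: cvg_id | exact: cvg_cst].
  have bF : bounded_mfun F by split=> //; exists 1 => x; exact: cos_max.
  rewrite -(normal_trig s0 phi u) -(mean_normal_prob s bF).
  apply: (@same_law_mean _ _ _ _ _ _ _ P (normal_prob 0 s) D id mD _ _ F) => //.
  by split; [exact: measurableT_comp | exists 1 => w; exact: cos_max].
apply: complex_ext.
  transitivity (\int[P]_w cos (u * D w + 0)).
    by apply: eq_Rintegral => w _; rewrite cisE addr0.
  by rewrite key cos0 mul1r.
transitivity (\int[P]_w cos (u * D w + - (pi / 2))).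
  by apply: eq_Rintegral => w _; rewrite cisE cosBpihalf.
by rewrite key cosN cos_pihalf mul0r.
Qed.

End GaussianVariable.

(** * Means of products of independent variables *)

Section IndependentProduct.
Context {R : realType} {d} {T : measurableType d} (P : probability T R).
Local Notation C := R[i].

Lemma cmeasurable_cis (V : T -> R) :
  measurable_fun setT V -> cmeasurable (fun w => cis (V w)).
Proof.
move=> mV; apply: cmeasurable_cexp; apply: cmeasurableM; first exact: cmeasurable_cst.
exact: cmeasurable_real.
Qed.

Lemma cmean_indic (A : set T) : measurable A ->
  cmean P (fun w => (\1_A w)%:C%C) = (fine (P A))%:C%C.
Proof. by move=> mA; apply: complex_ext => /=; rewrite ?mean_indic// mean_cst. Qed.

Lemma ae_eq_cmean (F G : T -> C) : cbounded F -> cbounded G ->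
  {ae P, forall w, F w = G w} -> cmean P F = cmean P G.
Proof.
move=> [[mF1 _] [mF2 _]] [[mG1 _] [mG2 _]] FG; apply: complex_ext => /=; congr fine.
- apply: ae_eq_integral => //; try exact/measurable_EFinP.
  by apply: filterS FG => w -> _.
- apply: ae_eq_integral => //; try exact/measurable_EFinP.
  by apply: filterS FG => w -> _.
Qed.

Context (n : nat) (Y : nat -> T -> R) (mY : forall k, measurable_fun setT (Y k)).
Context (indepY : forall B : nat -> set R, (forall k, measurable (B k)) ->
  P (\bigcap_(k < n) (Y k @^-1` B k)) = (\prod_(k < n) P (Y k @^-1` B k))%E).

Let good (h : R -> C) := cmeasurable h /\ forall x, sqnorm (h x) <= 1.
Let ind (A : set R) (x : R) : C := (\1_A x)%:C%C.

Let good_ind A : measurable A -> good (ind A).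
Proof.
move=> mA; split; first by apply: cmeasurable_real; exact: measurable_indic.
move=> x; rewrite /ind indicE; case: (_ \in _); by rewrite /sqnorm /= ?expr1n ?expr0n ?addr0.
Qed.

Let bgood h k : good h -> cbounded (fun w => h (Y k w)).
Proof.
move=> [mh h1]; apply: cbounded_disc => [|w]; last exact: h1.
exact (cmeasurable_comp_alpha (mY k) mh).
Qed.

Let indic_bigcap (B : nat -> set R) w :
  \prod_(k < n) ind (B k) (Y k w) = (\1_(\bigcap_(k < n) (Y k @^-1` B k)) w)%:C%C.
Proof.
rewrite /ind -rmorph_prod; congr (_%:C)%C.
rewrite [in RHS]indicE; case: (boolP (w \in _)) => /= [/set_mem wB|/negP wB].
  by rewrite big1// => k _; rewrite indicE mem_set//; exact: (wB k (ltn_ord k)).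
have [k kB] : exists k : 'I_n, ~ B k (Y k w).
  apply/not_existsP => h; apply: wB; apply/mem_set => k /= kn.
  by apply: contrapT => nB; exact: h (Ordinal kn) nB.
by rewrite (bigD1 k)//= indicE memNset// mul0r.
Qed.

(** The hypothesis is the product formula for indicators. They are replaced by
    bounded functions one factor at a time: as a function of the factor in
    [Y j], either side is determined by its values at indicators. *)
Lemma cmean_prod_indep (g : nat -> R -> C) :
  (forall k, cmeasurable (g k)) -> (forall k x, sqnorm (g k x) <= 1) ->
  cmean P (fun w => \prod_(k < n) g k (Y k w)) =
  \prod_(k < n) cmean P (fun w => g k (Y k w)).
Proof.
move=> mg g1.
suff S j : (j <= n)%N -> forall h, (forall k, good (h k)) ->
    (forall k, (j <= k)%N -> exists2 B, measurable B & h k = ind B) ->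
    cmean P (fun w => \prod_(k < n) h k (Y k w)) =
    \prod_(k < n) cmean P (fun w => h k (Y k w)).
  pose h k := if (k < n)%N then g k else ind setT.
  have := S n (leqnn n) h; rewrite /h.
  under eq_bigr do rewrite ltn_ord.
  under [in X in (_ -> _ -> cmean _ X = _) -> _]eq_fun do under eq_bigr do rewrite ltn_ord.
  apply.
    by move=> k; case: ifP => _; [split | exact: good_ind].
  by move=> k nk; rewrite ltnNge nk /=; exists setT.
elim: j => [_|j IH jn] h gh hB.
  have /choice[B hBB] : forall k, exists B, measurable B /\ h k = ind B.
    by move=> k; have [B mB hk] := hB k (leq0n k); exists B.
  have mYB k : measurable (Y k @^-1` B k).
    by rewrite -[_ @^-1` _]setTI; apply: mY => //; have [] := hBB k.
  transitivity (cmean P (fun w => (\1_(\bigcap_(k < n) (Y k @^-1` B k)) w)%:C%C)).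
    apply: eq_cmean => w; rewrite -indic_bigcap; apply: eq_bigr => k _.
    by have [_ ->] := hBB k.
  rewrite cmean_indic; last by apply: bigcap_measurableType.
  rewrite indepY; last by move=> k; have [] := hBB k.
  rewrite (_ : \prod_(k < n) _ = (\prod_(k < n) fine (P (Y k @^-1` B k)))%:E)%E /=; last first.
    by elim/big_rec2 : _ => // k x y _ ->; rewrite EFinM fineK// fin_num_measure.
  transitivity (\prod_(k < n) (fine (P (Y k @^-1` B k)))%:C%C : C).
    by rewrite -rmorph_prod.
  apply: eq_bigr => k _; rewrite -cmean_indic//; apply: eq_cmean => w.
  by have [_ ->] := hBB k.
pose j0 := Ordinal jn.
pose F w := \prod_(k < n | k != j0) h k (Y k w).
pose c := \prod_(k < n | k != j0) cmean P (fun w => h k (Y k w)).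
have bF : cbounded F.
  have -> : F = fun w => \prod_(k < n) (if k != j0 then h k (Y k w) else 1).
    by apply/funext => w; rewrite /F big_mkcond.
  by apply: cbounded_prod => k; case: (k != j0); [exact: bgood | exact: cbounded_cst].
transitivity (cmean P (fun w => h j (Y j w) * F w)).
  by apply: eq_cmean => w; rewrite (bigD1 j0).
transitivity (cmean P (fun w => h j (Y j w) * c)); last first.
  rewrite (bigD1 j0)//= -/c mulrC -cmeanZ; last exact: bgood.
  by apply: eq_cmean => w; rewrite mulrC.
have [[mh1 mh2] hj1] := gh j.
apply: (@cmean_preimage_ext _ _ _ P (Y j) F (fun=> c) (h j)) => //.
- exact: cbounded_cst.
- move=> A mA; pose hA k := if k == j then ind A else h k.
  have hA' (k : 'I_n) : k != j0 -> hA k = h k.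
    by rewrite /hA => /negPf; rewrite -val_eqE /= => ->.
  have hAj : hA j = ind A by rewrite /hA eqxx.
  have := IH (ltnW jn) hA.
  rewrite (bigD1 j0)//= hAj (eq_bigr (fun k : 'I_n => cmean P (fun w => h k (Y k w)))); last first.
    by move=> k /hA' ->.
  rewrite -/c => H.
  transitivity (cmean P (fun w => \prod_(k < n) hA k (Y k w))).
    apply: eq_cmean => w; rewrite (bigD1 j0)//= hAj; congr (_ * _).
    by apply: eq_bigr => k /hA' ->.
  rewrite H.
  + rewrite mulrC -cmeanZ; last by apply: bgood; exact: good_ind.
    by apply: eq_cmean => w; rewrite mulrC.
  + by move=> k; rewrite /hA; case: ifP => _ //; exact: good_ind.
  + move=> k jk; rewrite /hA; case: eqVneq => [_|kj]; first by exists A.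
    by apply: hB; rewrite ltn_neqAle eq_sym kj.
- exact: bgood.
Qed.

End IndependentProduct.

(** * Linear combinations of values of Brownian motion *)

Section SortedTimes.
Context {R : realType}.

(** Brownian increments are indexed by nondecreasing sequences from 0, whereas
    the times of a marginal come in no order and may coincide. *)
Lemma sorted_times (m : nat) (t : 'I_m -> R) : (forall i, 0 <= t i) ->
  exists tau : nat -> R, exists k : 'I_m -> nat,
  [/\ tau 0%N = 0, {homo tau : i j / (i <= j)%N >-> i <= j} &
      forall i, (k i <= m)%N /\ tau (k i) = t i].
Proof.
move=> t0; pose s := 0 :: sort <=%R (codom t).
have sm : size s = m.+1 by rewrite /= size_sort size_codom card_ord.
have ss : sorted <=%R s.
  rewrite /s /= path_sortedE; last exact: le_trans.
  rewrite sort_le_sorted andbT; apply/allP => x; rewrite mem_sort => /codomP[i ->].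
  exact: t0.
exists (fun k => nth 0 s (minn k m)), (fun i => index (t i) s); split=> //.
- by rewrite min0n.
- move=> i j ij; apply: (sorted_leq_nth (@le_trans _ _) (@lexx _ _)) => //.
  + by rewrite inE sm ltnS geq_minr.
  + by rewrite inE sm ltnS geq_minr.
  + by rewrite leq_min geq_minr andbT (leq_trans (geq_minl _ _)).
- move=> i; have ts : t i \in s by rewrite inE mem_sort codom_f orbT.
  have km : (index (t i) s <= m)%N by rewrite -ltnS -sm index_mem.
  by split=> //; rewrite (minn_idPl km) nth_index.
Qed.

Lemma telescope_upto (u : nat -> R) (n k : nat) : (k <= n)%N ->
  \sum_(j < n) (j < k)%N%:R * (u j.+1 - u j) = u k - u 0%N.
Proof.
move=> kn; rewrite -(telescope_sumr _ (leq0n k)) big_mkord.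
rewrite (big_ord_widen n (fun j => u j.+1 - u j) kn).
by rewrite [RHS]big_mkcond; apply: eq_bigr => j _; case: ifP; rewrite ?mul1r ?mul0r.
Qed.

(** Summation by parts. *)
Lemma sum_increments (m n : nat) (th : 'I_m -> R) (k : 'I_m -> nat) (u : nat -> R) :
  (forall i, (k i <= n)%N) -> u 0%N = 0 ->
  \sum_i th i * u (k i) =
  \sum_(j < n) (\sum_i th i * (j < k i)%N%:R) * (u j.+1 - u j).
Proof.
move=> kn u0; under [RHS]eq_bigr do rewrite mulr_suml.
rewrite exchange_big /=; apply: eq_bigr => i _.
transitivity (th i * (u (k i) - u 0%N)); first by rewrite u0 subr0.
rewrite -(telescope_upto u (kn i)) mulr_sumr.
by apply: eq_bigr => j _; rewrite mulrA.
Qed.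

(** The variance of a combination of independent increments, in terms of the
    covariance [min s t] of Brownian motion. *)
Lemma sum_increments_sqr (m n : nat) (th : 'I_m -> R) (k : 'I_m -> nat) (tau : nat -> R) :
  (forall i, (k i <= n)%N) -> tau 0%N = 0 -> {homo tau : i j / (i <= j)%N >-> i <= j} ->
  \sum_(j < n) (\sum_i th i * (j < k i)%N%:R) ^+ 2 * (tau j.+1 - tau j) =
  \sum_i \sum_l th i * th l * Num.min (tau (k i)) (tau (k l)).
Proof.
move=> kn t0 tm.
have minE i l : Num.min (tau (k i)) (tau (k l)) = tau (minn (k i) (k l)).
  case: (leqP (k i) (k l)) => [h|/ltnW h].
    by rewrite (min_idPl (tm _ _ h)).
  by rewrite (min_idPr (tm _ _ h)).
transitivity (\sum_(j < n) \sum_i \sum_l th i * th l *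
    ((j < minn (k i) (k l))%N%:R * (tau j.+1 - tau j))).
  apply: eq_bigr => j _; rewrite expr2 mulr_suml mulr_suml; apply: eq_bigr => i _.
  rewrite mulr_sumr mulr_suml; apply: eq_bigr => l _.
  rewrite leq_min -mulnb natrM; ring.
rewrite exchange_big /=; apply: eq_bigr => i _.
rewrite exchange_big /=; apply: eq_bigr => l _.
rewrite -mulr_sumr telescope_upto; last by rewrite geq_min kn.
by rewrite t0 subr0 minE.
Qed.

End SortedTimes.

Section BrownianCharacteristic.
Context {R : realType} {d} {T : measurableType d} (P : probability T R).
Local Notation C := R[i].
Context (B : R -> {RV P >-> R}) (hB : standard_brownian_motion P B).
Context (a : T -> R) (ma : measurable_fun setT a) (aB : indep_of_process P a B).

(** The formula also holds for a degenerate increment, which is constant. *)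
Lemma cmean_cis_increment (s t u : R) : 0 <= s -> s <= t ->
  cmean P (fun w => cis (u * (B t w - B s w))) = (expR (- ((t - s) * u ^+ 2) / 2))%:C%C.
Proof.
move=> s0; rewrite le_eqVlt => /predU1P[<-|st].
  rewrite subrr mul0r oppr0 mul0r expR0 -[RHS]/(1 : C) -(cmean_cst P 1); apply: eq_cmean => w.
  by rewrite subrr mulr0 cisE cos0 sin0.
have ts : 0 < t - s by rewrite subr_gt0.
rewrite (@cmean_cis_normal _ _ _ P (fun w => B t w - B s w) (Num.sqrt (t - s))).
- by rewrite sqr_sqrtr// ltW.
- by rewrite sqrtr_gt0.
- by apply: measurable_funB; exact: measurable_funPT.
- exact: (@bm_normal_increments _ _ _ P B hB s t s0 st).
Qed.

Context (tau : nat -> R) (tau0 : tau 0%N = 0)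
        (tauM : {homo tau : i j / (i <= j)%N >-> i <= j}).
Let D k w : R := B (tau k.+1) w - B (tau k) w.

Let mD k : measurable_fun setT (D k).
Proof. by apply: measurable_funB; exact: measurable_funPT. Qed.

Let tau_ge0 k : 0 <= tau k.
Proof. by rewrite -tau0 tauM. Qed.

Lemma process_increments_event (n : nat) (A : nat -> set R) :
  (forall k, measurable (A k)) ->
  process_sigma_algebra B (\bigcap_(k < n) (D k @^-1` A k)).
Proof.
move=> mA.
pose U := g_sigma_algebraType (\bigcup_(t in `[0, +oo[%classic) g_sigma_algebra_preimage (B t)).
have mB t : 0 <= t -> measurable_fun setT (B t : U -> R).
  move=> t0 _ E mE; apply: sub_sigma_algebra; exists t; first by rewrite /= in_itv /= t0.
  by exists E.
have mDU k : measurable_fun setT (D k : U -> R).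
  by apply: measurable_funB; apply: mB.
suff : measurable (\bigcap_(k < n) ((D k : U -> R) @^-1` A k)) by [].
apply: bigcap_measurableType => k _.
by rewrite -[_ @^-1` _]setTI; exact: mDU.
Qed.

(* The independent parameter is placed in front of the increments. *)
Let Y (k : nat) : T -> R := if k is k'.+1 then D k' else a.

Let indepY n (E : nat -> set R) : (forall k, measurable (E k)) ->
  P (\bigcap_(k < n.+1) (Y k @^-1` E k)) = (\prod_(k < n.+1) P (Y k @^-1` E k))%E.
Proof.
move=> mE.
have -> : \bigcap_(k < n.+1) (Y k @^-1` E k) =
    a @^-1` E 0%N `&` \bigcap_(k < n) (D k @^-1` E k.+1).
  apply/seteqP; split => [w h|w [h0 h] [|k]] //=.
    by split; [exact: (h 0%N) | move=> k kn; exact: (h k.+1)].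
  by rewrite ltnS => kn; exact: h.
rewrite aB; last 2 first.
- by exists (E 0%N) => //; rewrite setTI.
- by apply: (@process_increments_event n (fun k => E k.+1)) => k; exact: mE.
rewrite big_ord_recl /=; congr (_ * _)%E.
have I := @bm_indep_increments _ _ _ P B hB tau (tau_ge0 0%N) tauM.
have := I (iota 0 n) (fun k => E k.+1) (iota_uniq 0 n) (fun k _ => mE k.+1).
rewrite -[in X in _ = X](subn0 n) -/(index_iota 0 n) big_mkord => <-.
congr (P _); apply/seteqP; split => w h k /=.
  by rewrite mem_iota /= => kn; exact: h.
by move=> kn; apply: h; rewrite /= mem_iota.
Qed.

(** The linear combination of values is one of independent Gaussian increments. *)
Lemma cmean_cis_brownian_sorted (m : nat) (th : 'I_m -> R) (k : 'I_m -> nat)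
    (g : R -> C) (c : R) :
  (forall i, (k i <= m)%N) -> cmeasurable g -> (forall x, sqnorm (g x) <= 1) ->
  cmean P (fun w => g (a w) * cis (c * \sum_i th i * B (tau (k i)) w)) =
  cmean P (fun w => g (a w)) *
    (expR (- (c ^+ 2 * \sum_i \sum_l th i * th l * Num.min (tau (k i)) (tau (k l))) / 2))%:C%C.
Proof.
move=> km mg g1.
pose gam j := \sum_i th i * (j < k i)%N%:R.
pose f (j : nat) : R -> C := if j is j'.+1 then fun x => cis (c * gam j' * x) else g.
have mcis (x : R) : cmeasurable (fun y : R => cis (x * y)).
  by apply: cmeasurable_cis; exact: measurable_funM.
have mf j : cmeasurable (f j) by case: j => [|j] //; exact: mcis.
have f1 j x : sqnorm (f j x) <= 1 by case: j => [|j] //; rewrite sqnorm_cis.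
have mY j : measurable_fun setT (Y j) by case: j.
have := @cmean_prod_indep _ _ _ P m.+1 Y mY (@indepY m) f mf f1.
rewrite big_ord_recl /= => H.
transitivity (cmean P (fun w => \prod_(j < m.+1) f j (Y j w))).
  apply: ae_eq_cmean.
  - apply: cbounded_disc => [|w].
      apply: cmeasurableM; first exact (cmeasurable_comp_alpha ma mg).
      apply: (@cmeasurable_comp_alpha _ _ _ (fun w => \sum_i th i * B (tau (k i)) w) _
         (fun y => cis (c * y)) (mcis c)).
      by apply: measurable_sum => i; apply: measurable_funM => //; exact: measurable_funPT.
    by rewrite sqnormM sqnorm_cis mulr1.
  - by apply: cbounded_prod => j; apply: cbounded_disc => [|w] //;
      exact (cmeasurable_comp_alpha (mY j) (mf j)).
  - apply: filterS (@bm_start _ _ _ P B hB) => w B0; rewrite big_ord_recl /=; congr (_ * _).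
    rewrite (@sum_increments _ m m th k (fun j => B (tau j) w) km); last by rewrite tau0.
    rewrite mulr_sumr /cis -cexp_sum; congr cexp.
    rewrite rmorph_sum mulr_sumr; apply: eq_bigr => j _.
    by rewrite mulrA.
rewrite H; congr (_ * _).
transitivity (\prod_(j < m) (expR (- ((tau j.+1 - tau j) * (c * gam j) ^+ 2) / 2))%:C%C : C).
  by apply: eq_bigr => j _; apply: cmean_cis_increment => //; exact: tauM.
rewrite -rmorph_prod -expR_sum; congr (expR _)%:C%C.
rewrite -(@sum_increments_sqr _ m m th k tau km tau0 tauM) mulr_sumr.
rewrite -sumrN mulr_suml; apply: eq_bigr => j _; rewrite -/(gam j); ring.
Qed.

End BrownianCharacteristic.

(** * Mixture with an independent scale *)

Section BrownianMixture.
Context {R : realType} {d} {T : measurableType d} (P : probability T R).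
Local Notation C := R[i].
Context (B : R -> {RV P >-> R}) (hB : standard_brownian_motion P B).
Context (a : T -> R) (ma : measurable_fun setT a) (aB : indep_of_process P a B).

Definition brownian_covariance (m : nat) (t th : 'I_m -> R) : R :=
  \sum_i \sum_l th i * th l * Num.min (t i) (t l).

(** It is the variance of a combination of increments. *)
Lemma brownian_covariance_ge0 (m : nat) (t th : 'I_m -> R) :
  (forall i, 0 <= t i) -> 0 <= brownian_covariance t th.
Proof.
move=> t0; have [tau [k [tau0 tauM tk]]] := sorted_times t0.
rewrite (_ : brownian_covariance t th =
    \sum_i \sum_l th i * th l * Num.min (tau (k i)) (tau (k l))); last first.
  by apply: eq_bigr => i _; apply: eq_bigr => l _; rewrite !(tk _).2.
rewrite -(@sum_increments_sqr _ m m th k tau (fun i => (tk i).1) tau0 tauM).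
by apply: sumr_ge0 => j _; rewrite mulr_ge0 ?sqr_ge0// subr_ge0 tauM.
Qed.

Lemma cmean_cis_brownian (m : nat) (t th : 'I_m -> R) (g : R -> C) (c : R) :
  (forall i, 0 <= t i) -> cmeasurable g -> (forall x, sqnorm (g x) <= 1) ->
  cmean P (fun w => g (a w) * cis (c * \sum_i th i * B (t i) w)) =
  cmean P (fun w => g (a w)) *
    (expR (- (c ^+ 2 * brownian_covariance t th) / 2))%:C%C.
Proof.
move=> t0 mg g1; have [tau [k [tau0 tauM tk]]] := sorted_times t0.
have := @cmean_cis_brownian_sorted _ _ _ P B hB a ma aB tau tau0 tauM m th k g c
  (fun i => (tk i).1) mg g1.
congr (_ = _ * (expR (- (_ * _) / 2))%:C%C).
  apply: eq_cmean => w; congr (_ * cis (_ * _)).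
  by apply: eq_bigr => i _; rewrite (tk i).2.
by apply: eq_bigr => i _; apply: eq_bigr => l _; rewrite !(tk _).2.
Qed.

Lemma truncn_approx (y : R) (N : nat) : 0 <= y ->
  `|(Num.truncn (N.+1%:R * y))%:R / N.+1%:R - y| <= N.+1%:R^-1.
Proof.
move=> y0; have N0 : 0 < N.+1%:R :> R by rewrite ltr0n.
have /andP[t1 t2] := truncn_itv (mulr_ge0 (ltW N0) y0).
rewrite [_ / _]mulrC -(ler_pM2l N0) -[X in X * `| _ |]gtr0_norm// -normrM mulrBr.
rewrite mulVKf ?gt_eqF// divff ?gt_eqF// ler_norml; move: t2; rewrite -(natr1 (Num.truncn _)) => t2.
by apply/andP; split; lra.
Qed.

Lemma cvg_truncn_approx (y : R) : 0 <= y ->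
  (Num.truncn (N.+1%:R * y))%:R / N.+1%:R @[N --> \oo] --> y.
Proof.
move=> y0; apply/subr_cvg0; apply/norm_cvg0P.
apply: (@squeeze_cvgr _ _ _ _ (fun=> 0) (fun N : nat => N.+1%:R^-1)).
- by near=> N; rewrite normr_ge0 truncn_approx.
- exact: cvg_cst.
- exact: cvg_harmonic.
Unshelve. all: by end_near. Qed.

Lemma ccvg_cis (u : nat -> R) (l : R) :
  u n @[n --> \oo] --> l -> ccvg (fun n => cis (u n)) (cis l).
Proof.
move=> ul; rewrite (_ : (fun n => _) = fun n => (cos (u n) +i* sin (u n))%C); last first.
  by apply/funext => n; rewrite cisE.
rewrite cisE; split => /=; first exact: (cvg_comp _ _ ul (@continuous_cos R _)).
exact: (cvg_comp _ _ ul (@continuous_sin R _)).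
Qed.

Lemma measurable_truncn_scale (c : R) (h : R -> R) : measurable_fun setT h ->
  measurable_fun setT (fun x => Num.truncn (c * h x)).
Proof.
move=> mh; pose y x := c * h x.
have my : measurable_fun setT y by exact: measurable_funM.
move=> mT; apply: (measurability _ NGenCInfty.measurableE) => //.
move=> /= _ [_ [[|q] ->] <-]; rewrite preimage_itvcy setTI.
  by rewrite (_ : [set _ | _] = setT)//; apply/seteqP; split.
rewrite (_ : [set _ | _] = y @^-1` `[q.+1%:R, +oo[).
  by rewrite -[_ @^-1` _]setTI; exact: my.
by apply/seteqP; split => x /=; rewrite in_itv /= andbT -truncn_gt_nat.
Qed.

(** Conditionally on an independent scale, a linear combination of values of
    the motion is Gaussian; rounding the scale reduces this to constants. *)
Lemma cmean_cis_brownian_mixture (m : nat) (t th : 'I_m -> R) (h : R -> R) :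
  (forall i, 0 <= t i) -> measurable_fun setT h -> (forall x, 0 <= h x) ->
  cmean P (fun w => cis (h (a w) * \sum_i th i * B (t i) w)) =
  (\int[P]_w expR (- (h (a w) ^+ 2 * brownian_covariance t th) / 2))%:C%C.
Proof.
move=> t0 mh h0; set s2 := brownian_covariance t th.
have s20 : 0 <= s2 := brownian_covariance_ge0 th t0.
pose W w := \sum_i th i * B (t i) w.
have mW : measurable_fun setT W.
  by apply: measurable_sum => i; apply: measurable_funM => //; exact: measurable_funPT.
(* The scale is rounded to a multiple of [1 / (N + 1)], a constant on the level
   sets of [X N]. *)
pose X N w := Num.truncn (N.+1%:R * h (a w)).
have mX N : measurable_fun setT (X N).
  exact: (measurableT_comp (measurable_truncn_scale _ mh) ma).
pose F (N x : nat) w := cis (x%:R / N.+1%:R * W w).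
pose G (N x : nat) (w : T) : C := (expR (- ((x%:R / N.+1%:R) ^+ 2 * s2) / 2))%:C%C.
have mF N x : cmeasurable (F N x) by apply: cmeasurable_cis; exact: measurable_funM.
have mG N x : cmeasurable (G N x) by exact: cmeasurable_cst.
have F1 N x w : sqnorm (F N x w) <= 1 by rewrite sqnorm_cis.
have G1 N x w : sqnorm (G N x w) <= 1.
  rewrite /sqnorm /= expr0n addr0 exprn_ile1 ?expR_ge0// -expR0 ler_expR mulNr oppr_le0.
  by rewrite divr_ge0// mulr_ge0// sqr_ge0.
have FG N : cmean P (fun w => F N (X N w) w) = cmean P (fun w => G N (X N w) w).
  apply: (eq_cmean_levels (K := 1)) => // x.
  have := @cmean_cis_brownian m t th
    (fun y => (Num.truncn (N.+1%:R * h y) == x)%:R) (x%:R / N.+1%:R) t0.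
  rewrite -/s2 => -> //.
  - rewrite mulrC -cmeanZ; last exact (cbounded_level x (mX N)).
    by apply: eq_cmean => w; rewrite mulrC.
  - apply: (cmeasurable_level (X := fun y => Num.truncn (N.+1%:R * h y))).
    exact: measurable_truncn_scale.
  - by move=> y; exact: sqnorm_bool.
have cvgX w : ((X N w)%:R / N.+1%:R : R) @[N --> \oo] --> h (a w) by exact: cvg_truncn_approx.
have bF N : cbounded (fun w => F N (X N w) w).
  apply: cbounded_disc => [|w]; last exact: F1.
  exact (cmeasurable_nat_index (mX N) (mF N)).
have bG N : cbounded (fun w => G N (X N w) w).
  apply: cbounded_disc => [|w]; last exact: G1.
  exact (cmeasurable_nat_index (mX N) (mG N)).
have lF := proj2 (@cvg_cmean _ _ _ P (fun N w => F N (X N w) w)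
  (fun w => cis (h (a w) * W w)) (1 + 1) bF (fun N w => coord_le_sqnorm (F1 N _ w)) _).
have lG := proj2 (@cvg_cmean _ _ _ P (fun N w => G N (X N w) w)
  (fun w => (expR (- (h (a w) ^+ 2 * s2) / 2))%:C%C) (1 + 1) bG
  (fun N w => coord_le_sqnorm (G1 N _ w)) _).
transitivity (cmean P (fun w => (expR (- (h (a w) ^+ 2 * s2) / 2))%:C%C)); last first.
  by apply: complex_ext => //=; exact: mean_cst.
apply: (ccvg_unique (lF _)).
- move=> w; have cW : (X N w)%:R / N.+1%:R * W w @[N --> \oo] --> h (a w) * W w.
    by apply: cvgMr_tmp; exact: cvgX.
  exact (ccvg_cis cW).
- under eq_fun do rewrite FG.
  apply: lG => w; split => /=; last exact: cvg_cst.
  have cE : - (((X N w)%:R / N.+1%:R) ^+ 2 * s2) / 2 @[N --> \oo] -->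
      - (h (a w) ^+ 2 * s2) / 2.
    apply: cvgMr_tmp; apply: cvgN; apply: cvgMr_tmp.
    by rewrite expr2; under eq_fun do rewrite expr2; apply: cvgM; exact: cvgX.
  exact: (cvg_comp _ _ cE (@continuous_expR R _)).
Qed.
End BrownianMixture.

(** * Bernstein weights and the folding of the line *)

Section UniformContinuity.
Context {R : realType} (m : nat).

(** Heine's theorem. Only [x] is confined to the box. *)
Lemma box_uniform_continuity (f : 'rV[R]_m -> R) (L e : R) :
  continuous f -> 0 < e ->
  exists2 delta, 0 < delta & forall x y : 'rV[R]_m, (forall i, `|x ord0 i| <= L) ->
    (forall i, `|x ord0 i - y ord0 i| < delta) -> `|f x - f y| <= e.
Proof.
move=> cf e0; pose K := [set v : 'rV[R]_m | forall i, `[- L, L]%classic (v ord0 i)].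
have cK : compact K.
  by apply: (@rV_compact R m (fun=> `[- L, L]%classic)) => _; exact: segment_compact.
pose Q (delta : R) (x : 'rV[R]_m) := forall y : 'rV[R]_m,
  (forall i, `|x ord0 i - y ord0 i| < delta) -> `|f x - f y| <= e.
have e2 : 0 < e / 2 by rewrite divr_gt0.
have : \forall delta \near (0 : R)^'+, K `<=` Q delta.
  have H := proj1 (compact_near_coveringP K) cK R ((0 : R)^'+) Q _; apply: H => x Kx.
  have /cvgrPdist_lt /(_ _ e2) /nbhs_ballP[r /= r0 xr] := cf x.
  have r2 : 0 < r / 2 by rewrite divr_gt0.
  exists (ball x (r / 2), [set delta : R | delta < r / 2]).
    split=> /=; first exact: nbhsx_ballx.
    exact: nbhs_right_lt.
  move=> [x' delta] /= [[_ xx'] dr] y x'y.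
  have h1 : `|f x - f x'| < e / 2.
    apply: xr; split=> // i j; apply: le_ball (xx' i j); lra.
  have h2 : `|f x - f y| < e / 2.
    apply: xr; split=> // i j; rewrite [r](splitr r).
    apply: ball_triangle (xx' i j) _; rewrite ord1 /ball /=.
    exact: lt_trans (x'y j) dr.
  rewrite -(subrK (f x) (f x')) -addrA (le_trans (ler_normD _ _))// [e]splitr distrC.
  by rewrite lerD// ltW.
move=> [r /= r0 rQ]; exists (r / 2); first by rewrite divr_gt0.
move=> x y xL xy; apply: (rQ (r / 2)) => //.
- by rewrite /= sub0r normrN gtr0_norm ?divr_gt0// ltr_pdivrMr// ltr_pMr// ltr1n.
- by rewrite divr_gt0.
- by move=> i; rewrite /= in_itv /= -ler_norml.
Qed.

End UniformContinuity.

Section Bernstein.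
Context {R : realType}.

(** The binomial weights, by Pascal's rule rather than by factorials. *)
Fixpoint bernstein (N k : nat) (u : R) : R :=
  if N is N'.+1 then
    (if k is k'.+1 then u * bernstein N' k' u else 0) + (1 - u) * bernstein N' k u
  else (k == 0%N)%:R.

Lemma bernstein_ge0 N k u : 0 <= u <= 1 -> 0 <= bernstein N k u.
Proof.
move=> /andP[u0 u1]; elim: N k => [|N IH] k //=.
apply: addr_ge0; last by rewrite mulr_ge0// subr_ge0.
by case: k => [|k] //; rewrite mulr_ge0.
Qed.

Lemma bernstein_large N k u : (N < k)%N -> bernstein N k u = 0.
Proof.
elim: N k => [|N IH] [|k] //= Nk.
by rewrite !IH// ?mulr0 ?addr0// ltnW.
Qed.

(** Condition on the first of [N + 1] Bernoulli trials. *)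
Lemma sum_bernsteinS N (g : nat -> R) u :
  \sum_(k < N.+2) bernstein N.+1 k u * g k =
  \sum_(k < N.+1) bernstein N k u * (u * g k.+1 + (1 - u) * g k).
Proof.
transitivity (\sum_(k < N.+1) bernstein N k u * (u * g k.+1) +
              \sum_(k < N.+1) bernstein N k u * ((1 - u) * g k)); last first.
  by rewrite -big_split; apply: eq_bigr => k _; rewrite mulrDr.
transitivity (\sum_(k < N.+2) (if k : nat is k'.+1 then u * bernstein N k' u else 0) * g k +
              \sum_(k < N.+2) (1 - u) * bernstein N k u * g k).
  by rewrite -big_split; apply: eq_bigr => k _; rewrite /= mulrDl.
congr (_ + _).
  rewrite big_ord_recl mul0r add0r; apply: eq_bigr => k _ /=.
  by ring.
rewrite big_ord_recr /= bernstein_large// mulr0 mul0r addr0; apply: eq_bigr => k _.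
by rewrite /=; ring.
Qed.

Lemma sum_bernstein N u : \sum_(k < N.+1) bernstein N k u = 1.
Proof.
elim: N => [|N IH]; first by rewrite big_ord1.
under eq_bigr do rewrite -[bernstein _ _ _]mulr1.
rewrite (sum_bernsteinS N (fun=> 1)) -[RHS]IH; apply: eq_bigr => k _.
by rewrite !mulr1 addrCA subrr addr0 mulr1.
Qed.

(** Each trial adds the variance of a single one. *)
Lemma bernstein_variance N u :
  \sum_(k < N.+1) bernstein N k u * (k%:R - N%:R * u) ^+ 2 = N%:R * (u * (1 - u)).
Proof.
elim: N => [|N IH]; first by rewrite big_ord1 /= !mul0r subr0 expr0n mulr0.
rewrite (sum_bernsteinS N (fun k => (k%:R - N.+1%:R * u) ^+ 2)).
transitivity (\sum_(k < N.+1) (bernstein N k u * (k%:R - N%:R * u) ^+ 2 +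
                               bernstein N k u * (u * (1 - u)))).
  by apply: eq_bigr => k _; rewrite -mulrDr -!natr1; congr (_ * _); ring.
by rewrite big_split /= IH -mulr_suml sum_bernstein mul1r -[N.+1%:R]natr1 mulrDl mul1r.
Qed.

(** A quantitative form of the injectivity of sine on its principal interval:
    sin A - sin D = 2 sin((A - D)/2) cos((A + D)/2), and the cosine is at least
    the sine of half the distance. *)
Lemma sin_separation (A D : R) : - (pi / 2) <= A <= pi / 2 -> - (pi / 2) <= D <= pi / 2 ->
  2 * sin ((A - D) / 2) ^+ 2 <= `|sin A - sin D|.
Proof.
wlog AD : A D / D <= A => [H|] hA hD.
  case: (leP D A) => [h|/ltW h]; first exact: H.
  by rewrite distrC -sqrrN -sinN -mulNr opprB; exact: H.
pose s := (A + D) / 2; pose h := (A - D) / 2.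
have AE : A = s + h by rewrite /s /h; field.
have DE : D = s - h by rewrite /s /h; field.
have h0 : 0 <= h by rewrite divr_ge0// subr_ge0.
have hpi : h <= pi / 2 by rewrite /h; move: hA hD => /andP[? ?] /andP[? ?]; lra.
have sh : `|s| <= pi / 2 - h.
  by rewrite ler_norml; move: hA hD; rewrite AE DE => /andP[? ?] /andP[? ?]; apply/andP; split; lra.
have E : sin A - sin D = 2 * (cos s * sin h).
  by rewrite AE DE sinD sinB; ring.
have sinh0 : 0 <= sin h by apply: sin_ge0_pi; rewrite h0 /=; have := pi_ge0 R; lra.
have coss : sin h <= cos s.
  rewrite -(cos_norm s) -[sin h]cosBpihalf -cosN opprB.
  rewrite leNgt; apply/negP; rewrite ltr_cos.
  - by rewrite ltNge sh.
  - by rewrite in_itv /= subr_ge0 hpi /=; have := pi_ge0 R; lra.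
  - by rewrite in_itv /= normr_ge0 /=; have := pi_ge0 R; lra.
rewrite -/h E normrM ger0_norm// ler_pM2l// ger0_norm; last first.
  by rewrite mulr_ge0// (le_trans sinh0).
by rewrite expr2 ler_wpM2r.
Qed.

End Bernstein.

(** * Approximation by trigonometric polynomials *)

Section TrigonometricPolynomials.
Context {R : realType} (m : nat).
Local Notation C := R[i].

(** The test functions whose means are controlled by characteristic functions.
    They are closed under products because [cis] turns sums into products. *)
Inductive trig_poly : ('rV[R]_m -> C) -> Prop :=
| TrigTerm (c : C) (th : 'I_m -> R) :
    trig_poly (fun x => c * cis (\sum_i th i * x ord0 i))
| TrigSum p q : trig_poly p -> trig_poly q -> trig_poly (fun x => p x + q x).

Lemma eq_trig_poly p q : p =1 q -> trig_poly p -> trig_poly q.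
Proof. by move=> /funext ->. Qed.

Lemma cisD (x y : R) : cis (x + y) = cis x * cis y.
Proof. by rewrite /cis -cexpD rmorphD mulrDr. Qed.

Lemma trig_polyM p q : trig_poly p -> trig_poly q -> trig_poly (fun x => p x * q x).
Proof.
move=> hp; elim: hp q => [c th|p1 p2 _ IH1 _ IH2] q hq; last first.
  by apply: (eq_trig_poly _ (TrigSum (IH1 q hq) (IH2 q hq))) => x; rewrite mulrDl.
elim: hq => [c' th'|q1 q2 _ IH1 _ IH2]; last first.
  by apply: (eq_trig_poly _ (TrigSum IH1 IH2)) => x; rewrite mulrDr.
apply: (eq_trig_poly _ (TrigTerm (c * c') (fun i => th i + th' i))) => x.
rewrite (eq_bigr (fun i => th i * x ord0 i + th' i * x ord0 i)); last first.
  by move=> i _; rewrite mulrDl.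
by rewrite big_split /= cisD mulrACA.
Qed.

Lemma trig_poly_cst (c : C) : trig_poly (fun=> c).
Proof.
apply: (eq_trig_poly _ (TrigTerm c (fun=> 0))) => x.
rewrite big1; last by move=> i _; rewrite mul0r.
by rewrite cisE cos0 sin0 -[(1 +i* 0)%C]/(1 : C) mulr1.
Qed.

Lemma trig_poly_sum (I : Type) (s : seq I) (F : I -> 'rV[R]_m -> C) :
  (forall i, trig_poly (F i)) -> trig_poly (fun x => \sum_(i <- s) F i x).
Proof.
move=> hF; elim: s => [|i s IH].
  by apply: (eq_trig_poly _ (trig_poly_cst 0)) => x; rewrite big_nil.
by apply: (eq_trig_poly _ (TrigSum (hF i) IH)) => x; rewrite big_cons.
Qed.

Lemma trig_poly_prod (I : Type) (s : seq I) (F : I -> 'rV[R]_m -> C) :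
  (forall i, trig_poly (F i)) -> trig_poly (fun x => \prod_(i <- s) F i x).
Proof.
move=> hF; elim: s => [|i s IH].
  by apply: (eq_trig_poly _ (trig_poly_cst 1)) => x; rewrite big_nil.
by apply: (eq_trig_poly _ (trig_polyM (hF i) IH)) => x; rewrite big_cons.
Qed.

(** The folding of the [i]-th axis onto the unit interval, by half periods of
    length [pi / ka]. *)
Definition fold_coordinate (ka : R) (i : 'I_m) (x : 'rV[R]_m) : R :=
  (1 + sin (ka * x ord0 i)) / 2.

Lemma fold_coordinate01 ka i x : 0 <= fold_coordinate ka i x <= 1.
Proof.
rewrite /fold_coordinate; move: (sin_le1 (ka * x ord0 i)) (sin_geN1 (ka * x ord0 i)).
by move=> *; apply/andP; split; lra.
Qed.

Lemma trig_poly_fold ka i : trig_poly (fun x => (fold_coordinate ka i x)%:C%C).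
Proof.
pose th (s : R) j : R := if j == i then s else 0.
have thE s x : \sum_j th s j * x ord0 j = s * x ord0 i.
  rewrite (bigD1 i)//= {1}/th eqxx big1 ?addr0// => j /negPf ji.
  by rewrite /th ji mul0r.
have := TrigSum (TrigSum (TrigTerm (0 +i* - (1 / 4))%C (th ka)) (TrigTerm (0 +i* (1 / 4))%C (th (- ka))))
  (trig_poly_cst (1 / 2)%:C%C).
apply: eq_trig_poly => x; rewrite !thE mulNr !cisE cosN sinN.
by rewrite /fold_coordinate; apply: complex_ext => /=; field.
Qed.

Lemma trig_poly_bernstein N k ka i :
  trig_poly (fun x => (bernstein N k (fold_coordinate ka i x))%:C%C).
Proof.
have hu := trig_poly_fold ka i.
have hv : trig_poly (fun x => (1 - fold_coordinate ka i x)%:C%C).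
  apply: (eq_trig_poly _ (TrigSum (trig_poly_cst 1) (trig_polyM (trig_poly_cst (- 1)) hu))) => x.
  by rewrite mulN1r rmorphB rmorph1.
elim: N k => [|N IH] k /=; first exact: trig_poly_cst.
case: k => [|k].
  by apply: (eq_trig_poly _ (trig_polyM hv (IH 0%N))) => x; rewrite add0r -rmorphM.
apply: (eq_trig_poly _ (TrigSum (trig_polyM hu (IH k)) (trig_polyM hv (IH k.+1)))) => x.
by rewrite -!rmorphM -rmorphD.
Qed.

Section Approximation.
Context (f : 'rV[R]_m -> R) (M : R) (fM : forall x, `|f x| <= M).
Context (L : R) (L0 : 0 < L) (N : nat).

Let ka := pi / (2 * L).
Let u i x := fold_coordinate ka i x.
Let level (k : nat) : R := k%:R / N.+1%:R.
(* The point of [-L, L] that is folded onto [level k]. *)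
Let node (k : nat) : R := asin (2 * level k - 1) / ka.
Let W (h : {ffun 'I_m -> 'I_N.+2}) x := \prod_i bernstein N.+1 (h i) (u i x).

(** The multivariate Bernstein polynomial in the folded coordinates. *)
Definition bernstein_trig (x : 'rV[R]_m) : R :=
  \sum_(h : {ffun 'I_m -> 'I_N.+2}) f (\row_i node (h i)) * W h x.

Lemma trig_poly_bernstein_trig : trig_poly (fun x => (bernstein_trig x)%:C%C).
Proof.
pose F (h : {ffun 'I_m -> 'I_N.+2}) (x : 'rV[R]_m) : C := (f (\row_i node (h i)))%:C%C *
   \prod_i (bernstein N.+1 (h i) (u i x))%:C%C.
apply: (eq_trig_poly (p := fun x => \sum_h F h x)).
  by move=> x; rewrite rmorph_sum; apply: eq_bigr => h _; rewrite rmorphM rmorph_prod.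
apply: (@trig_poly_sum _ _ F) => h; rewrite /F; apply: trig_polyM; first exact: trig_poly_cst.
by apply: trig_poly_prod => i; exact: trig_poly_bernstein.
Qed.

Let W0 h x : 0 <= W h x.
Proof. by apply: prodr_ge0 => i _; apply: bernstein_ge0; exact: fold_coordinate01. Qed.

Let sumW (G : 'I_m -> 'I_N.+2 -> R) x :
  \sum_(h : {ffun 'I_m -> 'I_N.+2}) W h x * \prod_i G i (h i) =
  \prod_i \sum_(k < N.+2) bernstein N.+1 k (u i x) * G i k.
Proof.
by rewrite bigA_distr_bigA; apply: eq_bigr => h _; rewrite -big_split.
Qed.

Let sumW1 x : \sum_h W h x = 1.
Proof.
transitivity (\prod_(i < m) \sum_(k < N.+2) bernstein N.+1 k (u i x) * 1).
  rewrite -(sumW (fun _ _ => 1)); apply: eq_bigr => h _.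
  by rewrite big1 ?mulr1.
apply: big1 => i _; under eq_bigr do rewrite mulr1.
exact: sum_bernstein.
Qed.

Let varW j x : \sum_h W h x * (level (h j) - u j x) ^+ 2 <= N.+1%:R^-1.
Proof.
have N0 : 0 < N.+1%:R :> R by rewrite ltr0n.
pose G i (k : 'I_N.+2) : R := if i == j then (level k - u j x) ^+ 2 else 1.
rewrite (eq_bigr (fun h : {ffun 'I_m -> 'I_N.+2} => W h x * \prod_i G i (h i))); last first.
  move=> h _; rewrite (bigD1 j)//= {1}/G eqxx big1 ?mulr1// => i /negPf ij.
  by rewrite /G ij.
rewrite sumW.
rewrite (_ : \prod_i _ = \sum_(k < N.+2) bernstein N.+1 k (u j x) * G j k); last first.
  rewrite (bigD1 j)//= [X in _ * X]big1 ?mulr1// => i /negPf ij.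
  rewrite /G ij; under eq_bigr do rewrite mulr1.
  exact: sum_bernstein.
rewrite (eq_bigr (fun k : 'I_N.+2 => bernstein N.+1 k (u j x) *
     (k%:R - N.+1%:R * u j x) ^+ 2 * (N.+1%:R ^- 2))); last first.
  move=> k _; rewrite /G eqxx /level; move: N.+1%:R N0 (u j x) => c c0 v.
  by move: (bernstein _ _ _) => b; field; rewrite gt_eqF.
rewrite -mulr_suml bernstein_variance.
have /andP[u0 u1] := fold_coordinate01 ka j x; rewrite -/(u j x) in u0 u1.
rewrite (_ : N.+1%:R * (u j x * (1 - u j x)) * N.+1%:R ^- 2 = u j x * (1 - u j x) * N.+1%:R^-1); last first.
  by field; rewrite gt_eqF.
apply: ler_piMl; first by rewrite invr_ge0 ltW.
by apply: mulr_ile1 => //; rewrite ?subr_ge0 // lerBlDr lerDl.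
Qed.

Lemma bernstein_trig_bound x : `|bernstein_trig x| <= M.
Proof.
apply: le_trans (ler_norm_sum _ _ _) _.
rewrite -[leRHS]mulr1 -(sumW1 x) mulr_sumr; apply: ler_sum => h _.
by rewrite normrM (ger0_norm (W0 h x)) ler_wpM2r.
Qed.

(** Chebyshev's inequality: [f] is sampled at a distance at least [delta] from
    [x] only if some coordinate of the sample deviates, after folding, by more
    than a fixed amount. *)
Lemma bernstein_trig_error (x : 'rV[R]_m) (e delta : R) :
  (forall y : 'rV[R]_m, (forall i, `|x ord0 i - y ord0 i| < delta) -> `|f x - f y| <= e) ->
  (forall i, `|x ord0 i| <= L) -> 0 < delta -> delta <= L ->
  `|bernstein_trig x - f x| <=
    e + 2 * M * m%:R / sin (ka * delta / 2) ^+ 4 / N.+1%:R.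
Proof.
move=> fe xL d0 dL.
have N0 : 0 < N.+1%:R :> R by rewrite ltr0n.
have pi0 : 0 < pi :> R by exact: pi_gt0.
have M0 : 0 <= M := le_trans (normr_ge0 _) (fM 0).
have e0 : 0 <= e by apply: le_trans (fe x _) => // i; rewrite subrr normr0.
have ka0 : 0 < ka by rewrite divr_gt0// mulr_gt0.
have kaL : ka * L = pi / 2 by rewrite /ka; field; rewrite gt_eqF.
have kad : ka * delta / 2 <= pi / 4.
  have : ka * delta <= pi / 2 by rewrite -kaL ler_pM2l.
  by move=> h; lra.
have kad0 : 0 < ka * delta / 2 by rewrite divr_gt0// mulr_gt0.
set eta := sin (ka * delta / 2) ^+ 2.
have eta0 : 0 < eta.
  by rewrite exprn_gt0// sin_gt0_pi// kad0 /=; lra.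
have nodeE (k : 'I_N.+2) : (-1 : R) <= 2 * level k - 1 <= 1.
  have k0 : 0 <= level k by rewrite /level divr_ge0// ltW.
  have k1 : level k <= 1 by rewrite /level ler_pdivrMr// mul1r ler_nat -ltnS.
  by apply/andP; split; lra.
have kx i : - (pi / 2) <= ka * x ord0 i <= pi / 2.
  by have := xL i; rewrite ler_norml -kaL -mulrN !ler_pM2l.
have kan k : ka * node k = asin (2 * level k - 1).
  by rewrite /node mulrC divfK// gt_eqF.
have knode (k : 'I_N.+2) : - (pi / 2) <= ka * node k <= pi / 2.
  by rewrite kan asin_geNpi2 ?asin_lepi2.
have sep i (k : 'I_N.+2) : delta <= `|x ord0 i - node k| ->
    eta <= `|level k - u i x|.
  move=> dx; have := sin_separation (kx i) (knode k).
  have -> : sin (ka * node k) = 2 * level k - 1.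
    by rewrite kan asinK// in_itv /=.
  have -> : sin (ka * x ord0 i) = 2 * u i x - 1 by rewrite /u /fold_coordinate; field.
  rewrite distrC.
  have -> : 2 * level k - 1 - (2 * u i x - 1) = 2 * (level k - u i x).
    by ring.
  rewrite normrM ger0_norm// ler_pM2l//; apply: le_trans.
  set y := (ka * x ord0 i - ka * node k) / 2.
  have -> : sin y ^+ 2 = sin `|y| ^+ 2.
    by case: (ger0P y) => // _; rewrite sinN sqrrN.
  have yE : `|y| = ka * `|x ord0 i - node k| / 2.
    by rewrite /y -mulrBr normrM normrM (gtr0_norm ka0) (ger0_norm (_ : 0 <= 2^-1)).
  have y1 : ka * delta / 2 <= `|y| by rewrite yE ler_pM2r// ler_pM2l.
  have y2 : `|y| <= pi / 2.
    by rewrite ler_norml /y; move: (kx i) (knode k) => /andP[? ?] /andP[? ?]; apply/andP; split; lra.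
  rewrite /eta lerXn2r ?nnegrE ?sin_ge0_pi//.
  - by rewrite ltW//=; lra.
  - by rewrite normr_ge0 /=; lra.
  - by rewrite leNgt ltr_sin -?leNgt// in_itv /=; apply/andP; split; lra.
(* Either [x] and the node are close, or one of the squares below is at least 1. *)
have term (h : {ffun 'I_m -> 'I_N.+2}) : `|f (\row_i node (h i)) - f x| <=
    e + 2 * M * \sum_i ((level (h i) - u i x) ^+ 2 / eta ^+ 2).
  have S0 : 0 <= \sum_i ((level (h i) - u i x) ^+ 2 / eta ^+ 2).
    by apply: sumr_ge0 => i _; rewrite divr_ge0 ?sqr_ge0.
  have [near|/existsNP[i /negP]] := pselect (forall i, `|x ord0 i - node (h i)| < delta).
    rewrite distrC (le_trans (fe _ _))//; first by move=> i; rewrite mxE.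
    by rewrite lerDl mulr_ge0// mulr_ge0.
  rewrite -leNgt => /sep hi.
  apply: le_trans (_ : 2 * M <= _).
    by rewrite (le_trans (ler_normB _ _))// mulrDl mul1r lerD.
  have h1 : 1 <= (level (h i) - u i x) ^+ 2 / eta ^+ 2.
    rewrite ler_pdivlMr; last by rewrite exprn_gt0.
    rewrite mul1r -[leRHS]real_normK ?num_real//.
    by rewrite lerXn2r// nnegrE ltW.
  have h2 : 1 <= \sum_i ((level (h i) - u i x) ^+ 2 / eta ^+ 2).
    rewrite (bigD1 i)//= (le_trans h1)// lerDl.
    by apply: sumr_ge0 => j _; rewrite divr_ge0 ?sqr_ge0.
  rewrite (@le_trans _ _ (2 * M * \sum_i ((level (h i) - u i x) ^+ 2 / eta ^+ 2)))//.
    by rewrite ler_peMr// mulr_ge0.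
  by rewrite lerDr.
have -> : bernstein_trig x - f x =
    \sum_(h : {ffun 'I_m -> 'I_N.+2}) (f (\row_i node (h i)) - f x) * W h x.
  under eq_bigr do rewrite mulrBl.
  by rewrite sumrB -mulr_sumr sumW1 mulr1.
apply: le_trans (ler_norm_sum _ _ _) _.
apply: (@le_trans _ _ (\sum_(h : {ffun 'I_m -> 'I_N.+2}) (e +2 * M * \sum_i ((level (h i) - u i x) ^+ 2 / eta ^+ 2)) * W h x)).
  by apply: ler_sum => h _; rewrite normrM (ger0_norm (W0 h x)) ler_wpM2r.
under eq_bigr do rewrite mulrDl.
rewrite big_split /= -mulr_sumr sumW1 mulr1 lerD2l.
rewrite (eq_bigr (fun h : {ffun 'I_m -> 'I_N.+2} => \sum_i 2 * M / eta ^+ 2 *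
   (W h x * (level (h i) - u i x) ^+ 2))); last first.
  move=> h _; rewrite mulr_sumr mulr_suml; apply: eq_bigr => i _.
  by field; rewrite gt_eqF.
rewrite exchange_big /=.
apply: (@le_trans _ _ (\sum_(i < m) 2 * M / eta ^+ 2 / N.+1%:R)).
  apply: ler_sum => i _; rewrite -mulr_sumr ler_wpM2l ?varW//.
  by apply: divr_ge0; [exact: mulr_ge0 | exact: sqr_ge0].
rewrite sumr_const card_ord -[_ *+ m]mulr_natr (_ : sin (ka * delta / 2) ^+ 4 = eta ^+ 2); last by rewrite /eta -exprM.
by rewrite [leLHS]mulrAC [2 * M / _ * _]mulrAC.
Qed.

End Approximation.

(** Folding each axis by a sine turns a Bernstein polynomial into a
    trigonometric one. Its weights are a partition of unity, so the uniform norm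
    does not increase, even outside the box. *)
Lemma trig_poly_approx (f : 'rV[R]_m -> R) (M L e : R) :
  continuous f -> (forall x, `|f x| <= M) -> 0 < L -> 0 < e ->
  exists p : 'rV[R]_m -> R, [/\ trig_poly (fun x => (p x)%:C%C),
    forall x, `|p x| <= M &
    forall x : 'rV[R]_m, (forall i, `|x ord0 i| <= L) -> `|p x - f x| <= e].
Proof.
move=> cf fM L0 e0.
have e2 : 0 < e / 2 by rewrite divr_gt0.
have [delta d0 fd] := box_uniform_continuity L cf e2.
pose dl := Num.min delta L.
pose K := 2 * M * m%:R / sin (pi / (2 * L) * dl / 2) ^+ 4.
have [N NK] : exists N : nat, `|K| / (e / 2) < N.+1%:R.
  by exists (Num.truncn (`|K| / (e / 2))); exact: truncnS_gt.
exists (bernstein_trig f L N); split.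
- exact: trig_poly_bernstein_trig.
- exact: bernstein_trig_bound.
- move=> x xL; apply: le_trans (@bernstein_trig_error f M fM L L0 N x (e / 2) dl _ xL _ _) _.
  + by move=> y xy; apply: fd => // i; apply: lt_le_trans (xy i) _; rewrite ge_min lexx.
  + by rewrite lt_min d0.
  + by rewrite ge_min lexx orbT.
  rewrite -/K [leRHS]splitr lerD2l ler_pdivrMr ?ltr0n//.
  apply: le_trans (ler_norm _) _; move: NK; rewrite ltr_pdivrMr//.
  by rewrite mulrC => /ltW.
Qed.

End TrigonometricPolynomials.

(** * Gaussian damping and tightness *)

Section MeanSwap.
Context {R : realType} {d1 d2} {T1 : measurableType d1} {T2 : measurableType d2}.
Context (P : probability T1 R) (Q : probability T2 R).

(** Fubini's theorem for bounded functions. *)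
Lemma mean_swap (f : T1 * T2 -> R) : bounded_mfun f ->
  bounded_mfun (fun y => \int[P]_x f (x, y)) /\
  \int[P]_x \int[Q]_y f (x, y) = \int[Q]_y \int[P]_x f (x, y).
Proof.
move=> [mf [M fM]].
have mE : measurable_fun setT (EFin \o f) by exact/measurable_EFinP.
have b1 x : bounded_mfun (fun y => f (x, y)).
  by split; [exact: measurableT_comp mf (pair1_measurable x) | exists M].
have b2 y : bounded_mfun (fun x => f (x, y)).
  by split; [exact: measurableT_comp mf (pair2_measurable y) | exists M].
have M0 : 0 <= M := le_trans (normr_ge0 _) (fM point).
have imf : (P \x Q)%E.-integrable setT (EFin \o f).
  apply/(integrable12ltyP _ _ mE).
  apply: (@le_lt_trans _ _ (\int[P]_x \int[Q]_y M%:E)%E).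
    apply: ge0_le_integral => //.
    - by move=> x _; exact: integral_ge0.
    - apply: (@measurable_fun_fubini_tonelli_F _ _ T1 T2 R Q (abse \o (EFin \o f))).
        exact: measurableT_comp.
      by move=> z; rewrite /= lee_fin.
    - move=> x _; apply: ge0_le_integral => //.
      + by apply: measurableT_comp => //; apply/measurable_EFinP; exact: (b1 x).1.
      + by move=> y _; rewrite /= lee_fin.
  have cstE d (T : measurableType d) (P' : probability T R) : (\int[P']_x M%:E = M%:E)%E.
    by rewrite (@integral_cst _ _ _ P' setT measurableT M%:E) [X in (_ * X)%E]probability_setT mule1.
  under eq_integral do rewrite cstE.
  by rewrite cstE ltry.
have EG y : (\int[P]_x (EFin \o f) (x, y))%E = (\int[P]_x f (x, y))%:E.
  by have := bounded_mfun_expectation P (b2 y); rewrite unlock.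
have EF x : (\int[Q]_y (EFin \o f) (x, y))%E = (\int[Q]_y f (x, y))%:E.
  by have := bounded_mfun_expectation Q (b1 x); rewrite unlock.
split.
  split; last first.
    exists M => y; rewrite -[leRHS](mean_cst P); apply: le_normr_mean => //.
    exact: bounded_mfun_cst.
  apply/measurable_EFinP.
  have := measurable_fubini_G imf; congr measurable_fun; apply/funext => y.
  exact: EG.
have := Fubini imf.
under eq_integral do rewrite EF.
under [X in _ = X -> _]eq_integral do rewrite EG.
by rewrite /Rintegral => ->.
Qed.

End MeanSwap.

Section Damping.
Context {R : realType}.

(** Close to 1 on bounded sets when [u] is small, and small for large [z]. *)
Definition damping (u z : R) : R := expR (- (u * z) ^+ 2 / 2).

Lemma damping_itv u z : 0 <= damping u z <= 1.
Proof.
by rewrite /damping expR_ge0 /= -expR0 ler_expR mulNr oppr_le0 divr_ge0// sqr_ge0.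
Qed.

Lemma dampingC u z : damping u z = damping z u.
Proof. by rewrite /damping (mulrC u). Qed.

Lemma continuous_damping u : continuous (damping u).
Proof.
move=> z; apply: (@continuous_comp _ _ _ (fun z => - (u * z) ^+ 2 / 2) expR).
  apply: cvgMr_tmp; apply: cvgN.
  have cz : u * y @[y --> z] --> u * z by apply: cvgMl_tmp; exact: cvg_id.
  by rewrite expr2; under eq_fun do rewrite expr2; exact: cvgM.
exact: continuous_expR.
Qed.

Lemma bounded_mfun_damping d (T : measurableType d) (Z : T -> R) u :
  measurable_fun setT Z -> bounded_mfun (fun w => damping u (Z w)).
Proof.
move=> mZ; split.
  apply: measurableT_comp => //; apply: continuous_measurable_fun.
  exact: continuous_damping.
by exists 1 => w; rewrite ger0_norm; have /andP[] := damping_itv u (Z w).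
Qed.

Lemma damping_small u z : 0 < u -> 2 / u < `|z| -> 1 <= 2 * (1 - damping u z).
Proof.
move=> u0; rewrite ltr_pdivrMr// => uz.
have h : 2 <= (u * z) ^+ 2 / 2.
  rewrite ler_pdivlMr// -[leRHS]real_normK ?num_real// normrM (gtr0_norm u0).
  rewrite (_ : 2 * 2 = 2 ^+ 2 :> R); last by rewrite expr2.
  by rewrite lerXn2r ?nnegrE ?mulr_ge0 ?(ltW u0)// mulrC ltW.
have : damping u z <= 2^-1.
  rewrite /damping mulNr expRN lef_pV2 ?posrE ?expR_gt0//.
  by apply: le_trans (expR_ge1Dx _); lra.
by move=> ?; lra.
Qed.

Lemma cos_normal (c : R) : \int[normal_prob 0 1]_x cos (c * x) = expR (- c ^+ 2 / 2).
Proof.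
have bF : bounded_mfun (fun x : R => cos (c * x)).
  split; last by exists 1 => x; exact: cos_max.
  apply: continuous_measurable_fun => x.
  apply: (@continuous_comp _ _ _ (fun x => c * x) cos); last exact: continuous_cos.
  by apply: cvgMl_tmp; exact: cvg_id.
rewrite mean_normal_prob//.
have := @normal_trig R 1 ltr01 0 c; rewrite cos0 mul1r expr1n mul1r => <-.
by apply: eq_Rintegral => x _; rewrite addr0.
Qed.

(** The damping factor is a Gaussian mixture of cosines, so its mean is a
    mixture of values of the characteristic function. *)
Lemma mean_damping d (T : measurableType d) (P : probability T R) (Z : T -> R) u :
  measurable_fun setT Z ->
  bounded_mfun (fun x : R => \int[P]_w cos (u * Z w * x)) /\
  \int[P]_w damping u (Z w) = \int[normal_prob 0 1]_x \int[P]_w cos (u * Z w * x).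
Proof.
move=> mZ.
have b : bounded_mfun (fun p : T * R => cos (u * Z p.1 * p.2)).
  split; last by exists 1 => p; exact: cos_max.
  apply: measurableT_comp; first by apply: continuous_measurable_fun; exact: continuous_cos.
  apply: measurable_funM; last exact: measurable_snd.
  by apply: measurable_funM => //; exact: measurableT_comp mZ measurable_fst.
have [b1 E] := mean_swap P (normal_prob 0 1) b.
split; first exact: b1.
by rewrite -E; apply: eq_Rintegral => w _; rewrite /= cos_normal.
Qed.

End Damping.

(** * The continuity theorem for characteristic functions *)

Section TrigPolyMean.
Context {R : realType} (m : nat).
Local Notation C := R[i].

Lemma cbounded_cis d (T : measurableType d) (V : T -> R) :
  measurable_fun setT V -> cbounded (fun w => cis (V w)).
Proof.
move=> mV; apply: cbounded_disc => [|w]; last by rewrite sqnorm_cis.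
exact: (cmeasurable_cis mV).
Qed.

Lemma cbounded_trig_poly (p : 'rV[R]_m -> C) d (T : measurableType d)
    (Z : 'I_m -> T -> R) : (forall i, measurable_fun setT (Z i)) ->
  trig_poly p -> cbounded (fun w => p (\row_i Z i w)).
Proof.
move=> mZ; elim=> [c th|p1 p2 _ IH1 _ IH2]; last exact: cboundedD.
apply: cboundedM; first exact: cbounded_cst.
apply: cbounded_cis; apply: measurable_sum => i; apply: measurable_funM => //.
by rewrite (_ : (fun w => _) = Z i)//; apply/funext => w; rewrite mxE.
Qed.

(** A continuous function is a pointwise limit of trigonometric polynomials,
    which makes it measurable along any measurable vector. *)
Lemma bounded_mfun_row (f : 'rV[R]_m -> R) (M : R) d (T : measurableType d)
    (Z : 'I_m -> T -> R) : (forall i, measurable_fun setT (Z i)) ->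
  continuous f -> (forall x, `|f x| <= M) -> bounded_mfun (fun w => f (\row_i Z i w)).
Proof.
move=> mZ cf fM; split; last by exists M => w.
have /choice[p pP] : forall N : nat, exists p : 'rV[R]_m -> R,
    [/\ trig_poly (fun x => (p x)%:C%C), forall x, `|p x| <= M &
    forall x : 'rV[R]_m, (forall i, `|x ord0 i| <= N.+1%:R) -> `|p x - f x| <= N.+1%:R^-1].
  by move=> N; apply: trig_poly_approx; rewrite ?invr_gt0 ?ltr0n.
apply: (@measurable_fun_cvg _ _ _ setT (fun N w => p N (\row_i Z i w))).
  by move=> N; have [hp _ _] := pP N; have [[]] := cbounded_trig_poly mZ hp.
move=> w _; apply/subr_cvg0; apply/norm_cvg0P.
apply: (@squeeze_cvgr _ _ _ _ (fun=> 0) (fun N : nat => N.+1%:R^-1)).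
- near=> N; rewrite normr_ge0 /=; have [_ _] := pP N; apply => i.
  apply: (@le_trans _ _ (\sum_i `|(\row_i Z i w) ord0 i|)).
    by rewrite (bigD1 i)//= lerDl sumr_ge0.
  apply: le_trans (ltW (truncnS_gt _)) _; rewrite ler_nat ltnS.
  by near: N; exact: nbhs_infty_ge.
- exact: cvg_cst.
- exact: cvg_harmonic.
Unshelve. all: by end_near. Qed.

(** Outside the box some coordinate is large and its damping factor is at most
    1/2, so the sum compensates for the trivial bound [2 * M]. *)
Lemma approx_by_damping (f p : 'rV[R]_m -> R) (M e u : R) (x : 'rV[R]_m) :
  (forall x, `|f x| <= M) -> (forall x, `|p x| <= M) -> 0 < u -> 0 <= e ->
  (forall x : 'rV[R]_m, (forall i, `|x ord0 i| <= 2 / u) -> `|p x - f x| <= e) ->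
  `|f x - p x| <= e + 4 * M * \sum_i (1 - damping u (x ord0 i)).
Proof.
move=> fM pM u0 e0 pf.
have M0 : 0 <= M := le_trans (normr_ge0 _) (fM 0).
have S0 i : 0 <= 1 - damping u (x ord0 i).
  by rewrite subr_ge0; have /andP[] := damping_itv u (x ord0 i).
have [h|/existsNP[i /negP]] := pselect (forall i, `|x ord0 i| <= 2 / u).
  rewrite distrC (le_trans (pf _ h))// lerDl mulr_ge0 ?mulr_ge0//.
  exact: sumr_ge0.
rewrite -ltNge => /(damping_small u0) h.
apply: (@le_trans _ _ (2 * M)).
  by rewrite (le_trans (ler_normB _ _))// mulrDl mul1r lerD.
rewrite -[leLHS]add0r lerD//.
have : 1 <= 2 * \sum_i (1 - damping u (x ord0 i)).
  apply: le_trans h _; rewrite ler_pM2l// (bigD1 i)//= lerDl.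
  exact: sumr_ge0.
move: (\sum_i _) => S S1; rewrite (_ : 4 * M * S = 2 * M * (2 * S)); last by ring.
by rewrite ler_peMr// mulr_ge0.
Qed.

Lemma mean_approx_by_damping (f p : 'rV[R]_m -> R) (M e u : R)
    d (T : measurableType d) (P : probability T R) (Z : 'I_m -> T -> R) :
  continuous f -> (forall x, `|f x| <= M) ->
  trig_poly (fun x => (p x)%:C%C) -> (forall x, `|p x| <= M) ->
  0 < u -> 0 <= e ->
  (forall x : 'rV[R]_m, (forall i, `|x ord0 i| <= 2 / u) -> `|p x - f x| <= e) ->
  (forall i, measurable_fun setT (Z i)) ->
  `|\int[P]_w f (\row_i Z i w) - \int[P]_w p (\row_i Z i w)| <=
    e + 4 * M * \sum_i (1 - \int[P]_w damping u (Z i w)).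
Proof.
move=> cf fM hp pM u0 e0 pf mZ.
have bf := bounded_mfun_row mZ cf fM.
have [bp _] := cbounded_trig_poly mZ hp.
have b1 i : bounded_mfun (fun w => 1 - damping u (Z i w)).
  by apply: bounded_mfunB; [exact: bounded_mfun_cst | exact: bounded_mfun_damping].
have bS : bounded_mfun (fun w => \sum_i (1 - damping u (Z i w))) by exact: bounded_mfun_sum.
have bMS : bounded_mfun (fun w => 4 * M * \sum_i (1 - damping u (Z i w))).
  by apply: bounded_mfunM => //; exact: bounded_mfun_cst.
rewrite -meanB// (_ : e + _ = \int[P]_w (e + 4 * M * \sum_i (1 - damping u (Z i w)))).
  apply: le_normr_mean; first exact: bounded_mfunB.
    by apply: bounded_mfunD => //; exact: bounded_mfun_cst.
  move=> w; have := approx_by_damping (\row_i Z i w) fM pM u0 e0 pf.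
  by under [in leRHS]eq_bigr do rewrite mxE.
rewrite meanD//; last exact: bounded_mfun_cst.
rewrite mean_cst meanZ// mean_sum//; congr (_ + _ * _).
apply: eq_bigr => i _; rewrite meanB ?mean_cst//; first exact: bounded_mfun_cst.
exact: bounded_mfun_damping.
Qed.

End TrigPolyMean.

Section LevyContinuity.
Context {R : realType} (m : nat).
Local Notation C := R[i].
Context {d1} {T1 : measurableType d1} (P1 : probability T1 R).
Context {d2} {T2 : measurableType d2} (P2 : probability T2 R).
Context (Z : nat -> 'I_m -> T1 -> R) (mZ : forall n i, measurable_fun setT (Z n i)).
Context (Y : 'I_m -> T2 -> R) (mY : forall i, measurable_fun setT (Y i)).
Context (ZY : forall th : 'I_m -> R,
  ccvg (fun n => cmean P1 (fun w => cis (\sum_i th i * Z n i w)))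
       (cmean P2 (fun w => cis (\sum_i th i * Y i w)))).

Lemma cvg_mean_trig_poly (p : 'rV[R]_m -> C) : trig_poly p ->
  ccvg (fun n => cmean P1 (fun w => p (\row_i Z n i w)))
       (cmean P2 (fun w => p (\row_i Y i w))).
Proof.
elim=> [c th|p1 p2 hp1 IH1 hp2 IH2]; last first.
  rewrite cmeanD; [|exact: cbounded_trig_poly..].
  under eq_fun do (rewrite cmeanD; [|exact: cbounded_trig_poly..]).
  exact: ccvgD.
have E d (T : measurableType d) (P : probability T R) (X : 'I_m -> T -> R) :
    (forall i, measurable_fun setT (X i)) ->
    cmean P (fun w => c * cis (\sum_i th i * (\row_i X i w) ord0 i)) =
    c * cmean P (fun w => cis (\sum_i th i * X i w)).
  move=> mX; rewrite -cmeanZ; last first.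
    by apply: cbounded_cis; apply: measurable_sum => i; exact: measurable_funM.
  by apply: eq_cmean => w; congr (_ * cis _); apply: eq_bigr => i _; rewrite mxE.
rewrite E//; under eq_fun do rewrite E//.
exact (ccvgZ c (ZY th)).
Qed.

Lemma cvg_mean_damping (u : R) (i : 'I_m) :
  \int[P1]_w damping u (Z n i w) @[n --> \oo] --> \int[P2]_w damping u (Y i w).
Proof.
have [_ ->] := mean_damping P2 u (mY i).
under eq_fun do rewrite (mean_damping P1 u (mZ _ i)).2.
apply: proj2; apply: (@cvg_mean _ _ _ (normal_prob 0 1)
  (fun n x => \int[P1]_w cos (u * Z n i w * x))
  (fun x => \int[P2]_w cos (u * Y i w * x)) 1).
- by move=> n; have [[]] := mean_damping P1 u (mZ n i).
- move=> n x; have bc : bounded_mfun (fun w => cos (u * Z n i w * x)).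
    split; last by exists 1 => w; exact: cos_max.
    apply: measurableT_comp; first by apply: continuous_measurable_fun; exact: continuous_cos.
    by apply: measurable_funM => //; exact: measurable_funM.
  rewrite -[leRHS](mean_cst P1); apply: le_normr_mean => //; first exact: bounded_mfun_cst.
  by move=> w; exact: cos_max.
- move=> x; have [+ _] := ZY (fun j => if j == i then u * x else 0).
  have E d (T : measurableType d) (P : probability T R) (X : 'I_m -> T -> R) :
      Re (cmean P (fun w => cis (\sum_j (if j == i then u * x else 0) * X j w))) =
      \int[P]_w cos (u * X i w * x).
    apply: eq_Rintegral => w _; rewrite (bigD1 i)// eqxx big1 ?addr0; last first.
      by move=> j /negPf ->; rewrite mul0r.
    by rewrite cisE [LHS]/= addr0 mulrAC.
  by rewrite E; under eq_fun do rewrite E.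
Qed.

(** The limit vector alone is tight; convergence of the damping factors makes
    the sequence uniformly tight. *)
Lemma exists_damping (c e : R) : 0 < e ->
  exists2 u, 0 < u & c * \sum_i (1 - \int[P2]_w damping u (Y i w)) < e.
Proof.
move=> e0.
have cvg1 i : \int[P2]_w damping (N.+1%:R^-1) (Y i w) @[N --> \oo] --> (1 : R).
  rewrite -[X in _ --> X](mean_cst P2); apply: proj2.
  apply: (@cvg_mean _ _ _ P2 (fun N w => damping N.+1%:R^-1 (Y i w)) (fun=> 1) 1).
  - by move=> N; exact: (bounded_mfun_damping _ (mY i)).1.
  - by move=> N w; rewrite ger0_norm; have /andP[] := damping_itv N.+1%:R^-1 (Y i w).
  - move=> w; have := cvg_comp _ _ (@cvg_harmonic R) (@continuous_damping R (Y i w) 0).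
    rewrite {2}/damping mulr0 expr0n oppr0 mul0r expR0.
    by under eq_fun do rewrite dampingC.
have : c * \sum_i (1 - \int[P2]_w damping N.+1%:R^-1 (Y i w)) @[N --> \oo] --> (0 : R).
  have E : c * \sum_(i < m) (1 - 1) = 0 by rewrite big1 ?mulr0// => i _; rewrite subrr.
  rewrite -[X in _ --> X]E; apply: cvgMl_tmp.
  apply: (@cvg_sum_seq _ _ _ (fun N i => 1 - \int[P2]_w damping N.+1%:R^-1 (Y i w))) => i.
  by apply: cvgB; [exact: cvg_cst | exact: cvg1].
move/cvgr_lt => /(_ _ e0) [N _ NP]; exists N.+1%:R^-1; first by rewrite invr_gt0 ltr0n.
exact: (NP N (leqnn N)).
Qed.

(** A trigonometric polynomial approximates [f] on a box, and its means converge
    by hypothesis. The damping factors, whose means converge as well, bound the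
    mass outside the box uniformly in [n]. *)
Lemma levy_continuity (f : 'rV[R]_m -> R) :
  continuous f -> (exists M : R, forall x, `|f x| <= M) ->
  'E_P1[fun w => f (\row_i Z n i w)]%E @[n --> \oo] -->
  'E_P2[fun w => f (\row_i Y i w)]%E.
Proof.
move=> cf [M fM].
rewrite (bounded_mfun_expectation P2 (bounded_mfun_row mY cf fM)).
under eq_fun do rewrite (bounded_mfun_expectation P1 (bounded_mfun_row (mZ _) cf fM)).
apply: cvg_EFin; first exact: nearW.
apply/cvgrPdist_lt => e e0.
have e8 : 0 < e / 8 by rewrite divr_gt0.
have [u u0 uY] := exists_damping (4 * M) e8.
have u2 : 0 < 2 / u by rewrite divr_gt0.
have [p [hp pM pf]] := trig_poly_approx cf fM u2 e8.
have [cp _] := cvg_mean_trig_poly hp.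
have cD : 4 * M * \sum_i (1 - \int[P1]_w damping u (Z n i w)) @[n --> \oo] -->
    4 * M * \sum_i (1 - \int[P2]_w damping u (Y i w)).
  apply: cvgMl_tmp.
  apply: (@cvg_sum_seq _ _ _ (fun n i => 1 - \int[P1]_w damping u (Z n i w))) => i.
  by apply: cvgB; [exact: cvg_cst | exact: cvg_mean_damping].
near=> n.
rewrite [X in _ - X]/=.
have h1 := mean_approx_by_damping P2 cf fM hp pM u0 (ltW e8) pf mY.
have h2 := mean_approx_by_damping P1 cf fM hp pM u0 (ltW e8) pf (mZ n).
have h3 : 4 * M * \sum_i (1 - \int[P1]_w damping u (Z n i w)) < e / 8.
  by near: n; move/cvgr_lt: cD; exact.
have h4 : `|\int[P2]_w p (\row_i Y i w) - \int[P1]_w p (\row_i Z n i w)| < e / 8.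
  by near: n; move/cvgrPdist_lt: cp; exact.
have h5 := uY; move: h1 h2 h3 h4 h5; move: (\int[P1]_w f _) (\int[P2]_w f _) => a b.
move: (\int[P1]_w p _) (\int[P2]_w p _) => a' b'.
move: (4 * M * _) (4 * M * _) => s t.
rewrite !ler_norml !ltr_norml => /andP[? ?] /andP[? ?] ? /andP[? ?] ?.
by apply/andP; split; lra.
Unshelve. all: by end_near. Qed.

End LevyContinuity.

(** * Linear combinations of partial sums *)

Section Windows.
Context {R : realType} (m : nat) (th : 'I_m -> R).

(** The coefficient of the k-th summand in a linear combination of partial
    sums of lengths [N i]. *)
Definition window (N : 'I_m -> nat) (k : nat) : R :=
  \sum_i th i * (0 < k <= N i)%N%:R.

Context (N : 'I_m -> nat).

Lemma window_norm k : `|window N k| <= \sum_i `|th i|.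
Proof.
apply: le_trans (ler_norm_sum _ _ _) _; apply: ler_sum => i _.
by rewrite normrM; case: (_ && _); rewrite ?normr1 ?normr0 ?mulr1 ?mulr0.
Qed.

Lemma sum_window1 (H n : nat) (u : nat -> R) : (n < H)%N ->
  \sum_(k < H) (0 < k <= n)%N%:R * u k = \sum_(1 <= k < n.+1) u k.
Proof.
move=> nH; rewrite big_geq_mkord (big_ord_widen_cond H (fun k => 0 < k)%N u nH).
rewrite [RHS]big_mkcond; apply: eq_bigr => k _.
by rewrite ltnS; case: (_ && _); rewrite ?mul1r ?mul0r.
Qed.

Lemma sum_window (H : nat) (u : nat -> R) : (forall i, (N i < H)%N) ->
  \sum_i th i * \sum_(1 <= k < (N i).+1) u k = \sum_(k < H) window N k * u k.
Proof.
move=> NH; under [RHS]eq_bigr do rewrite mulr_suml.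
rewrite exchange_big; apply: eq_bigr => i _.
rewrite -(sum_window1 u (NH i)) mulr_sumr; apply: eq_bigr => k _.
by rewrite mulrA.
Qed.

Lemma sum_window_sqr (H : nat) : (forall i, (N i < H)%N) ->
  \sum_(k < H) window N k ^+ 2 = \sum_i \sum_l th i * th l * (minn (N i) (N l))%:R.
Proof.
move=> NH; transitivity (\sum_(k < H) \sum_i \sum_l th i * th l *
    ((0 < k <= minn (N i) (N l))%N%:R * 1)).
  apply: eq_bigr => k _; rewrite expr2 mulr_suml; apply: eq_bigr => i _.
  rewrite mulr_sumr; apply: eq_bigr => l _.
  rewrite leq_min mulr1; case: (0 < k)%N; rewrite ?mulr0 ?mul0r//=.
  by rewrite -mulnb natrM; ring.
rewrite exchange_big; apply: eq_bigr => i _.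
rewrite exchange_big; apply: eq_bigr => l _.
rewrite -mulr_sumr (sum_window1 (fun=> 1)); last by rewrite gtn_min NH.
by rewrite sumr_const_nat subSS subn0.
Qed.

(** The indicator of an interval jumps at most twice. *)
Lemma window_variation (H : nat) :
  \sum_(k < H) `|window N k.+1 - window N k| <= 2 * \sum_i `|th i|.
Proof.
have one (n : nat) : \sum_(k < H) (k == n :> nat)%:R <= 1 :> R.
  have [nH|Hn] := ltnP n H.
    rewrite (bigD1 (Ordinal nH))//= eqxx big1 ?addr0// => k.
    by rewrite -val_eqE /= => /negPf ->.
  by rewrite big1// => k _; rewrite ltn_eqF// (leq_trans (ltn_ord k)).
apply: (@le_trans _ _ (\sum_(k < H) \sum_i `|th i| * ((k == 0%N :> nat)%:R + (k == N i :> nat)%:R))).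
  apply: ler_sum => k _; rewrite /window -sumrB.
  apply: le_trans (ler_norm_sum _ _ _) _; apply: ler_sum => i _.
  rewrite -mulrBr normrM ler_wpM2l//.
  case: (nat_of_ord k) => [|j] /=; first by case: (0 < N i)%N; rewrite ?subr0 ?normr1 ?normr0 ?lerDl ?addr_ge0.
  rewrite add0r; case: (ltngtP j.+1 (N i)) => //= _; rewrite ?subrr ?normr0//.
  by rewrite sub0r normrN normr1.
rewrite exchange_big /= mulr_sumr; apply: ler_sum => i _.
rewrite -mulr_sumr mulrC ler_wpM2r// big_split /=.
by have := one 0%N; have := one (N i); lra.
Qed.

End Windows.

(** * The characteristic functions of the partial sums *)

Section PartialSums.
Context {R : realType}.
Local Notation C := R[i].

Definition root_scale (n : nat) : R := (Num.sqrt n%:R)^-1.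

Lemma root_scale_ge0 n : 0 <= root_scale n.
Proof. by rewrite invr_ge0 sqrtr_ge0. Qed.

Lemma root_scale_sqr n : root_scale n ^+ 2 = n%:R^-1.
Proof. by rewrite exprVn sqr_sqrtr. Qed.

Lemma cvg_root_scale : root_scale n @[n --> \oo] --> (0 : R).
Proof.
apply/cvgrPdist_lt => e e0; near=> n.
have n0 : 0 < n%:R :> R by rewrite ltr0n; near: n; exact: nbhs_infty_gt.
rewrite sub0r normrN ger0_norm ?root_scale_ge0// -(ltr_pXn2r (_ : 0 < 2)%N) ?nnegrE ?root_scale_ge0 ?ltW//.
rewrite root_scale_sqr invf_plt ?posrE ?exprn_gt0//.
apply: lt_le_trans (truncnS_gt _) _; rewrite ler_nat.
by near: n; exact: nbhs_infty_ge.
Unshelve. all: by end_near. Qed.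

Lemma cvg_steps (t : R) : 0 <= t ->
  root_scale n ^+ 2 * (Num.truncn (n%:R * t))%:R @[n --> \oo] --> t.
Proof.
move=> t0; rewrite -cvg_shiftS; have := cvg_truncn_approx t0.
rewrite (_ : (fun n => _) = [sequence root_scale n.+1 ^+ 2 * (Num.truncn (n.+1%:R * t))%:R]_n)//.
by apply/funext => n; rewrite /= root_scale_sqr mulrC.
Qed.

Lemma min_truncn (n : nat) (s t : R) :
  minn (Num.truncn (n%:R * s)) (Num.truncn (n%:R * t)) = Num.truncn (n%:R * Num.min s t).
Proof.
case: (leP s t) => [st|/ltW st].
  by apply/minn_idPl; apply: le_truncn; rewrite ler_wpM2l.
by apply/minn_idPr; apply: le_truncn; rewrite ler_wpM2l.
Qed.

Context (lam : R) (lam0 : 0 < lam) {d} {T : measurableType d} (P : probability T R).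
Context (a : T -> R) (X : nat -> T -> nat) (law : inar1_law lam P a X).

Definition centred k w : R := (X k w)%:R - lam / (1 - a w).

Context (m : nat) (t th : 'I_m -> R) (t0 : forall i, 0 <= t i).
Let N (n : nat) (i : 'I_m) : nat := Num.truncn (n%:R * t i).
(* A horizon beyond all the partial sums, where the weights vanish. *)
Let H (n : nat) : nat := (\sum_i N n i).+1.
Let c (n : nat) : nat -> R := window th (N n).
Let mu (x : R) : R := lam / (1 - x).

Let NH n i : (N n i < H n)%N.
Proof. by rewrite /H ltnS (bigD1 i)//= leq_addr. Qed.

Let Hscale n : (H n)%:R * root_scale n ^+ 2 <= \sum_i t i + 1.
Proof.
have S0 : 0 <= \sum_i t i by exact: sumr_ge0.
case: n => [|n].
  by rewrite root_scale_sqr invr0 mulr0 addr_ge0.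
rewrite root_scale_sqr ler_pdivrMr ?ltr0n// /H -natr1 natr_sum mulrDl mul1r mulr_suml.
apply: lerD; last by rewrite ler1n.
apply: ler_sum => i _; rewrite mulrC truncn_le mulr_ge0//.
Qed.

Let combination n w :
  cis (\sum_i th i * partial_sum_process centred n (t i) w) =
  cis (- (root_scale n * mu (a w) * \sum_(k < H n) c n k)) *
  \prod_(k < H n) cis (root_scale n * c n k) ^+ X k w.
Proof.
have -> : \sum_i th i * partial_sum_process centred n (t i) w =
    root_scale n * \sum_(k < H n) c n k * centred k w.
  rewrite -(sum_window th (centred ^~ w) (NH n)) mulr_sumr; apply: eq_bigr => i _.
  by rewrite /partial_sum_process mulrCA.
rewrite (eq_bigr (fun k : 'I_(H n) => cis ((X k w)%:R * (root_scale n * c n k)))); last first.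
  move=> k _; rewrite /cis cexpX; congr cexp.
  by rewrite mulrCA; congr (_ * _); rewrite [RHS]rmorphM [in RHS]rmorph_nat.
rewrite /cis -cexp_sum -cexpD; congr cexp.
rewrite -mulr_sumr -rmorph_sum -mulrDr -rmorphD; congr (_ * _%:C)%C.
rewrite mulr_sumr -mulrA mulr_sumr mulr_sumr -sumrN -big_split.
by apply: eq_bigr => k _; rewrite /centred -/(mu (a w)) /=; ring.
Qed.

Let s2 := brownian_covariance t th.

Let cvg_sqr : root_scale n ^+ 2 * \sum_(k < H n) c n k ^+ 2 @[n --> \oo] --> s2.
Proof.
under eq_fun do rewrite (sum_window_sqr th (NH _)) mulr_sumr.
apply: (@cvg_sum_seq _ _ _ (fun n i => root_scale n ^+ 2 *
   \sum_l th i * th l * (minn (N n i) (N n l))%:R)) => i.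
under eq_fun do rewrite mulr_sumr.
apply: (@cvg_sum_seq _ _ _ (fun n l => root_scale n ^+ 2 *
   (th i * th l * (minn (N n i) (N n l))%:R))) => l.
under eq_fun do rewrite min_truncn mulrCA.
by apply: cvgMl_tmp; apply: cvg_steps; rewrite le_min !t0.
Qed.

(** The characteristic function is a value of the joint generating function at
    points of the unit circle, with the centring as a function of the parameter.
    Its logarithm converges for each value of the parameter, and dominated
    convergence applies because a generating function stays in the unit disc. *)
Lemma cvg_cmean_cis_partial_sums :
  ccvg (fun n => cmean P (fun w => cis (\sum_i th i * partial_sum_process centred n (t i) w)))
    (\int[P]_w expR (- (lam * (1 + a w) / (1 - a w) ^+ 2 / 2 * s2)))%:C%C.
Proof.
pose z n k : C := cis (root_scale n * c n k).
pose g n x : C := cis (- (root_scale n * mu x * \sum_(k < H n) c n k)).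
pose L n x : C := g n x * cexp (log_pgf lam x (z n) (H n) 1).
have ma := law_malpha law; have a01 := law_alpha01 law.
have z1 n k : sqnorm (z n k) <= 1 by rewrite sqnorm_cis.
have mg n : cmeasurable (g n).
  apply: cmeasurable_cexp; apply: cmeasurableM; first exact: cmeasurable_cst.
  apply: cmeasurable_real; apply: measurable_funN; apply: measurable_funM => //.
  apply: measurable_funM => //; apply: measurable_funM => //.
  by apply: (measurableT_comp measurable_inv); exact: measurable_funB.
have mL n : cmeasurable (L n).
  apply: cmeasurableM => //; apply: cmeasurable_cexp; apply: cmeasurable_log_pgf.
  exact: cmeasurable_cst.
have L1 n w : sqnorm (L n (a w)) <= 1.
  rewrite sqnormM sqnorm_cis mul1r; apply: sqnorm_cexp_le1.
  by apply: Re_log_pgf_le0 => //; rewrite sqnorm1.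
have -> : (fun n => cmean P (fun w => cis (\sum_i th i * partial_sum_process centred n (t i) w))) =
    (fun n => cmean P (fun w => L n (a w))).
  apply/funext => n; rewrite -(law_pgf law (H n) (z1 n) (mg n) (K := 1)); last first.
    by move=> x _; rewrite sqnorm_cis.
  by apply: eq_cmean => w; exact: combination.
rewrite (_ : (\int[P]_w _)%:C%C = cmean P (fun w =>
    (expR (- (lam * (1 + a w) / (1 - a w) ^+ 2 / 2 * s2)))%:C%C)); last first.
  by apply: complex_ext => //=; rewrite mean_cst.
apply: proj2; apply: (@cvg_cmean _ _ _ P (fun n w => L n (a w)) _ (1 + 1)).
- by move=> n; apply: cbounded_disc => // ; exact (cmeasurable_comp_alpha ma (mL n)).
- by move=> n w; exact: coord_le_sqnorm.
move=> w; rewrite -cexp_real.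
rewrite (_ : L ^~ (a w) = fun n => cexp (log_pgf lam (a w) (z n) (H n) 1 -
    ('i * (root_scale n * (lam / (1 - a w)) * \sum_(k < H n) c n k)%:C)%C)); last first.
  apply/funext => n; rewrite /L /g /cis -cexpD addrC; congr (cexp (_ + _)).
  by rewrite rmorphN mulrN.
apply: ccvg_cexp; rewrite -mulNr.
pose K := 2 * (\sum_i `|th i|) + (\sum_i t i + 1).
have T0 : 0 <= \sum_i `|th i| by exact: sumr_ge0.
have S0 : 0 <= \sum_i t i by exact: sumr_ge0.
rewrite mulNr; apply: (@cvg_log_pgf R lam (a w) K s2 c H root_scale (a01 w)).
- by rewrite /K; lra.
- exact: root_scale_ge0.
- exact: cvg_root_scale.
- by move=> n k; apply: le_trans (window_norm _ _ _) _; rewrite /K; lra.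
- move=> n; rewrite /c /window big1// => i _.
  by rewrite (leqNgt (H n)) NH andbF mulr0.
- by move=> n; apply: le_trans (Hscale n) _; rewrite /K; lra.
- by move=> n; apply: le_trans (window_variation _ _ _) _; rewrite /K; lra.
- exact: cvg_sqr.
Qed.

End PartialSums.

(** * Almost sure identification of the centring *)

Section AlmostSureVersions.
Context {R : realType}.

Lemma ae_eq_expectation d (T : measurableType d) (P : probability T R) (f g : T -> R) :
  bounded_mfun f -> bounded_mfun g -> {ae P, forall w, f w = g w} ->
  ('E_P[f] = 'E_P[g])%E.
Proof.
move=> bf bg fg; rewrite !unlock; apply: ae_eq_integral => //.
- by apply/measurable_EFinP; exact: bf.1.
- by apply/measurable_EFinP; exact: bg.1.
- by apply: filterS fg => w /= -> _.
Qed.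

Lemma same_law_ae d (T : measurableType d) (P : probability T R)
    d' (T' : measurableType d') (P' : probability T' R) (a : T -> R) (a' : T' -> R) :
  measurable_fun setT a' -> same_law P' a' P a -> (forall w, 0 < a w < 1) ->
  {ae P', forall w, 0 < a' w < 1}.
Proof.
move=> ma' aa' a01; pose E : set R := `]0, 1[%classic.
have mE : measurable E by exact: measurable_itv.
have mE' : measurable (a' @^-1` E) by rewrite -[_ @^-1` _]setTI; exact: ma'.
exists (~` (a' @^-1` E)); split; first exact: measurableC.
  rewrite probability_setC// aa'// (_ : a @^-1` E = setT) ?probability_setT ?subee//.
  by apply/seteqP; split => // w _; rewrite /E /= in_itv /=; exact: a01.
by move=> w /= h h'; apply: h; move: h'; rewrite /E /= in_itv.
Qed.

(** The parameter agrees with its truncation almost surely, so the integrals of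
    [X k] over events about either of them are the same. *)
Lemma cond_exp_inar1 (lam : R) d (T : measurableType d) (P : probability T R)
    (a : T -> R) (X : nat -> T -> nat) (k : nat) (Y : T -> \bar R) :
  0 < lam -> measurable_fun setT a -> {ae P, forall w, 0 < a w < 1} ->
  inar1_law lam P (clamp01 \o a) X ->
  is_cond_exp P (g_sigma_algebra_preimage a) (fun w => (X k w)%:R%:E) Y ->
  {ae P, forall w, Y w = (lam / (1 - clamp01 (a w)))%:E}.
Proof.
move=> lam0 ma a01 law XY.
have c1 x : 0 < 1 - clamp01 x by have := clamp01_itv x; rewrite subr_gt0 => /andP[].
pose h x := lam / (1 - clamp01 x).
have mh : measurable_fun setT h.
  apply: measurable_funM => //; apply: (measurableT_comp (@measurable_inv R)).
  by apply: measurable_funB => //; exact: measurable_clamp01.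
have h0 x : 0 < h x by apply: divr_gt0 => //; exact: c1.
apply: (@cond_exp_unique _ _ _ P a ma h mh (fun x _ => h0 x) _ _ XY _ a01).
move=> A e mA e0 Ae.
have mD1 : measurable (a @^-1` A) by rewrite -[_ @^-1` _]setTI; exact: ma.
have mD2 : measurable ((clamp01 \o a) @^-1` A).
  by rewrite -[_ @^-1` _]setTI; exact: (law_malpha law).
have mX : measurable_fun setT (fun w => (X k w)%:R%:E : \bar R).
  apply/measurable_EFinP.
  by apply: (measurable_fun_nat_index (F := fun n (_ : T) => n%:R : R) (law_mX law k)) => n.
have ind : {ae P, forall w, (w \in a @^-1` A) = (w \in (clamp01 \o a) @^-1` A)}.
  apply: filterS a01 => w aw.
  by apply/idP/idP => /set_mem Aw; apply/mem_set; move: Aw; rewrite /= clamp01_id.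
transitivity (\int[P]_(w in (clamp01 \o a) @^-1` A) (X k w)%:R%:E)%E.
  rewrite integral_mkcond [RHS]integral_mkcond; apply: ae_eq_integral => //.
  - by apply/(measurable_restrictT _ _).1 => //; exact: measurable_funTS.
  - by apply/(measurable_restrictT _ _).1 => //; exact: measurable_funTS.
  - by apply: filterS ind => w wE _; rewrite !patchE wE.
rewrite (integral_inar1 lam0 law k mA e0); last by move=> x /Ae /= /andP[].
set F := fun w => _ : R; have bF : bounded_mfun F.
  split.
    apply: measurable_funM; first exact: measurable_indic.
    exact: (measurableT_comp mh ma).
  exists (lam / e) => w; rewrite /F indicE; case: (boolP (w \in _)) => [/set_mem /Ae /= /andP[_ h1]|_].
    rewrite mul1r ger0_norm; last by rewrite ltW// (h0 (a w)).
    rewrite ler_pM2l// lef_pV2 ?posrE//; last exact: c1.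
    by move: h1; rewrite /= => h1; lra.
  by rewrite mul0r normr0 divr_ge0 ?ltW.
have := bounded_mfun_expectation P bF; rewrite unlock => <-.
rewrite [RHS]integral_mkcond; apply: ae_eq_integral => //.
- by apply/measurable_EFinP; exact: bF.1.
- apply/(measurable_restrictT _ _).1 => //; apply: measurable_funTS.
  by apply/measurable_EFinP; exact: measurableT_comp mh ma.
- apply: filterS ind => w wE _; rewrite patchE wE /F /= indicE.
  by case: (_ \in _); rewrite ?mul1r ?mul0r.
Qed.

End AlmostSureVersions.

(** * The limit theorem *)

Theorem proposition4p2 (R : realType) (lambda : R) (hlambda : 0 < lambda)
  (* alpha and the randomized INAR(1) process with Poisson innovations *)
  (d : measure_display) (T : measurableType d) (P : probability T R)
  (alpha : {RV P >-> R}) (halpha : forall w, 0 < alpha w < 1)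
  (X0 : {RV P >-> nat}) (xi : nat -> nat -> {RV P >-> nat})
  (eps : nat -> {RV P >-> nat})
  (hinputs : randomized_inar1_inputs P lambda alpha X0 xi eps)
  (* a copy (alpha1, X1) of it *)
  (d1 : measure_display) (T1 : measurableType d1) (P1 : probability T1 R)
  (alpha1 : {RV P1 >-> R}) (X1 : nat -> {RV P1 >-> nat})
  (hcopy : same_law
     P1 (fun w => (alpha1 w, (fun k => X1 k w) : seq_space nat))
     P (fun w => (alpha w, (fun k => inar1 X0 xi eps k w) : seq_space nat)))
  (* versions of the conditional expectations E(X1_k | alpha1) *)
  (condE : nat -> T1 -> \bar R)
  (hcondE : forall k, is_cond_exp P1 (g_sigma_algebra_preimage alpha1)
     (fun w => (X1 k w)%:R%:E) (condE k))
  (* alpha (up to law) and an independent standard Brownian motion *)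
  (d2 : measure_display) (T2 : measurableType d2) (P2 : probability T2 R)
  (alpha2 : {RV P2 >-> R}) (halpha2 : same_law P2 alpha2 P alpha)
  (B : R -> {RV P2 >-> R}) (hB : standard_brownian_motion P2 B)
  (hindep : indep_of_process P2 alpha2 B) :
  fdd_cvg
    P1 (partial_sum_process (fun k w => (X1 k w)%:R - fine (condE k w)))
    P2 (fun t w =>
      Num.sqrt (lambda * (1 + alpha2 w)) / (1 - alpha2 w) * B t w).

Proof.
have malpha : measurable_fun setT alpha by exact: measurable_funPT.
have malpha1 : measurable_fun setT alpha1 by exact: measurable_funPT.
have malpha2 : measurable_fun setT alpha2 by exact: measurable_funPT.
have mX1 k : measurable_fun setT (X1 k) by exact: measurable_funPT.
have law := inar1_law_copy hlambda (inar1_law_inputs hlambda halpha hinputs) malpha1 mX1 hcopy.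
have alpha12 : same_law P1 alpha1 P alpha.
  move=> A mA; have := hcopy (A `*` setT) (measurableX mA measurableT).
  have pre U (a : U -> R) (x : U -> seq_space nat) :
      (fun w => (a w, x w)) @^-1` (A `*` setT) = a @^-1` A.
    by apply/seteqP; split => w //= [].
  by rewrite !pre.
have a1_01 := same_law_ae malpha1 alpha12 halpha.
have a2_01 := same_law_ae malpha2 halpha2 halpha.
pose S k w := (X1 k w)%:R - fine (condE k w).
(* The truncated parameter and the explicit conditional means replace [alpha1]
   and the given versions; this changes nothing outside a null event. *)
pose S' := centred lambda (clamp01 \o alpha1) X1.
have mcond k : measurable_fun setT (condE k).
  exact: (cond_exp_measurable malpha1 (hcondE k)).
have mS k : measurable_fun setT (S k).
  apply: measurable_funB.
    by apply: (measurable_fun_nat_index (F := fun n (_ : T1) => n%:R : R) (mX1 k)) => n.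
  exact: measurableT_comp.
have mpartial (V : nat -> T1 -> R) n s : (forall k, measurable_fun setT (V k)) ->
    measurable_fun setT (partial_sum_process V n s).
  move=> mV; apply: measurable_funM => //.
  exact: measurable_sum.
have SS' : {ae P1, forall w, forall k, S k w = S' k w}.
  apply/ae_foralln => k.
  have := cond_exp_inar1 hlambda malpha1 a1_01 law (hcondE k).
  by apply: filterS => w; rewrite /S /S' /centred => ->.
have mS' k : measurable_fun setT (S' k).
  apply: measurable_funB.
    by apply: (measurable_fun_nat_index (F := fun n (_ : T1) => n%:R : R) (mX1 k)) => n.
  apply: measurable_funM => //; apply: (measurableT_comp (@measurable_inv R)).
  by apply: measurable_funB => //; exact: (law_malpha law).
have msqrt : measurable_fun setT (@Num.sqrt R).
  by apply: continuous_measurable_fun; exact: sqrt_continuous.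
pose h x := Num.sqrt (lambda * (1 + clamp01 x)) / (1 - clamp01 x).
have h0 x : 0 <= h x.
  by have /andP[_ x1] := clamp01_itv x; rewrite divr_ge0// subr_ge0 ltW.
have mh : measurable_fun setT h.
  apply: measurable_funM.
    apply: (measurableT_comp msqrt).
    apply: measurable_funM => //; apply: measurable_funD => //; exact: measurable_clamp01.
  apply: (measurableT_comp (@measurable_inv R)).
  by apply: measurable_funB => //; exact: measurable_clamp01.
move=> m t t0 f cf [M fM].
pose Y (i : 'I_m) w := h (alpha2 w) * B (t i) w.
have mY i : measurable_fun setT (Y i).
  by apply: measurable_funM; [exact: measurableT_comp mh malpha2 | exact: measurable_funPT].
pose Y0 (i : 'I_m) w := Num.sqrt (lambda * (1 + alpha2 w)) / (1 - alpha2 w) * B (t i) w.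
have mY0 i : measurable_fun setT (Y0 i).
  apply: measurable_funM; last exact: measurable_funPT.
  apply: measurable_funM.
    apply: (measurableT_comp msqrt).
    by apply: measurable_funM => //; exact: measurable_funD.
  by apply: (measurableT_comp (@measurable_inv R)); exact: measurable_funB.
rewrite (_ : ('E_P2[fun w => f (\row_i _)])%E = ('E_P2[fun w => f (\row_i Y i w)])%E); last first.
  apply: ae_eq_expectation.
  - exact: (bounded_mfun_row mY0 cf fM).
  - exact: (bounded_mfun_row mY cf fM).
  - apply: filterS a2_01 => w w01; congr f; apply/rowP => i; rewrite !mxE.
    by rewrite /Y /h clamp01_id.
rewrite (_ : (fun n => _) = (fun n => 'E_P1[fun w => f (\row_i partial_sum_process S' n (t i) w)])%E); last first.
  apply/funext => n; apply: ae_eq_expectation.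
  - by apply: (bounded_mfun_row _ cf fM) => i; exact: mpartial.
  - by apply: (bounded_mfun_row _ cf fM) => i; exact: mpartial.
  - apply: filterS SS' => w SS'w; congr f; apply/rowP => i; rewrite !mxE.
    rewrite /partial_sum_process; congr (_ * _).
    by apply: eq_bigr => k _; exact: SS'w.
apply: (@levy_continuity R m _ _ P1 _ _ P2 (fun n i => partial_sum_process S' n (t i))) => //.
- by move=> n i; exact: mpartial.
- move=> th.
  rewrite (_ : cmean P2 _ = (\int[P2]_w expR (- (h (alpha2 w) ^+ 2 * brownian_covariance t th) / 2))%:C%C); last first.
    rewrite -(cmean_cis_brownian_mixture hB malpha2 hindep th t0 mh h0).
    apply: eq_cmean => w; congr cis; rewrite mulr_sumr; apply: eq_bigr => i _.
    by rewrite /Y mulrCA.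
  (* Both parameters have the law of [alpha], hence the two limits agree. *)
  pose G x : R := expR (- (h x ^+ 2 * brownian_covariance t th) / 2).
  have mG : measurable_fun setT G.
    apply: measurableT_comp => //; apply: measurable_funM => //; apply: measurable_funN.
    by apply: measurable_funM => //; exact: measurable_funX.
  have bG d' (T' : measurableType d') (a : T' -> R) : measurable_fun setT a -> bounded_mfun (G \o a).
    move=> ma; split; first exact: measurableT_comp.
    exists 1 => w; rewrite /G /= ger0_norm ?expR_ge0// -expR0 ler_expR mulNr oppr_le0.
    by rewrite divr_ge0// mulr_ge0 ?sqr_ge0// brownian_covariance_ge0.
  have EG : \int[P2]_w G (alpha2 w) = \int[P1]_w G (alpha1 w).
    rewrite (same_law_mean malpha2 malpha halpha2 mG (bG _ _ _ malpha2) (bG _ _ _ malpha)).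
    by rewrite (same_law_mean malpha1 malpha alpha12 mG (bG _ _ _ malpha1) (bG _ _ _ malpha)).
  rewrite EG; have := cvg_cmean_cis_partial_sums hlambda law th t0.
  congr (ccvg _ (_%:C)%C); apply: eq_Rintegral => w _; rewrite /G; congr expR.
  rewrite /h /= -/(clamp01 _); have /andP[c0 c1] := clamp01_itv (alpha1 w).
  rewrite exprMn sqr_sqrtr ?exprVn; last by rewrite mulr_ge0 ?addr_ge0// ltW.
  by rewrite mulNr; congr (- _); rewrite mulrAC.
- by exists M.
Qed.
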